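(* Let $f:\mathbb{C}\to\mathbb{C}$ be a transcendental entire function and let $R>0$ be such that $M(r,f)>r$ for all $r\ge R$. If the complement $A_R(f)^c=\mathbb{C}\setminus A_R(f)$ has a bounded connected component, then each of $A_R(f)$, $A(f)$ and $I(f)$ is a spider's web.
   Context: $\mathbb{N}=\{1,2,\dots\}$; $f^n$ denotes the $n$th iterate of $f$. $M(r,f)=\max_{|z|=r}|f(z)|$ for $r>0$, and $M^n(r,f)$ denotes the $n$th iterate of $r\mapsto M(r,f)$. The escaping set is $I(f)=\{z: f^n(z)\to\infty\text{ as } n\to\infty\}$. $A_R(f)=\{z: |f^n(z)|\ge M^n(R,f)\text{ for all } n\in\mathbb{N}\}$. The fast escaping set is $A(f)=\{z:\text{there exists } L\in\mathbb{N}\text{ such that } |f^{n+L}(z)|\ge M^n(R,f)\text{ for all } n\in\mathbb{N}\}$; it does not depend on the choice of $R$ with $M(r,f)>r$ for $r\ge R$. A set $E\subset\mathbb{C}$ is a spider's web if $E$ is connected and there exists a sequence of bounded simply connected domains $G_n$, $n\in\mathbb{N}$, with $G_n\subset G_{n+1}$ and $\partial G_n\subset E$ for all $n\in\mathbb{N}$, and $\bigcup_{n\in\mathbb{N}}G_n=\mathbb{C}$. *)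

(* Defs.v *)
From HB Require Import structures.
From mathcomp Require Import all_boot all_order all_algebra.
From mathcomp Require Import complex.
From mathcomp Require Import all_classical all_reals all_analysis.

Set Implicit Arguments.
Unset Strict Implicit.
Unset Printing Implicit Defensive.

Import Order.TTheory GRing.Theory Num.Theory.
Import numFieldNormedType.Exports.
Export numFieldNormedType.Exports.

Local Open Scope classical_set_scope.
Local Open Scope ring_scope.

(* The library topologizes [K^o] for [K : numFieldType] by the norm; this makes
   that structure available on the concrete type [R[i]], as a normed module
   over itself, so that [derivable] is complex differentiability. *)
HB.instance Definition _ (R : realType) := PseudoPointedMetric.copy R[i] R[i]^o.
HB.instance Definition _ (R : realType) := NormedModule.copy R[i] R[i]^o.

Section Topology.
Context {R : realType}.
Implicit Types (G E : set R[i]) (g : R -> R[i]).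

Definition boundary E : set R[i] := closure E `\` E°.

Definition loop_in G g :=
  [/\ {within `[0, 1], continuous g}, g @` `[0, 1] `<=` G & g 0 = g 1].

(* [g] contracts in [G] to its base point, the base point being kept fixed. *)
Definition null_homotopic_in G g := exists H : R * R -> R[i],
  [/\ {within `[0, 1] `*` `[0, 1], continuous H},
      H @` (`[0, 1] `*` `[0, 1]) `<=` G,
      {in `[0, 1], forall t, H (0, t) = g t /\ H (1, t) = g 0} &
      {in `[0, 1], forall s, H (s, 0) = g 0 /\ H (s, 1) = g 0}].

Definition domain G := [/\ G !=set0, open G & connected G].

Definition simply_connected_domain G :=
  domain G /\ forall g, loop_in G g -> null_homotopic_in G g.

Definition spiders_web E :=
  connected E /\
  exists G : nat -> set R[i],
    [/\ forall n, simply_connected_domain (G n) /\ bounded_set (G n),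
        forall n, G n `<=` G n.+1,
        forall n, boundary (G n) `<=` E &
        \bigcup_n G n = [set: R[i]]].

Definition has_bounded_component E :=
  exists2 z, E z & bounded_set (connected_component E z).

End Topology.

Section Dynamics.
Context {R : realType}.
Implicit Types (f : R[i] -> R[i]) (r : R).

Definition entire f := forall z, derivable f z 1.

Definition transcendental f := ~ exists p : {poly R[i]}, forall z, f z = p.[z].

(* For [f] continuous and [r >= 0] the set is nonempty and compact, so that the
   supremum is a maximum. *)
Definition maxmod f r : R :=
  sup [set Normc.normc (f z) | z in [set z | Normc.normc z = r]].

Definition escaping_set f : set R[i] :=
  [set z | Normc.normc (iter n f z) @[n --> \oo] --> +oo].

Definition A_ r f : set R[i] :=
  [set z | forall n, (0 < n)%N ->
     iter n (maxmod f) r <= Normc.normc (iter n f z)].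

(* The set does not depend on [r] as long as [maxmod f s > s] for [s >= r]. *)
Definition fast_escaping_set r f : set R[i] :=
  [set z | exists2 L, (0 < L)%N & forall n, (0 < n)%N ->
     iter n (maxmod f) r <= Normc.normc (iter (n + L) f z)].

End Dynamics.

(* Main.v *)
Require Import Defs.
From HB Require Import structures.
From mathcomp Require Import all_boot all_order all_algebra.
From mathcomp Require Import complex.
From mathcomp Require Import zify ring lra.
From mathcomp Require Import all_classical all_reals all_analysis.

Set Implicit Arguments.
Unset Strict Implicit.
Unset Printing Implicit Defensive.

Import Order.TTheory GRing.Theory Num.Theory.
Import numFieldNormedType.Exports.

Local Open Scope classical_set_scope.
Local Open Scope ring_scope.

(** The sets [A_ (M^m(r0)) f], and their analogues with delayed orbits, are closed
and have no bounded components: a point of such a set that could be enclosed by a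
curve avoiding the set would contradict the maximum principle for some iterate of
[f]. Hence the components of their complements have no holes, and in particular
the components around [0], called cores here, are simply connected as soon as they
are bounded. The iterate [f^m] maps the boundary of a component of the complement
of [A_ r0 f] into [A_ (M^m(r0)) f], so if that component is bounded its image
covers the [m]-th core for all large [m]. The cores are then bounded, increase to
the whole plane, and have their boundary in [A_ r0 f].

A closed plane set is connected if it has no bounded components and its complement
has only bounded ones; this gives [A_ r0 f] and the delayed sets, whose increasing
union is [A(f)]. If [I(f)] split, a part [Q] would avoid the closure of [A(f)],
hence contain a point of a bounded component [U] of the complement of that closure.
The orbit of [U] never crosses the boundary of a core, so the closure of [U]
escapes as a whole, and it joins [Q] to the closure of [A(f)].

The function theory needed is derived from Goursat's lemma for trapezoid sums,
without integrals; simple connectivity comes from contracting grid walks around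
which all squares of odd winding number lie in the domain. *)

(** * Complex numbers and their topology *)

Section Complex.
Context {R : realType}.
Implicit Types (z w : R[i]) (A : set R[i]).
Local Notation C := R[i].
Local Notation N := Normc.normc.
Local Notation Re := complex.Re.
Local Notation Im := complex.Im.
Local Open Scope complex_scope.

(** Since [maxmod f] is strictly increasing, by the strong maximum principle, a point whose orbit
    has once fallen behind the radii stays behind, and points near it are behind at the same time.
    By compactness a single iterate then serves a whole boundary, which is the uniformity that the
    maximum principle needs to exclude bounded parts. The same permanence explains why the image of
    a bounded component meets the [m]-th core for large [m]: a point of the component has fallen
    behind, so its [m]-th image lies in the disc of radius [rad m]. Holes and bounded parts are
    tested with bounded open sets and their boundaries, so that no Jordan curve is needed. Trapezoid
    sums only give an estimate of Cauchy's type with the constant 4, which disappears on passing to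
    powers of the function. What results bounds a value by a bound on an annulus around it, without
    strictness, so the global principle needs a perturbation that makes the maximum strict. *)

Lemma ex_natr_gt (x : R) : exists n : nat, x < n%:R.
Proof. by exists (Num.truncn x).+1; exact: truncnS_gt. Qed.

Lemma normCE z : `|z| = (N z)%:C. Proof. by []. Qed.

Lemma normc_ge0 z : 0 <= N z :> R.
Proof. by rewrite -lecR -normCE normr_ge0. Qed.

Lemma normc_le_add z w : N (z + w) <= N z + N w.
Proof. by rewrite -lecR rmorphD -!normCE ler_normD. Qed.

Lemma normcN z : N (- z) = N z.
Proof. by apply: complexI; rewrite -!normCE normrN. Qed.

Lemma normcBC z w : N (z - w) = N (w - z).
Proof. by rewrite -normcN opprB. Qed.

Lemma normc_eq0 z : (N z == 0) = (z == 0).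
Proof.
apply/eqP/eqP => [/Normc.eq0_normc//|->]; exact: Normc.normc0.
Qed.

Lemma normc_gt0 z : (0 < N z) = (z != 0).
Proof. by rewrite lt_def normc_eq0 normc_ge0 andbT. Qed.

Lemma normcX z n : N (z ^+ n) = N z ^+ n.
Proof. by elim: n => [|n IH]; rewrite ?Normc.normc1// !exprS Normc.normcM IH. Qed.

Lemma normc_real (x : R) : N x%:C = `|x|.
Proof. by rewrite /= expr0n/= addr0 sqrtr_sqr. Qed.

Lemma normc_dist z w : `|N z - N w| <= N (z - w).
Proof.
rewrite ler_norml; apply/andP; split.
  by rewrite lerNl opprB lerBlDr normcBC (le_trans _ (normc_le_add _ _))// subrK.
by rewrite lerBlDr (le_trans _ (normc_le_add _ _))// subrK.
Qed.

Lemma normc_dist_le w z z' : N (z - z') <= N (z - w) + N (w - z').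
Proof. by rewrite (le_trans _ (normc_le_add _ _))// addrA subrK. Qed.

Lemma normcE2 z : N z ^+ 2 = Re z ^+ 2 + Im z ^+ 2.
Proof. by case: z => a b /=; rewrite sqr_sqrtr// addr_ge0// sqr_ge0. Qed.

Lemma Re_le_normc z : `|Re z| <= N z.
Proof.
rewrite -(@ler_pXn2r _ 2)// ?nnegrE ?normc_ge0 ?normr_ge0// normcE2 real_normK ?num_real//.
by rewrite lerDl sqr_ge0.
Qed.

Lemma Im_le_normc z : `|Im z| <= N z.
Proof.
rewrite -(@ler_pXn2r _ 2)// ?nnegrE ?normc_ge0 ?normr_ge0// normcE2 real_normK ?num_real//.
by rewrite lerDr sqr_ge0.
Qed.

Lemma normc_le_ReIm z : N z <= `|Re z| + `|Im z|.
Proof.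
rewrite {1}(complexE z) (le_trans (normc_le_add _ _))// Normc.normcM !normc_real.
by rewrite /= expr0n expr1n add0r sqrtr1 mul1r.
Qed.

Definition cball z (r : R) : set C := [set w | N (w - z) < r].

(** The balls of the library have radii in [R[i]], but a positive complex number is real. *)
Lemma nbhs_cballP z A : nbhs z A <-> exists2 e : R, 0 < e & cball z e `<=` A.
Proof.
split.
  move/nbhs_ballP => [[e e'] /= e0 zA].
  have [e'0 er0] : e' = 0 /\ 0 < e by move: e0; rewrite ltcE/= => /andP[/eqP].
  exists e => // w wz; apply: zA.
  rewrite /ball/= -opprB normrN normCE ltcE/= e'0 eqxx/=.
  by move: wz; rewrite /cball/=.
move=> [e e0 zA]; apply/nbhs_ballP; exists e%:C => /=; first by rewrite ltcR.
by move=> w; rewrite /ball/= => zw; apply: zA; rewrite /cball/= normcBC -ltcR.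
Qed.

Lemma open_cball z r : open (cball z r).
Proof.
rewrite openE => w wz; apply/nbhs_cballP; exists (r - N (w - z)); first by rewrite subr_gt0.
move=> v; rewrite /cball/= ltrBrDr; apply: le_lt_trans; exact: normc_dist_le.
Qed.

Lemma openCP A : open A <-> forall z, A z -> exists2 e : R, 0 < e & cball z e `<=` A.
Proof.
rewrite openE; split => [oA z Az|h z Az]; first exact/nbhs_cballP/oA.
exact/nbhs_cballP/h.
Qed.

Lemma closureCP A z : closure A z <-> forall e : R, 0 < e -> exists2 w, A w & N (w - z) < e.
Proof.
split => [h e e0|h B /nbhs_cballP[e e0 zB]].
  have /h[w [Aw zw]] : nbhs z (cball z e) by apply/nbhs_cballP; exists e.
  by exists w.
by have [w Aw wz] := h e e0; exists w; split => //; apply: zB.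
Qed.

Lemma cvgC_realP (T : Type) (F : set_system T) (FF : Filter F) (f : T -> C) l :
  f @ F --> l <-> forall e : R, 0 < e -> \forall x \near F, N (f x - l) < e.
Proof.
split => [h e e0|h B /nbhs_cballP[e e0 zB]].
  by apply: (h (cball l e)); apply/nbhs_cballP; exists e.
by apply: filterS (h e e0) => x /zB.
Qed.

Lemma continuousC_realP (T : topologicalType) (f : T -> C) x :
  {for x, continuous f} <-> forall e : R, 0 < e -> \forall y \near x, N (f y - f x) < e.
Proof. exact: cvgC_realP. Qed.

Lemma near_cball z (P : C -> Prop) :
  (\forall w \near z, P w) <-> exists2 e : R, 0 < e & forall w, N (w - z) < e -> P w.
Proof. exact: nbhs_cballP. Qed.

Lemma continuous_realP (T : topologicalType) (f : T -> R) x :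
  {for x, continuous f} <-> forall e : R, 0 < e -> \forall y \near x, `|f y - f x| < e.
Proof. exact: (@cvgrPdistC_lt _ _ _ (nbhs x)). Qed.

Lemma cts_normc z : {for z, continuous (@Normc.normc R : C -> R)}.
Proof.
apply/continuous_realP => e e0; apply/near_cball; exists e => // w wz.
by rewrite (le_lt_trans (normc_dist _ _)).
Qed.

Lemma cts_Complex (T : topologicalType) (f g : T -> R) x : {for x, continuous f} ->
  {for x, continuous g} -> {for x, continuous (fun y => f y +i* g y : C)}.
Proof.
move=> /continuous_realP cf /continuous_realP cg; apply/continuousC_realP => e e0.
have e20 : 0 < e / 2 by rewrite divr_gt0.
near=> y; rewrite (le_lt_trans (normc_le_ReIm _))//= (splitr e) ltrD//.
  by near: y; exact: cf.
by near: y; exact: cg.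
Unshelve. all: by end_near. Qed.

Lemma cts_realC (T : topologicalType) (f : T -> R) x : {for x, continuous f} ->
  {for x, continuous (fun y => (f y)%:C : C)}.
Proof. by move=> cf; apply: cts_Complex => //; exact: cvg_cst. Qed.

(** The disc is closed and lies in the continuous image of a compact square of [R * R]. *)
Lemma compact_cdisk z (r : R) : compact [set w | N (w - z) <= r].
Proof.
have cR : compact (`[- r, r]%classic `*` `[- r, r]%classic : set (R * R)).
  by apply: compact_setX; exact: segment_compact.
have cC : compact ((fun p : R * R => z + (p.1 +i* p.2)) @`
    (`[- r, r]%classic `*` `[- r, r]%classic)).
  apply: continuous_compact => //; apply: continuous_subspaceT => p.
  apply: (@cvgD _ C); first exact: cvg_cst.
  by apply: (@cts_Complex _ fst snd); [exact: cvg_fst|exact: cvg_snd].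
apply: subclosed_compact cC _ => [|w /= wz].
  move=> w /closureCP h; rewrite /= leNgt; apply/negP => rw.
  have [] := h (N (w - z) - r); first by rewrite subr_gt0.
  move=> v /= vz; have := normc_dist_le v w z; rewrite (normcBC w v); lra.
exists (Re (w - z), Im (w - z)).
  by split; rewrite /= in_itv/= -ler_norml (le_trans _ wz)//
    ?Re_le_normc ?Im_le_normc.
by case: (w) (z) => a b [c d] /=; congr (_ +i* _); ring.
Qed.

Lemma bounded_setC_P A : bounded_set A <-> exists r : R, forall z, A z -> N z <= r.
Proof.
split.
  move=> [M [Mreal h]].
  have /h/= hM : M < (N M + 1)%:C.
    have MM : M <= `|M| by rewrite real_ler_norm.
    by rewrite (le_lt_trans MM)// normCE ltcR ltrDl.
  by exists (N M + 1) => z /hM; rewrite normCE lecR.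
move=> [r h]; exists r%:C; split; first by apply/complex_realP; exists r.
move=> M rM z Az /=; rewrite (le_trans _ (ltW rM))// normCE lecR; exact: h.
Qed.

Lemma compact_bounded_closed A : bounded_set A -> closed A -> compact A.
Proof.
move=> /bounded_setC_P[r h] cA.
by apply: subclosed_compact cA (@compact_cdisk 0 r) _ => z /h /=; rewrite subr0.
Qed.

Lemma bounded_closure A : bounded_set A -> bounded_set (closure A).
Proof.
move=> /bounded_setC_P[r h]; apply/bounded_setC_P; exists (r + 1) => z /closureCP/(_ 1 ltr01)[w /h wr].
move=> wz; have := normc_le_add (z - w) w; rewrite subrK normcBC => zz.
by rewrite (le_trans zz)// addrC lerD// ltW.
Qed.

Lemma compact_closureC A : bounded_set A -> compact (closure A).
Proof.
by move=> bA; apply: compact_bounded_closed; [exact: bounded_closure|exact: closed_closure].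
Qed.

Lemma boundary_sub_closure A : boundary A `<=` closure A.
Proof. by move=> z []. Qed.

Lemma boundary_closed A : closed (boundary A).
Proof. by rewrite /boundary setDE; apply: closedI;
  [exact: closed_closure|exact/open_closedC/open_interior]. Qed.

Lemma compact_boundary A : bounded_set A -> compact (boundary A).
Proof.
move=> bA; apply: subclosed_compact (@boundary_closed A) (compact_closureC bA) _.
exact: boundary_sub_closure.
Qed.

Lemma boundary_open A : open A -> boundary A = closure A `\` A.
Proof. by move=> /interior_id; rewrite /boundary => ->. Qed.

Lemma bounded_subset A B : A `<=` B -> bounded_set B -> bounded_set A.
Proof.
move=> AB /bounded_setC_P[r h]; apply/bounded_setC_P; exists r => z /AB; exact: h.
Qed.

Lemma compact_max (K : set C) (f : C -> R) : compact K -> K !=set0 ->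
  (forall z, K z -> {for z, continuous f}) -> exists2 z, K z & forall w, K w -> f w <= f z.
Proof.
move=> cK K0 cf.
have [|z /set_mem Kz h] := @compact_EVT_max _ _ f K K0 cK.
  by apply: continuous_in_subspaceT => z /set_mem; exact: cf.
by exists z => // w Kw; apply: h; exact/mem_set.
Qed.

(* Caratheodory's form of complex differentiability, stable under algebraic
   operations without any limit computation. *)
Definition cdiff (f : C -> C) z := exists2 phi : C -> C,
  {for z, continuous phi} & forall w, f w = f z + phi w * (w - z).

End Complex.

(** * Complex differentiability *)

Section ComplexDiff.
Context {R : realType}.
Local Notation C := R[i].
Local Notation N := Normc.normc.
Implicit Types (f g : C -> C) (z w : C).

Lemma ctsM (T : topologicalType) (f g : T -> C) x : {for x, continuous f} ->
  {for x, continuous g} -> {for x, continuous (fun y => f y * g y)}.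
Proof. exact: (@cvgM _ _ (nbhs x)). Qed.

Lemma ctsD (T : topologicalType) (f g : T -> C) x : {for x, continuous f} ->
  {for x, continuous g} -> {for x, continuous (fun y => f y + g y)}.
Proof. exact: (@cvgD _ _ _ (nbhs x)). Qed.

Lemma ctsN (T : topologicalType) (f : T -> C) x : {for x, continuous f} ->
  {for x, continuous (fun y => - f y)}.
Proof. exact: (@cvgN _ _ _ (nbhs x)). Qed.

Lemma ctsV (T : topologicalType) (f : T -> C) x : {for x, continuous f} -> f x != 0 ->
  {for x, continuous (fun y => (f y)^-1)}.
Proof. by move=> cf fx; exact: (@cvgV _ _ (nbhs x)). Qed.

Lemma cts_cst (T : topologicalType) (a : C) x : {for x, continuous (fun _ : T => a)}.
Proof. exact: cvg_cst. Qed.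

Lemma cts_id z : {for z, continuous (fun w : C => w)}.
Proof. exact: (@cvg_id _ (nbhs z)). Qed.

Lemma cts_near_eq (f g : C -> C) z : {for z, continuous f} -> (\forall w \near z, f w = g w) ->
  {for z, continuous g}.
Proof.
move=> /continuousC_realP cf fg; apply/continuousC_realP => e e0.
have fgz := nbhs_singleton fg.
by near=> w; rewrite -(near fg w)// -fgz; near: w; exact: cf.
Unshelve. all: by end_near. Qed.

(** [cdiff] asks for its identity at every point; replacing the factor by the difference quotient
    away from [z] does not affect continuity at [z], so a local identity is enough. *)
Lemma cdiff_local f z (phi : C -> C) : {for z, continuous phi} ->
  (\forall w \near z, f w = f z + phi w * (w - z)) -> cdiff f z.
Proof.
move=> cphi fphi.
exists (fun w => if w == z then phi z else (f w - f z) / (w - z)).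
  apply: cts_near_eq cphi _; near=> w; have [->//|wz] := eqVneq w z.
  by rewrite (near fphi w)// addrC addKr mulfK// subr_eq0.
move=> w; have [->|wz] := eqVneq w z; first by rewrite subrr mulr0 addr0.
by rewrite divfK ?subr_eq0// addrC subrK.
Unshelve. all: by end_near. Qed.

Lemma cdiff_near_eq f g z : cdiff f z -> (\forall w \near z, f w = g w) -> cdiff g z.
Proof.
move=> [phi cphi fE] fg; apply: cdiff_local cphi _.
by near=> w; rewrite -(near fg w)// -(nbhs_singleton fg) -fE.
Unshelve. all: by end_near. Qed.

Lemma cdiff_cts f z : cdiff f z -> {for z, continuous f}.
Proof.
move=> [phi cphi fE]; have -> : f = (fun w => f z + phi w * (w - z)) by apply/funext.
exact: (ctsD (@cts_cst _ (f z) z) (ctsM cphi (ctsD (@cvg_id _ (nbhs z)) (@cts_cst _ (- z) z)))).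
Qed.

Lemma cdiff_cst (a : C) z : cdiff (fun=> a) z.
Proof. by exists (fun=> 0); [exact: cts_cst|move=> w; rewrite mul0r addr0]. Qed.

Lemma cdiff_id z : cdiff (fun w => w) z.
Proof. by exists (fun=> 1); [exact: cts_cst|move=> w; rewrite mul1r addrC subrK]. Qed.

Lemma cdiffD f g z : cdiff f z -> cdiff g z -> cdiff (fun w => f w + g w) z.
Proof.
move=> [phi cphi fE] [psi cpsi gE]; exists (fun w => phi w + psi w).
  exact: (ctsD cphi cpsi).
by move=> w; rewrite (fE w) (gE w); ring.
Qed.

Lemma cdiffM f g z : cdiff f z -> cdiff g z -> cdiff (fun w => f w * g w) z.
Proof.
move=> df dg; have cg := cdiff_cts dg.
case: df dg => [phi cphi fE] [psi cpsi gE]; exists (fun w => f z * psi w + phi w * g w).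
  exact: (ctsD (ctsM (@cts_cst _ (f z) z) cpsi) (ctsM cphi cg)).
by move=> w; rewrite [in LHS]fE mulrDl [in X in X + _ = _]gE; ring.
Qed.

Lemma cdiffX f z n : cdiff f z -> cdiff (fun w => f w ^+ n) z.
Proof.
move=> df; elim: n => [|n IH]; first exact: cdiff_cst.
by under eq_fun do rewrite exprS; exact: (cdiffM df IH).
Qed.

Lemma cdiffN f z : cdiff f z -> cdiff (fun w => - f w) z.
Proof.
by move=> df; under eq_fun do rewrite -mulN1r; exact: (cdiffM (@cdiff_cst (-1) z) df).
Qed.

Lemma cdiffB f g z : cdiff f z -> cdiff g z -> cdiff (fun w => f w - g w) z.
Proof. by move=> df dg; exact: (cdiffD df (cdiffN dg)). Qed.

Lemma cts_near_neq0 f z : {for z, continuous f} -> f z != 0 -> \forall w \near z, f w != 0.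
Proof.
move=> /continuousC_realP cf fz; near=> w.
have : N (f w - f z) < N (f z) by near: w; apply: cf; rewrite normc_gt0.
by apply: contraTneq => ->; rewrite sub0r normcN ltxx.
Unshelve. all: by end_near. Qed.

Lemma cdiffV f z : cdiff f z -> f z != 0 -> cdiff (fun w => (f w)^-1) z.
Proof.
move=> df fz; have cf := cdiff_cts df; case: df => [phi cphi fE].
apply: (@cdiff_local _ _ (fun w => - phi w * (f w)^-1 * (f z)^-1)).
  exact: (ctsM (ctsM (ctsN cphi) (ctsV cf fz)) (@cts_cst _ (f z)^-1 z)).
have fn0 := cts_near_neq0 cf fz.
near=> w; have fw : f w != 0 by near: w.
have e : f w - f z = phi w * (w - z) by rewrite fE addrC addKr.
rewrite !mulNr mulrAC -(mulrC (w - z)) !mulrA (mulrC (w - z)) -e; field.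
by rewrite fw fz.
Unshelve. all: by end_near. Qed.

Lemma cdiff_comp f g z : cdiff f z -> cdiff g (f z) -> cdiff (fun w => g (f w)) z.
Proof.
move=> df [psi cpsi gE]; have cf := cdiff_cts df; case: df => [phi cphi fE].
exists (fun w => psi (f w) * phi w).
  exact: (ctsM (@continuous_comp _ _ _ f psi z cf cpsi) cphi).
by move=> w; rewrite (gE (f w)) {2}(fE w); ring.
Qed.

Lemma cdiff_iter f n z : (forall w, cdiff f w) -> cdiff (iter n f) z.
Proof.
move=> df; elim: n => [|n IH]; first exact: cdiff_id.
exact: (cdiff_comp IH).
Qed.

(** The difference quotient, completed by its limit at [z], is the factor required. *)
Lemma derivable_cdiff f z : derivable f z 1 -> cdiff f z.
Proof.
move=> df; pose q h := h^-1 *: ((f \o shift z) (h *: 1) - f z).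
pose d := lim (q @ 0^').
have qd : q @ 0^' --> d by [].
exists (fun w => if w == z then d else (f w - f z) / (w - z)); last first.
  move=> w; have [->|wz] := eqVneq w z; first by rewrite subrr mulr0 addr0.
  by rewrite divfK ?subr_eq0// addrC subrK.
apply/continuousC_realP => e e0; rewrite eqxx.
have /near_cball[r r0 h] : \forall h \near 0^', N (q h - d) < e.
  by move: qd => /cvgC_realP; apply.
apply/near_cball; exists r => // w wz /=; have [_|wneqz] := eqVneq w z.
  by rewrite subrr Normc.normc0.
have wz0 : w - z != 0 by rewrite subr_eq0.
have := h (w - z); rewrite subr0 => /(_ wz wz0).
by rewrite /q /= scaler1 subrK /GRing.scale/= mulrC.
Qed.

Lemma entire_cdiff f z : entire f -> cdiff f z.
Proof. by move=> ef; exact: derivable_cdiff. Qed.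

End ComplexDiff.

(** * Goursat's lemma *)

Section Goursat.
Context {R : realType}.
Local Notation C := R[i].
Local Notation N := Normc.normc.
Local Notation Re := complex.Re.
Local Notation Im := complex.Im.
Local Open Scope complex_scope.
Implicit Types (f g : C -> C) (z w a b c : C).

(* Trapezoid sums over the [2 ^ n]-fold dyadic subdivision of a segment play
   the role of line integrals: they are exactly additive under bisection and
   exact on affine functions, which is all that Goursat's argument uses. *)
Fixpoint trap f n a b : C :=
  if n is m.+1 then trap f m a ((a + b) / 2) + trap f m ((a + b) / 2) b
  else (b - a) * (f a + f b) / 2.

Lemma trap0 f a b : trap f 0 a b = (b - a) * (f a + f b) / 2.
Proof. by []. Qed.

Lemma trapS f n a b :
  trap f n.+1 a b = trap f n a ((a + b) / 2) + trap f n ((a + b) / 2) b.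
Proof. by []. Qed.

Lemma trapN f n a b : trap f n b a = - trap f n a b.
Proof.
elim: n a b => [|n IH] a b; first by rewrite !trap0; ring.
rewrite !trapS.
by rewrite (addrC b a) [trap f n b _]IH [trap f n _ a]IH; ring.
Qed.

Lemma trapD f g n a b : trap (fun w => f w + g w) n a b = trap f n a b + trap g n a b.
Proof. by elim: n a b => [|n IH] a b; [rewrite !trap0; ring|rewrite !trapS !IH; ring]. Qed.

Lemma trapZ k f n a b : trap (fun w => k * f w) n a b = k * trap f n a b.
Proof. by elim: n a b => [|n IH] a b; [rewrite !trap0; ring|rewrite !trapS !IH; ring]. Qed.

Lemma trap_affine k l n a b :
  trap (fun w => k + l * w) n a b = k * (b - a) + l * (b ^+ 2 - a ^+ 2) / 2.
Proof. by elim: n a b => [|n IH] a b; [rewrite !trap0|rewrite !trapS !IH]; field. Qed.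

Lemma trap_scale f n u a b : trap f n (u * a) (u * b) = u * trap (fun w => f (u * w)) n a b.
Proof.
elim: n a b => [|n IH] a b; first by rewrite !trap0; ring.
rewrite !trapS.
by rewrite -mulrDr -mulrA !IH mulrDr.
Qed.

(** Bisection only creates midpoints, so this weak convexity already keeps all nodes of a trapezoid
    sum in the set. *)
Definition midconvex (P : set C) := forall a b, P a -> P b -> P ((a + b) / 2).

Lemma trap_eq (P : set C) f g n a b : midconvex P -> P a -> P b ->
  (forall w, P w -> f w = g w) -> trap f n a b = trap g n a b.
Proof.
move=> cP Pa Pb fg; elim: n a b Pa Pb => [|n IH] a b Pa Pb; first by rewrite !trap0 !fg.
rewrite !trapS.
by rewrite !IH//; exact: cP.
Qed.

Lemma normc2 : N (2 : C) = 2 :> R.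
Proof. by rewrite -[2 : C]/(2%:R) -(rmorph_nat (real_complex R)) normc_real ger0_norm. Qed.

Lemma normc_half z : N (z / 2) = N z / 2.
Proof. by rewrite Normc.normcM Normc.normcV normc2. Qed.

Lemma normc_halfB a b : N (((a + b) / 2) - a) = N (b - a) / 2.
Proof. by rewrite -normc_half; congr N; field. Qed.

Lemma normc_halfBr a b : N (b - (a + b) / 2) = N (b - a) / 2.
Proof. by rewrite -normc_half; congr N; field. Qed.

Lemma trap_bound (P : set C) f n a b (M : R) : midconvex P -> P a -> P b ->
  (forall w, P w -> N (f w) <= M) -> N (trap f n a b) <= M * N (b - a).
Proof.
move=> cP Pa Pb fM; elim: n a b Pa Pb => [|n IH] a b Pa Pb.
  rewrite trap0 -mulrA Normc.normcM mulrC ler_wpM2r ?normc_ge0// normc_half.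
  by rewrite ler_pdivrMr// mulr2n mulrDr mulr1 (le_trans (normc_le_add _ _))// lerD ?fM.
have Pm := cP _ _ Pa Pb; rewrite trapS.
rewrite (le_trans (normc_le_add _ _))//.
rewrite (le_trans (lerD (IH _ _ Pa Pm) (IH _ _ Pm Pb)))//.
by rewrite normc_halfB normc_halfBr -mulrDr -splitr.
Qed.

Definition tri f n a b c := trap f n a b + trap f n b c + trap f n c a.
Definition perimeter a b c : R := N (b - a) + N (c - b) + N (a - c).

(** The four triangles cut out by the midpoints share three inner edges, whose sums cancel in
    pairs. *)
Lemma triS f n a b c : tri f n.+1 a b c =
  tri f n a ((a + b) / 2) ((c + a) / 2) + tri f n ((a + b) / 2) b ((b + c) / 2) +
  tri f n ((b + c) / 2) c ((c + a) / 2) + tri f n ((a + b) / 2) ((b + c) / 2) ((c + a) / 2).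
Proof.
rewrite /tri !trapS (trapN f n ((b + c) / 2) ((a + b) / 2)).
rewrite (trapN f n ((c + a) / 2) ((b + c) / 2)) (trapN f n ((c + a) / 2) ((a + b) / 2)).
by ring.
Qed.

Lemma tri_bound (P : set C) f n a b c (M : R) : midconvex P -> P a -> P b -> P c ->
  (forall w, P w -> N (f w) <= M) -> N (tri f n a b c) <= M * perimeter a b c.
Proof.
move=> cP Pa Pb Pc fM; rewrite /tri /perimeter !mulrDr.
by rewrite (le_trans (normc_le_add _ _))// lerD ?(trap_bound _ cP)//
  (le_trans (normc_le_add _ _))// lerD ?(trap_bound _ cP).
Qed.

Lemma midconvex_cdisk z (r : R) : midconvex [set w | N (w - z) <= r].
Proof.
move=> a b /= az bz.
have -> : (a + b) / 2 - z = (a - z) / 2 + (b - z) / 2 by field.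
by rewrite (le_trans (normc_le_add _ _))// !normc_half (splitr r) lerD// ler_pM2r.
Qed.

Lemma midconvexI P Q : midconvex P -> midconvex Q -> midconvex (P `&` Q).
Proof. by move=> cP cQ a b [Pa Qa] [Pb Qb]; split; [exact: cP|exact: cQ]. Qed.

Lemma tri_affine k l n a b c : tri (fun w => k + l * w) n a b c = 0.
Proof. by rewrite /tri !trap_affine; field. Qed.

Lemma triD f g n a b c : tri (fun w => f w + g w) n a b c = tri f n a b c + tri g n a b c.
Proof. by rewrite /tri !trapD; ring. Qed.

Lemma perimeter_ge0 a b c : 0 <= perimeter a b c.
Proof. by rewrite !addr_ge0 ?normc_ge0. Qed.

Lemma perimeter_sub a b c :
  [/\ perimeter a ((a + b) / 2) ((c + a) / 2) = perimeter a b c / 2,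
      perimeter ((a + b) / 2) b ((b + c) / 2) = perimeter a b c / 2,
      perimeter ((b + c) / 2) c ((c + a) / 2) = perimeter a b c / 2 &
      perimeter ((a + b) / 2) ((b + c) / 2) ((c + a) / 2) = perimeter a b c / 2].
Proof.
have mid u v w : N ((v + w) / 2 - (u + v) / 2) = N (w - u) / 2.
  by rewrite -normc_half; congr N; field.
have mid' u v w : N ((u + v) / 2 - (v + w) / 2) = N (u - w) / 2.
  by rewrite -normc_half; congr N; field.
rewrite /perimeter; split.
- by rewrite normc_halfB normc_halfBr mid'; lra.
- by rewrite normc_halfB normc_halfBr mid'; lra.
- by rewrite normc_halfB normc_halfBr mid'; lra.
- by rewrite !mid (normcBC c a) (normcBC a b) (normcBC b c); lra.
Qed.

(** The affine part of [f] at [z] sums to zero around a triangle. The remainder is at most [e / 3]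
    times the distance to [z], itself at most [3 * s]. *)
Lemma tri_small f z (e : R) : cdiff f z -> 0 < e -> exists2 r : R, 0 < r &
  forall n a b c (s := perimeter a b c), 3 * s < r ->
    N (a - z) <= 2 * s -> N (tri f n a b c) <= e * s ^+ 2.
Proof.
move=> [phi cphi fE] e0.
have e30 : 0 < e / 3 by rewrite divr_gt0.
have /near_cball[r r0 h] := (iffLR (@continuousC_realP _ _ _ _) cphi) _ e30.
exists r => // n a b c s sr az.
have s0 : 0 <= s by exact: perimeter_ge0.
have -> : tri f n a b c = tri (fun w => (phi w - phi z) * (w - z)) n a b c.
  rewrite -[RHS]add0r -(tri_affine (f z - phi z * z) (phi z) n a b c) -triD.
  by congr tri; apply/funext => w; rewrite fE; ring.
have bnd : N (b - a) <= s by rewrite /s /perimeter -addrA lerDl addr_ge0 ?normc_ge0.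
have cnd : N (a - c) <= s by rewrite /s /perimeter lerDr addr_ge0 ?normc_ge0.
have -> : e * s ^+ 2 = (e / 3 * (3 * s)) * s by field.
apply: (@tri_bound [set w | N (w - z) <= 3 * s]).
- exact: midconvex_cdisk.
- by rewrite /=; lra.
- by rewrite /=; have := normc_dist_le a b z; lra.
- by rewrite /=; have := normc_dist_le a c z; rewrite (normcBC c a); lra.
- move=> w /= wz; rewrite Normc.normcM ler_pM ?normc_ge0// ltW// h//.
  exact: le_lt_trans wz sr.
Qed.

(** The squared perimeter is the scale that passes from the parts to the whole: four triangles of
    half the perimeter add up to the same bound. *)
Definition good_tri f (e : R) (t : C * C * C) := exists n0, forall n, (n0 <= n)%N ->
  N (tri f n t.1.1 t.1.2 t.2) <= e * perimeter t.1.1 t.1.2 t.2 ^+ 2.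

Definition in_tri (K : set C) (t : C * C * C) := [/\ K t.1.1, K t.1.2 & K t.2].

Lemma bad_tri_sub (K : set C) f (e : R) t : midconvex K -> in_tri K t -> ~ good_tri f e t ->
  exists t', [/\ in_tri K t', ~ good_tri f e t',
    perimeter t'.1.1 t'.1.2 t'.2 = perimeter t.1.1 t.1.2 t.2 / 2 &
    N (t'.1.1 - t.1.1) <= perimeter t.1.1 t.1.2 t.2].
Proof.
case: t => [[a b] c] cK [/= Ka Kb Kc] bad; apply: contrapT => nex; apply: bad.
have [p1 p2 p3 p4] := perimeter_sub a b c.
have Kab := cK _ _ Ka Kb; have Kbc := cK _ _ Kb Kc; have Kca := cK _ _ Kc Ka.
have gd x y z : K x -> K y -> K z -> perimeter x y z = perimeter a b c / 2 ->
    N (x - a) <= perimeter a b c -> good_tri f e (x, y, z).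
  move=> Kx Ky Kz pxyz xa; apply: contrapT => bad.
  by apply: nex; exists (x, y, z); split.
have ab : N ((a + b) / 2 - a) <= perimeter a b c.
  rewrite normc_halfB /perimeter; have := normc_ge0 (b - a); have := normc_ge0 (c - b).
  by have := normc_ge0 (a - c); lra.
have bc : N ((b + c) / 2 - a) <= perimeter a b c.
  have := normc_dist_le b ((b + c) / 2) a; rewrite normc_halfB /perimeter.
  by have := normc_ge0 (a - c); have := normc_ge0 (c - b); lra.
have [|n1 h1] := gd a _ _ Ka Kab Kca p1; first by rewrite subrr Normc.normc0 perimeter_ge0.
have [n2 h2] := gd _ _ _ Kab Kb Kbc p2 ab.
have [n3 h3] := gd _ _ _ Kbc Kc Kca p3 bc.
have [n4 h4] := gd _ _ _ Kab Kbc Kca p4 ab.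
(* Level [n.+1] of the whole triangle is level [n] of its four parts. *)
exists (maxn (maxn n1 n2) (maxn n3 n4)).+1 => -[//|n]; rewrite ltnS !geq_max.
move=> /andP[/andP[/h1 g1 /h2 g2] /andP[/h3 g3 /h4 g4]] /=.
move: g1 g2 g3 g4 => /=; rewrite triS p1 p2 p3 p4 => g1 g2 g3 g4.
rewrite (le_trans (normc_le_add _ _))//.
rewrite (le_trans (lerD (le_trans (normc_le_add _ _) (lerD (normc_le_add _ _) g3)) g4))//.
rewrite (le_trans (lerD (lerD (lerD g1 g2) (lexx _)) (lexx _)))//.
by rewrite le_eqVlt; apply/orP; left; apply/eqP; field.
Qed.

(** Goursat's bisection: if the triangle were bad, so would be successively halved ones that
    accumulate at a point of [K], against [tri_small] there. *)
Lemma goursat (K : set C) f a b c (e : R) : compact K -> midconvex K ->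
  (forall z, K z -> cdiff f z) -> K a -> K b -> K c -> 0 < e ->
  exists n0, forall n, (n0 <= n)%N -> N (tri f n a b c) <= e.
Proof.
move=> kK cK df Ka Kb Kc e0.
pose e' := e / (perimeter a b c ^+ 2 + 1).
have d0 : 0 < perimeter a b c ^+ 2 + 1 by rewrite ltr_pwDr// sqr_ge0.
have e'0 : 0 < e' by rewrite divr_gt0.
suff [n0 h] : good_tri f e' (a, b, c).
  exists n0 => n /h/= /le_trans; apply.
  by rewrite /e' mulrAC ler_pdivrMr// mulrDr mulr1 lerDl ltW.
apply: contrapT => bad.
pose T := {t : C * C * C | in_tri K t /\ ~ good_tri f e' t}.
pose p (t : C * C * C) := perimeter t.1.1 t.1.2 t.2.
have [nx nxP] : {nx : T -> T & forall t, p (sval (nx t)) = p (sval t) / 2 /\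
    N ((sval (nx t)).1.1 - (sval t).1.1) <= p (sval t)}.
  apply: (@choice _ _ (fun t t' : T => p (sval t') = p (sval t) / 2 /\
    N ((sval t').1.1 - (sval t).1.1) <= p (sval t))) => -[t [tK tbad]] /=.
  by have [t' [t'K t'bad ? ?]] := bad_tri_sub cK tK tbad; exists (exist _ t' (conj t'K t'bad)).
have abcK : in_tri K (a, b, c) by [].
pose u n := iter n nx (exist _ (a, b, c) (conj abcK bad)).
pose v n := (sval (u n)).1.1.
have vK n : K (v n) by rewrite /v; case: (u n) => -[[? ?] ?] /= [[]].
have pu n : p (sval (u n)) = p (sval (u 0%N)) / 2 ^+ n.
  elim: n => [|n IH]; first by rewrite expr0 divr1.
  by rewrite {1}/u iterS -/(u n) (nxP (u n)).1 IH exprSr invfM mulrA.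
have p0 n : 0 <= p (sval (u n)) by exact: perimeter_ge0.
(* The first vertex moves by at most the current perimeter, which is halved each time, so the
   displacements telescope. *)
have vv n k : N (v (n + k)%N - v n) <= 2 * p (sval (u n)) - 2 * p (sval (u (n + k)%N)).
  elim: k => [|k IH]; first by rewrite addn0 !subrr Normc.normc0.
  have := normc_dist_le (v (n + k)%N) (v (n + k.+1)%N) (v n).
  have [] := nxP (u (n + k)%N); rewrite addnS /v -[nx _]/(u (n + k).+1) => -> h2 h3.
  move: IH h2 h3; rewrite /v; lra.
have [z [Kz zcl]] : K `&` cluster (v @ \oo) !=set0.
  by apply: kK; exists 0%N => // n _ /=; exact: vK.
have vz n : N (v n - z) <= 2 * p (sval (u n)).
  apply/ler_addgt0Pr => d dpos.
  have [w [[m nm mw] wz]] : [set x | exists2 m, (n <= m)%N & x = v m] `&` cball z d !=set0.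
    apply: zcl; last by apply/nbhs_cballP; exists d.
    by exists n => // m /= nm; exists m.
  move: wz; rewrite /cball/= mw => wz.
  have := normc_dist_le (v m) (v n) z; have := vv n (m - n)%N; rewrite subnKC//.
  by rewrite (normcBC (v m)); have := p0 m; lra.
have [r r0 hr] := tri_small (df z Kz) e'0.
have [k hk] : exists k, 3 * p (sval (u k)) < r.
  have P0 := p0 0%N.
  have [k hk] := ex_natr_gt (3 * p (sval (u 0%N)) / r).
  exists k; rewrite pu mulrA ltr_pdivrMr ?exprn_gt0// (mulrC r) -ltr_pdivrMr// (lt_trans hk)//.
  by rewrite -natrX ltr_nat ltn_expl.
move: hk (vz k); rewrite /v /p; case: (u k) => -[[a' b'] c'] /= [_ bad'] hk h.
by apply: bad'; exists 0%N => j _ /=; apply: hr.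
Qed.

End Goursat.

(** * The maximum principle *)

Section MaximumPrinciple.
Context {R : realType}.
Local Notation C := R[i].
Local Notation N := Normc.normc.
Local Notation Re := complex.Re.
Local Notation Im := complex.Im.
Local Open Scope complex_scope.
Implicit Types (f g h : C -> C) (z w a b c u : C).

Lemma midconvex_halfplane u (k : R) : midconvex [set w | k <= Re (w * u)].
Proof.
move=> a b /= ka kb.
have -> : (a + b) / 2 * u = (a * u + b * u) * (2^-1)%:C.
  by rewrite fmorphV rmorph_nat; field.
have -> : Re ((a * u + b * u) * (2^-1)%:C) = (Re (a * u) + Re (b * u)) / 2.
  by case: (a * u) => ? ?; case: (b * u) => ? ? /=; ring.
by rewrite ler_pdivlMr//; lra.
Qed.

Lemma closed_halfplane u (k : R) : closed [set w | k <= Re (w * u)].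
Proof.
move=> w /closureCP h /=; rewrite leNgt; apply/negP => wk.
have e0 : 0 < (k - Re (w * u)) / (N u + 1).
  by rewrite divr_gt0 ?subr_gt0// ltr_wpDl// normc_ge0.
have [v /= kv vw] := h _ e0.
have : Re ((v - w) * u) < k - Re (w * u).
  rewrite (le_lt_trans (ler_norm _))// (le_lt_trans (Re_le_normc _))// Normc.normcM.
  have u1 : 0 < N u + 1 by rewrite ltr_wpDl// normc_ge0.
  move: vw; rewrite ltr_pdivlMr// => /(le_lt_trans _); apply.
  by rewrite ler_wpM2l ?normc_ge0// lerDl.
by rewrite mulrBl raddfB/= ltrBlDr subrK ltNge kv.
Qed.

(* A triangle with the exceptional point as a vertex: the three quarters away from
   it are covered by [goursat], and the perimeter of the remaining one is halved
   at each step. *)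
Lemma tri_vertex f (s M : R) u a b : (forall w, N w <= s -> N (f w) <= M) ->
  (forall w, N w <= s -> w != 0 -> cdiff f w) ->
  N a <= s -> N b <= s -> 0 < Re (a * u) -> 0 < Re (b * u) ->
  forall e : R, 0 < e -> exists n0, forall n, (n0 <= n)%N -> N (tri f n 0 a b) <= e.
Proof.
move=> fM df as_ bs ua ub e e0.
have s0 : 0 <= s by rewrite (le_trans _ as_)// normc_ge0.
have M0 : 0 <= M by rewrite (le_trans (normc_ge0 (f 0)))// fM// Normc.normc0.
have s00 : N (0 - 0 : C) <= s by rewrite subrr Normc.normc0.
have half_in z : N z <= s -> N (z / 2) <= s.
  by move=> zs; rewrite normc_half; have := normc_ge0 z; lra.
have Re_half z : Re (z / 2 * u) = Re (z * u) / 2.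
  rewrite (_ : z / 2 * u = z * u * (2^-1)%:C); last by rewrite fmorphV rmorph_nat; field.
  by case: (z * u) => x y /=; ring.
have step k : forall a b, N a <= s -> N b <= s -> 0 < Re (a * u) -> 0 < Re (b * u) ->
    forall e : R, 0 < e -> exists n0, forall n, (n0 <= n)%N ->
    N (tri f n 0 a b) <= e + M * perimeter 0 a b / 2 ^+ k.
  elim: k => [|k IH] {ua ub as_ bs e e0}a {}b as_ bs ua ub e e0.
    exists 0%N => n _; rewrite expr0 divr1.
    apply: (@le_trans _ _ (M * perimeter 0 a b)); last by rewrite lerDr ltW.
    apply: (@tri_bound _ [set w | N (w - 0) <= s]); first exact: midconvex_cdisk.
    - exact: s00.
    - by rewrite /= subr0.
    - by rewrite /= subr0.
    - by move=> w /=; rewrite subr0; exact: fM.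
  have e40 : 0 < e / 4 by rewrite divr_gt0.
  pose a' := (0 + a) / 2; pose b' := (b + 0) / 2.
  have a'E : a' = a / 2 by rewrite /a' add0r.
  have b'E : b' = b / 2 by rewrite /b' addr0.
  have [n1 h1] : exists n0, forall n, (n0 <= n)%N ->
      N (tri f n 0 a' b') <= e / 4 + M * perimeter 0 a' b' / 2 ^+ k.
    by apply: IH; rewrite // ?a'E ?b'E ?half_in// Re_half divr_gt0.
  have [pE _ _ _] := perimeter_sub 0 a b.
  (* The half plane [kap <= Re (w * u)] contains every vertex but [0] and keeps three of the
     quarters away from the exceptional point. *)
  pose kap := Num.min (Re (a * u)) (Re (b * u)) / 2.
  have kap0 : 0 < kap by rewrite divr_gt0// lt_min ua ub.
  have kapa : kap <= Re (a * u) / 2 by rewrite ler_pM2r// ge_min lexx.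
  have kapb : kap <= Re (b * u) / 2 by rewrite ler_pM2r// ge_min lexx orbT.
  pose K := [set w | N (w - 0) <= s] `&` [set w | kap <= Re (w * u)].
  have cK : compact K.
    apply: compact_closedI; [exact: compact_cdisk|exact: closed_halfplane].
  have mK : midconvex K.
    by apply: midconvexI; [exact: midconvex_cdisk|exact: midconvex_halfplane].
  have dK z : K z -> cdiff f z.
    move=> [/=]; rewrite subr0 => zs kz; apply: df => //.
    by apply: contraTneq kz => ->; rewrite mul0r/= -ltNge.
  have Ka : K a by split; rewrite /= ?subr0//; lra.
  have Kb : K b by split; rewrite /= ?subr0//; lra.
  have Ka' : K a' by rewrite a'E; split; rewrite /= ?subr0 ?half_in ?Re_half.
  have Kb' : K b' by rewrite b'E; split; rewrite /= ?subr0 ?half_in ?Re_half.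
  have Kab := mK _ _ Ka Kb.
  have [n2 h2] := goursat cK mK dK Ka' Ka Kab e40.
  have [n3 h3] := goursat cK mK dK Kab Kb Kb' e40.
  have [n4 h4] := goursat cK mK dK Ka' Kab Kb' e40.
  exists (maxn (maxn n1 n2) (maxn n3 n4)).+1 => -[//|n]; rewrite ltnS !geq_max.
  move=> /andP[/andP[/h1 g1 /h2 g2] /andP[/h3 g3 /h4 g4]].
  move: g1; rewrite pE => g1; rewrite triS -/a' -/b'.
  rewrite (le_trans (normc_le_add _ _))//.
  rewrite (le_trans (lerD (le_trans (normc_le_add _ _) (lerD (normc_le_add _ _) g3)) g4))//.
  rewrite (le_trans (lerD (lerD (lerD g1 g2) (lexx _)) (lexx _)))//.
  by rewrite le_eqVlt; apply/orP; left; apply/eqP; rewrite exprS; field; rewrite expf_neq0.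
have e20 : 0 < e / 2 by rewrite divr_gt0.
have [k hk] := ex_natr_gt (M * perimeter 0 a b / (e / 2)).
have [n0 h] := step k _ _ as_ bs ua ub _ e20.
exists n0 => n /h /le_trans; apply; rewrite [leRHS]splitr lerD2l.
rewrite ler_pdivrMr ?exprn_gt0// (mulrC (e / 2)) -ler_pdivrMr// (le_trans (ltW hk))//.
by rewrite -natrX ler_nat ltnW// ltn_expl.
Qed.

Definition trapd f n z := trap f n z (z * 'i).

Definition edge (z : C) : set C := [set w | exists2 p : R, 0 <= p <= 1 & w = z * ((1 - p) +i* p)].

Lemma midconvex_edge z : midconvex (edge z).
Proof.
move=> a b [p p01 ->] [q q01 ->]; exists ((p + q) / 2); first by lra.
rewrite -mulrDr -mulrA; congr (_ * _).
rewrite -[(2 : C)^-1]/((2%:R)^-1) -(rmorph_nat (real_complex R)) -fmorphV.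
by apply/eqP; rewrite eq_complex/=; apply/andP; split; apply/eqP; field.
Qed.

Lemma edge_l z : edge z z.
Proof. by exists 0; rewrite ?lexx ?ler01// subr0 mulr1. Qed.

Lemma edge_r z : edge z (z * 'i).
Proof. by exists 1; rewrite ?lexx ?ler01// subrr. Qed.

(** The midpoint of the edge is nearest to [0], at distance [N z] over the square root of 2; the
    factor [1 / 2] is a rational lower bound. *)
Lemma edge_norm z w : edge z w -> N z / 2 <= N w <= N z.
Proof.
move=> [p p01 ->]; rewrite Normc.normcM.
have nz := normc_ge0 z; set q := _ +i* p.
have q0 := normc_ge0 q.
have qE : N q ^+ 2 = (1 - p) ^+ 2 + p ^+ 2 by rewrite normcE2.
have h1 : N q <= 1.
  by rewrite -(@ler_pXn2r _ 2)// ?nnegrE// qE expr1n; nra.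
have h2 : 2^-1 <= N q.
  by rewrite -(@ler_pXn2r _ 2)// ?nnegrE// qE; nra.
by rewrite ler_wpM2l//= ler_piMr.
Qed.

(** The integral from [1] to ['i] has imaginary part pi / 2, but a lower bound by 1 will do. At a
    node [w] the imaginary part of chord over [w] is [(q - p) / N w ^+ 2], and [N w <= 1]. *)
Lemma trap_inv_Im n (p q : R) : 0 <= p -> p <= q -> q <= 1 ->
  q - p <= Im (trap (fun w => w^-1) n ((1 - p) +i* p) ((1 - q) +i* q)).
Proof.
elim: n p q => [|n IH] p q p0 pq q1.
  rewrite trap0.
  have key (x : R) : 0 <= x <= 1 -> q - p <=
      Im ((((1 - q) +i* q) - ((1 - p) +i* p)) * ((1 - x) +i* x)^-1).
    move=> x01; rewrite /=.
    set d := (1 - x) ^+ 2 + x ^+ 2.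
    have d0 : 0 < d by rewrite /d; nra.
    have d1 : d <= 1 by rewrite /d; nra.
    rewrite [leRHS](_ : _ = (q - p) / d); last by field; rewrite gt_eqF.
    by rewrite ler_pdivlMr//; nra.
  rewrite mulrDr (_ : forall t v : C, Im ((t + v) / 2) = (Im t + Im v) / 2).
    by have := key p; have := key q; move=> /(_ _)kq /(_ _)kp; rewrite ler_pdivlMr//;
      have := kq ltac:(lra); have := kp ltac:(lra); lra.
  move=> [t1 t2] [v1 v2]; rewrite -[(2 : C)^-1]/((2%:R)^-1) -(rmorph_nat (real_complex R)) -fmorphV.
  by rewrite /=; ring.
rewrite trapS.
have -> : (((1 - p) +i* p) + ((1 - q) +i* q)) / 2 = (1 - (p + q) / 2) +i* ((p + q) / 2).
  rewrite -[(2 : C)^-1]/((2%:R)^-1) -(rmorph_nat (real_complex R)) -fmorphV.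
  by apply/eqP; rewrite eq_complex/=; apply/andP; split; apply/eqP; field.
rewrite raddfD/=.
have h1 := IH p ((p + q) / 2) p0 ltac:(lra) ltac:(lra).
have h2 := IH ((p + q) / 2) q ltac:(lra) ltac:(lra) q1.
lra.
Qed.

Lemma trapd_inv n z : z != 0 -> trapd (fun w => w^-1) n z = trap (fun w => w^-1) n 1 'i.
Proof.
move=> z0; rewrite /trapd -{1}(mulr1 z) trap_scale.
by under eq_fun do rewrite invfM; rewrite trapZ mulrA mulfV// mul1r.
Qed.

(* [phi w = (h w - h 0) / w] sums to almost [0] along the square with vertices
   [s * 'i ^ k], since the four triangles that join its edges to [0] do; the sum of
   [1 / w] is the same along all four edges and has modulus at least [1]. *)
Lemma cauchy_estimate h (s m : R) : 0 < s -> (forall w, N w <= s -> cdiff h w) ->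
  (forall w, s / 2 <= N w <= s -> N (h w) <= m) -> N (h 0) <= 4 * m.
Proof.
move=> s0 dh hm.
have m0 : 0 <= m.
  apply: le_trans (normc_ge0 (h s%:C)) (hm _ _).
  by rewrite normc_real gtr0_norm// lexx andbT; lra.
have N00 : N (0 : C) <= s by rewrite Normc.normc0 ltW.
have [phi cphi hE] := dh 0 N00.
have hphi w : w != 0 -> phi w = (h w - h 0) * w^-1.
  by move=> w0; rewrite [in X in X - _]hE subr0 addrAC subrr add0r mulfK.
have dphi w : N w <= s -> w != 0 -> cdiff phi w.
  move=> ws w0; apply: (@cdiff_near_eq _ (fun v => (h v - h 0) * v^-1)).
    exact: (cdiffM (cdiffB (dh _ ws) (@cdiff_cst _ (h 0) w)) (cdiffV (@cdiff_id _ w) w0)).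
  have : \forall v \near w, v != 0.
    exact: (cts_near_neq0 (@cts_id _ w) w0).
  by apply: filterS => v /hphi ->.
have [M phiM] : exists M : R, forall w, N w <= s -> N (phi w) <= M.
  have [||z _ hz] := @compact_max _ [set w | N (w - 0) <= s] (fun w => N (phi w)) (@compact_cdisk _ 0 s).
  - by exists 0; rewrite /mkset subrr.
  - move=> z /=; rewrite subr0 => zs; apply: continuous_comp; last exact: cts_normc.
    have [->|z0] := eqVneq z 0; first exact: cphi.
    exact: cdiff_cts (dphi _ zs z0).
  - by exists (N (phi z)) => w ws; apply: hz; rewrite /mkset subr0.
pose v k : C := s%:C * 'i ^+ k.
have Ni : N ('i : C) = 1 by rewrite /= expr0n expr1n/= add0r sqrtr1.
have Nv k : N (v k) = s.
  by rewrite /v Normc.normcM normcX Ni expr1n mulr1 normc_real gtr0_norm.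
have v0 k : v k != 0 by rewrite -normc_gt0 Nv.
have vS k : v k * 'i = v k.+1 by rewrite /v exprSr mulrA.
have v4 : v 4 = v 0%N by rewrite /v (exprM _ 2 2) sqr_i expr0 sqrrN expr1n.
have tri0 k (e : R) : 0 < e -> exists n0, forall n, (n0 <= n)%N -> N (tri phi n 0 (v k) (v k.+1)) <= e.
  (* [z * (1 +i* 1)] points along the bisector of [z] and [z * 'i], so both lie in the open half
     plane given by its conjugate. *)
  have vu z : z != 0 -> 0 < Re (z * (z * (1 +i* 1))^*) /\ 0 < Re (z * 'i * (z * (1 +i* 1))^*).
    case: z => x y xy; have {}xy : 0 < x ^+ 2 + y ^+ 2.
      by rewrite -normc_gt0 in xy; have := exprn_gt0 2 xy; rewrite normcE2.
    by split; rewrite /=; nra.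
  have [u1 u2] := vu _ (v0 k).
  by apply: (tri_vertex phiM dphi _ _ u1); rewrite -?vS// ?vS ?Nv.
have edge_in z w : N z = s -> edge z w -> s / 2 <= N w <= s.
  by move=> zs /edge_norm; rewrite zs.
have edge0 z w : N z = s -> edge z w -> w != 0.
  by move=> zs /(edge_in _ _ zs) ws; rewrite -normc_gt0; lra.
have dE k n : trapd phi n (v k) = trapd (fun w => h w * w^-1) n (v k) -
    h 0 * trap (fun w => w^-1) n 1 'i.
  rewrite -(trapd_inv n (v0 k)) /trapd -mulNr -trapZ -trapD.
  apply: (@trap_eq _ (edge (v k))); [exact: midconvex_edge|exact: edge_l|exact: edge_r|].
  by move=> w /(edge0 _ _ (Nv k)) w0; rewrite hphi// mulrBl mulNr.
(* On the edge [1 / w] is at most [2 / s], and the edge is at most [2 * s] long: this is the origin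
   of the constant 4. *)
have bE k n : N (trapd (fun w => h w * w^-1) n (v k)) <= 4 * m.
  rewrite /trapd (_ : 4 * m = (m / (s / 2)) * (2 * s)); last by field; rewrite gt_eqF.
  apply: (@le_trans _ _ (m / (s / 2) * N (v k * 'i - v k))).
    apply: (@trap_bound _ (edge (v k))); [exact: midconvex_edge|exact: edge_l|exact: edge_r|].
    move=> w /(edge_in _ _ (Nv k)) /andP[w1 w2]; rewrite Normc.normcM Normc.normcV.
    rewrite ler_pM ?normc_ge0 ?invr_ge0 ?normc_ge0//; first by rewrite hm// w1.
    by rewrite lef_pV2// posrE; lra.
  rewrite ler_wpM2l//; first by rewrite divr_ge0//; lra.
  by rewrite (le_trans (normc_le_add _ _))// normcN Normc.normcM Ni Nv; lra.
apply/ler_addgt0Pr => e e0.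
have [n0 h0] := tri0 0%N e e0; have [n1 h1] := tri0 1%N e e0.
have [n2 h2] := tri0 2%N e e0; have [n3 h3] := tri0 3%N e e0.
pose n := maxn (maxn n0 n1) (maxn n2 n3).
have {}h0 := h0 n ltac:(by rewrite !leq_max leqnn).
have {}h1 := h1 n ltac:(by rewrite !leq_max leqnn ?orbT).
have {}h2 := h2 n ltac:(by rewrite !leq_max leqnn ?orbT).
have {}h3 := h3 n ltac:(by rewrite !leq_max leqnn ?orbT).
(* The sums along the four radii cancel. *)
have sumE : tri phi n 0 (v 0%N) (v 1%N) + tri phi n 0 (v 1%N) (v 2) +
    (tri phi n 0 (v 2) (v 3) + tri phi n 0 (v 3) (v 4)) =
    trapd phi n (v 0%N) + trapd phi n (v 1%N) + (trapd phi n (v 2) + trapd phi n (v 3)).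
  rewrite /tri /trapd !vS v4 (trapN phi n 0 (v 0%N)) (trapN phi n 0 (v 1%N)).
  by rewrite (trapN phi n 0 (v 2)) (trapN phi n 0 (v 3)); ring.
have T1 : 1 <= N (trap (fun w => w^-1) n (1 : C) 'i).
  have := @trap_inv_Im n 0 1 (lexx _) ler01 (lexx _).
  rewrite subr0 subrr => /le_trans; apply.
  exact: le_trans (ler_norm _) (Im_le_normc _).
pose S1 := trapd (fun w => h w * w^-1) n (v 0%N) + trapd (fun w => h w * w^-1) n (v 1%N) +
  (trapd (fun w => h w * w^-1) n (v 2) + trapd (fun w => h w * w^-1) n (v 3)).
pose T := trap (fun w => w^-1) n (1 : C) 'i.
have key : 4 * (h 0 * T) = S1 - (tri phi n 0 (v 0%N) (v 1%N) + tri phi n 0 (v 1%N) (v 2) +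
    (tri phi n 0 (v 2) (v 3) + tri phi n 0 (v 3) (v 4))).
  by rewrite sumE !dE /S1 -/T; ring.
have N4 : N (4 : C) = 4 :> R.
  by rewrite -[4 : C]/(4%:R) -(rmorph_nat (real_complex R)) normc_real ger0_norm.
have add4 (x y z t : C) : N (x + y + (z + t)) <= N x + N y + (N z + N t).
  by rewrite (le_trans (normc_le_add _ _))// lerD// normc_le_add.
have le1 : 4 * (N (h 0) * N T) <= 16 * m + 4 * e.
  have -> : 4 * (N (h 0) * N T) = N (4 * (h 0 * T)) by rewrite !Normc.normcM N4.
  rewrite key (le_trans (normc_le_add _ _))// normcN.
  have a1 := add4 (tri phi n 0 (v 0%N) (v 1%N)) (tri phi n 0 (v 1%N) (v 2))
    (tri phi n 0 (v 2) (v 3)) (tri phi n 0 (v 3) (v 4)).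
  have a2 := add4 (trapd (fun w => h w * w^-1) n (v 0%N)) (trapd (fun w => h w * w^-1) n (v 1%N))
    (trapd (fun w => h w * w^-1) n (v 2)) (trapd (fun w => h w * w^-1) n (v 3)).
  have := bE 0%N n; have := bE 1%N n; have := bE 2 n; have := bE 3 n.
  by move: a1 a2; rewrite -/S1; lra.
have le2 : N (h 0) <= N (h 0) * N T by rewrite ler_peMr ?normc_ge0.
lra.
Qed.

(** A constant factor disappears in the limit of [n]-th roots; Bernoulli's inequality replaces the
    limit. *)
Lemma pow_bound (x m : R) : 0 <= m -> (forall n, x ^+ n <= 4 * m ^+ n) -> x <= m.
Proof.
move=> m0 h; rewrite leNgt; apply/negP => mx.
have [m00|mn0] := eqVneq m 0.
  by have := h 1%N; rewrite m00 !expr1; lra.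
have {mn0}m0 : 0 < m by rewrite lt_def mn0.
have d0 : 0 < x / m - 1 by rewrite subr_gt0 ltr_pdivlMr// mul1r.
have [n hn] := ex_natr_gt (4 / (x / m - 1)).
have bern k : 1 + k%:R * (x / m - 1) <= (x / m) ^+ k.
  elim: k => [|k IH]; first by rewrite mul0r addr0 expr0.
  have xm0 : 0 <= x / m by lra.
  rewrite exprS; apply: le_trans (ler_wpM2l xm0 IH).
  move: d0 (ler0n R k); rewrite -natr1; set d := x / m - 1 => d0 k0.
  rewrite (_ : x / m = 1 + d); last by rewrite /d; ring.
  by have : 0 <= k%:R * d ^+ 2; [rewrite mulr_ge0 ?sqr_ge0|nra].
have := h n; rewrite -ler_pdivrMr ?exprn_gt0// -expr_div_n => h4.
have := bern n; move: hn; rewrite ltr_pdivrMr// => h5 h6.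
lra.
Qed.

(** [cauchy_estimate] has the same constant 4 for every power of [h], so [pow_bound] removes it. *)
Lemma local_max_principle h c (s m : R) : 0 < s -> 0 <= m ->
  (forall w, N (w - c) <= s -> cdiff h w) ->
  (forall w, s / 2 <= N (w - c) <= s -> N (h w) <= m) -> N (h c) <= m.
Proof.
move=> s0 m0 dh hm; apply: pow_bound => // n; rewrite -normcX.
rewrite -[c]addr0.
apply: (@cauchy_estimate (fun w => h (c + w) ^+ n) s) => // w ws.
  apply: cdiffX; apply: (@cdiff_comp _ (fun w => c + w)).
    by apply: cdiffD; [exact: cdiff_cst|exact: cdiff_id].
  by apply: dh; rewrite addrAC subrr add0r.
by rewrite normcX lerXn2r ?nnegrE ?normc_ge0// hm// addrAC subrr add0r.
Qed.

End MaximumPrinciple.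

(** * The maximum principle on bounded open sets *)

Section GlobalMaximum.
Context {R : realType}.
Local Notation C := R[i].
Local Notation N := Normc.normc.
Local Notation Re := complex.Re.
Local Notation Im := complex.Im.
Local Open Scope complex_scope.
Implicit Types (f g h : C -> C) (z w a b c u : C) (U : set C).

Lemma normC1 : N (1 : C) = 1.
Proof. exact: Normc.normc1. Qed.

Lemma normC0 : N (0 : C) = 0.
Proof. exact: Normc.normc0. Qed.

Lemma normc2D z w : N (z + w) ^+ 2 = N z ^+ 2 + 2 * Re (w * z^*) + N w ^+ 2.
Proof. by case: z w => [a b] [c d]; rewrite !normcE2 /=; ring. Qed.

Lemma normc2D1 w : N (1 + w) ^+ 2 = 1 + 2 * Re w + N w ^+ 2.
Proof. by case: w => c d; rewrite !normcE2 /=; ring. Qed.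

Lemma normcJ z : N (z^*) = N z.
Proof. by case: z => a b /=; rewrite sqrrN. Qed.

(** In [max_principle], [A = N a ^+ 2], [Y = N (w - z1) ^+ 2] and [X] is the cross term of
    [N (a + (w - z1)) ^+ 2]. The first factor bounds [N (h w) ^+ 2 / mu2] and the second equals
    [N (p w) ^+ 2]; the first order terms in [X] cancel and a gain of [t * Y / 2] remains. *)
Lemma perturbed_max_ineq (t A X Y Q : R) : 0 <= t -> 0 <= A -> 0 <= Y -> A + Y <= Q ->
  `|X| <= A + Y -> t * Q <= 6^-1 ->
  (1 - t * (X + Y)) * (1 + t * X + t ^+ 2 * A * Y) <= 1 - t * Y / 2.
Proof.
move=> t0 A0 Y0 AQ XA tQ.
have /ler_normlP[X1 X2] := XA.
have tA : 0 <= t * A <= 6^-1 by apply/andP; split; [exact: mulr_ge0|nra].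
have tX : - 6^-1 <= t * X <= 6^-1 by apply/andP; split; nra.
have tY : 0 <= t * Y by exact: mulr_ge0.
rewrite -subr_ge0.
have -> : 1 - t * Y / 2 - (1 - t * (X + Y)) * (1 + t * X + t ^+ 2 * A * Y) =
  t * Y * (2^-1 - t * A + t * X + (t * A) * (t * X)) + (t * X) ^+ 2 + (t * A) * (t * Y) ^+ 2.
  by field.
rewrite !addr_ge0 ?sqr_ge0//; last by rewrite mulr_ge0 ?sqr_ge0//; lra.
by rewrite mulr_ge0//; nra.
Qed.

(* Otherwise [N (h z) ^+ 2 + e * N (z - z0) ^+ 2] is maximal at an interior point
   [z1] for small [e]. Multiplying [h] by the affine function [p] absorbs the first
   order variation of the second term around [z1], so that [(h p) ^ 2] contradicts
   [local_max_principle] there. *)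
Theorem max_principle h U (m : R) : open U -> bounded_set U -> 0 <= m ->
  (forall z, U z -> cdiff h z) -> (forall z, closure U z -> {for z, continuous h}) ->
  (forall z, boundary U z -> N (h z) <= m) -> forall z, U z -> N (h z) <= m.
Proof.
move=> oU bU m0 dh ch hm z0 Uz0; rewrite leNgt; apply/negP => mz0.
have [rho0 hrho0] : exists r : R, forall z, closure U z -> N (z - z0) <= r.
  have /bounded_setC_P[r hr] := bounded_closure bU.
  exists (r + N z0) => z /hr zr; rewrite (le_trans (normc_le_add _ _))// normcN.
  by rewrite lerD2r.
(* The additional 1 leaves room for [Y <= 1] in the hypothesis [A + Y <= Q] of
   [perturbed_max_ineq]. *)
pose Q := rho0 ^+ 2 + 1.
have Q1 : 1 <= Q by rewrite lerDr sqr_ge0.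
pose d := N (h z0) ^+ 2 - m ^+ 2.
have d0 : 0 < d by rewrite subr_gt0 ltrXn2r// nnegrE normc_ge0.
(* With [e * Q = d / 12] the added term is too small to move the maximum to the boundary, where
   [N (h z) <= m]. *)
pose e := d / (12 * Q).
have e0 : 0 < e by rewrite divr_gt0//; lra.
have eQ : e * Q = d / 12 by rewrite /e; field; lra.
have Uz0' : closure U z0 by exact: subset_closure.
pose v z := N (h z) ^+ 2 + e * N (z - z0) ^+ 2.
have [|z clz|z1 clz1 hz1] := @compact_max _ (closure U) v (compact_closureC bU).
- by exists z0.
- apply: (@cvgD _ _ _ (nbhs z)).
    apply: (@continuous_comp _ _ _ (fun w => N (h w)) (fun x : R => x ^+ 2)).
      apply: (@continuous_comp _ _ _ h (@Normc.normc R)); first exact: ch.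
      exact: cts_normc.
    exact: exprn_continuous.
  apply: (@cvgM _ _ (nbhs z)); first exact: cvg_cst.
  apply: (@continuous_comp _ _ _ (fun w => N (w - z0)) (fun x : R => x ^+ 2)).
    apply: (@continuous_comp _ _ _ (fun w => w - z0) (@Normc.normc R)); last exact: cts_normc.
    exact: (ctsD (@cts_id _ z) (@cts_cst _ _ (- z0) z)).
  exact: exprn_continuous.
have rhoQ z : closure U z -> N (z - z0) ^+ 2 <= Q - 1.
  move=> /hrho0 zr; rewrite /Q addrK lerXn2r// nnegrE ?normc_ge0//.
  exact: le_trans (normc_ge0 _) zr.
have v0 : v z0 = N (h z0) ^+ 2 by rewrite /v subrr Normc.normc0 expr0n mulr0 addr0.
have vz1 := hz1 _ Uz0'; rewrite v0 in vz1.
have Uz1 : U z1.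
  apply: contrapT => nU; have bz1 : boundary U z1 by rewrite boundary_open.
  have : N (h z1) ^+ 2 <= m ^+ 2 by rewrite lerXn2r// ?nnegrE ?normc_ge0// hm.
  have := rhoQ _ clz1; move: vz1; rewrite /v.
  by move: d0 eQ; rewrite /d; nra.
pose mu2 := N (h z1) ^+ 2.
have mu2d : d / 2 <= mu2.
  have := rhoQ _ clz1; move: vz1; rewrite /v -/mu2.
  by have := sqr_ge0 m; move: d0 eQ; rewrite /d; nra.
have mu20 : 0 < mu2 by lra.
pose a := z1 - z0; pose t := e / mu2.
have t0 : 0 < t by rewrite divr_gt0.
have tQ : t * Q <= 6^-1.
  by rewrite /t mulrAC eQ ler_pdivrMr//; lra.
have [s0 s0pos hs0] := (iffLR (openCP U) oU) _ Uz1.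
pose s := Num.min (s0 / 2) 1.
have s_gt0 : 0 < s by rewrite lt_min divr_gt0//=.
have s_s0 : s < s0 by rewrite gt_min; apply/orP; left; lra.
have s1 : s <= 1 by rewrite ge_min lexx orbT.
have inU w : N (w - z1) <= s -> U w.
  by move=> ws; apply: hs0; rewrite /cball/=; exact: le_lt_trans ws s_s0.
pose p w := 1 + t%:C * a^* * (w - z1).
have dp w : cdiff p w.
  apply: cdiffD; first exact: cdiff_cst.
  by apply: cdiffM; [exact: cdiff_cst|apply: cdiffB; [exact: cdiff_id|exact: cdiff_cst]].
have Np w : N (p w) ^+ 2 = 1 + t * (2 * Re ((w - z1) * a^*)) + t ^+ 2 * N a ^+ 2 * N (w - z1) ^+ 2.
  rewrite /p normc2D1 !Normc.normcM normcJ normc_real.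
  rewrite (ger0_norm (ltW t0)) -mulrA (mulrC (a^*)); congr (1 + _ + _); last by ring.
  by case: (_ * a^*) => x y /=; ring.
(* On the annulus [Y] is at least [s ^+ 2 / 4], hence the gain [t * s ^+ 2 / 8]. Squaring the
   product lets the bounds on squared moduli apply directly. *)
have key : N ((h z1 * p z1) ^+ 2) <= mu2 * (1 - t * s ^+ 2 / 8).
  apply: (@local_max_principle _ (fun w => (h w * p w) ^+ 2) z1 s) => //.
  - apply: mulr_ge0; first exact: ltW.
    have t6 : t <= 6^-1 by nra.
    have s21 : s ^+ 2 <= 1 by rewrite expr_le1// ltW.
    have : t * s ^+ 2 <= 6^-1 by have := sqr_ge0 s; nra.
    by lra.
  - by move=> w /inU Uw; apply: cdiffX; exact: (cdiffM (dh _ Uw) (dp w)).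
  move=> w ws; have Uw : U w by apply: inU; case/andP: ws.
  have clw : closure U w by exact: subset_closure.
  rewrite normcX Normc.normcM exprMn Np.
  pose X := 2 * Re ((w - z1) * a^*); pose Y := N (w - z1) ^+ 2; pose A := N a ^+ 2.
  have wz0 : N (w - z0) ^+ 2 = A + X + Y.
    by rewrite -normc2D; congr (N _ ^+ 2); rewrite /a; ring.
  have hw : N (h w) ^+ 2 <= mu2 * (1 - t * (X + Y)).
    have := hz1 _ clw; rewrite /v wz0 -/a -/A -/mu2.
    rewrite [mu2 * _](_ : _ = mu2 - e * (X + Y)); last by rewrite /t; field; rewrite gt_eqF.
    lra.
  have XAY : `|X| <= A + Y.
    rewrite ler_norml.
    have h1 := sqr_ge0 (N (a + (w - z1))); have h2 := sqr_ge0 (N (a - (w - z1))).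
    rewrite normc2D -/A -/Y -/X in h1.
    rewrite normc2D mulNr raddfN mulrN normcN -/A -/Y -/X in h2.
    by apply/andP; split; lra.
  have Y1 : s ^+ 2 / 4 <= Y <= 1.
    case/andP: ws => ws1 ws2; rewrite /Y; apply/andP; split.
      have -> : s ^+ 2 / 4 = (s / 2) ^+ 2 by field.
      by rewrite lerXn2r// ?nnegrE ?normc_ge0//; lra.
    by rewrite expr_le1// ?normc_ge0//; lra.
  have AQ : A + Y <= Q by have := rhoQ _ clz1; rewrite -/a -/A; lra.
  have A0 : 0 <= A by exact: sqr_ge0.
  have Y0 : 0 <= Y by exact: sqr_ge0.
  rewrite -/X -/Y -/A.
  apply: (@le_trans _ _ (mu2 * (1 - t * (X + Y)) * (1 + t * X + t ^+ 2 * A * Y))).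
    by rewrite ler_wpM2r// -Np sqr_ge0.
  rewrite -mulrA; apply: ler_wpM2l; first exact: ltW.
  apply: le_trans (perturbed_max_ineq (ltW t0) A0 Y0 AQ XAY tQ) _.
  by nra.
move: key; rewrite normcX Normc.normcM exprMn /p subrr mulr0 addr0 normC1 expr1n mulr1 -/mu2.
rewrite leNgt => /negP; apply; rewrite -subr_gt0.
rewrite (_ : mu2 - _ = mu2 * (t * s ^+ 2) / 8); last by field.
by rewrite divr_gt0// mulr_gt0// mulr_gt0// exprn_gt0.
Qed.

End GlobalMaximum.

(** * The maximum modulus *)

Section MaximumModulus.
Context {R : realType}.
Local Notation C := R[i].
Local Notation N := Normc.normc.
Local Notation Re := complex.Re.
Local Notation Im := complex.Im.
Local Open Scope complex_scope.
Implicit Types (f g h : C -> C) (z w a b c u : C) (U : set C).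

Lemma closure_normc_le z (r : R) U : (forall w, U w -> N (w - z) <= r) ->
  forall w, closure U w -> N (w - z) <= r.
Proof.
move=> h w /closureCP clw; apply/ler_addgt0Pr => e e0.
have [v /h vr vw] := clw e e0.
by have := normc_dist_le v w z; rewrite (normcBC w v); lra.
Qed.

Lemma closure_normc_ge z (r : R) U : (forall w, U w -> r <= N (w - z)) ->
  forall w, closure U w -> r <= N (w - z).
Proof.
move=> h w /closureCP clw; apply/ler_addgt0Pr => e e0.
have [v /h vr vw] := clw e e0.
by have := normc_dist_le w v z; lra.
Qed.

Lemma open_normc_gt z (r : R) : open [set w | r < N (w - z)].
Proof.
apply/openCP => w /= rw; exists (N (w - z) - r); first by rewrite subr_gt0.
move=> v; rewrite /cball/= => vw.
by have := normc_dist_le v w z; rewrite (normcBC w v); lra.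
Qed.

Lemma entire_bounded_on f (T : R) c : (forall z, cdiff f z) ->
  exists2 M : R, 0 <= M & forall w, N (w - c) <= T -> N (f w) <= M.
Proof.
move=> df; have [T0|T0] := leP 0 T; last first.
  by exists 0 => // w wT; have := normc_ge0 (w - c); lra.
have [||z _ hz] := @compact_max _ [set w | N (w - c) <= T] (fun w => N (f w)) (@compact_cdisk _ c T).
- by exists c; rewrite /mkset subrr normC0.
- move=> z _; apply: (@continuous_comp _ _ _ f (@Normc.normc R)); last exact: cts_normc.
  exact: cdiff_cts.
by exists (N (f z)) => [|w]; [exact: normc_ge0|exact: hz].
Qed.

(* The maximum principle on an annulus for [(f v - a) / (v - c) ^ n], which
   vanishes on the inner circle, with [n] tending to infinity. *)
Lemma identity_entire f c (rho : R) a : (forall z, cdiff f z) -> 0 < rho ->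
  (forall w, N (w - c) < rho -> f w = a) -> forall w, f w = a.
Proof.
move=> df rho0 fa w; have [/fa//|rw] := ltP (N (w - c)) rho.
pose D := N (w - c); rewrite -/D in rw; have D0 : 0 < D by exact: lt_le_trans rw.
have [M M0 hM] := @entire_bounded_on (fun w => f w - a) (2 * D) c
  (fun z => cdiffB (df z) (@cdiff_cst _ a z)).
pose U := [set v | rho / 2 < N (v - c)] `&` cball c (2 * D).
have oU : open U by apply: openI; [exact: open_normc_gt|exact: open_cball].
have clU1 v : closure U v -> rho / 2 <= N (v - c).
  by apply: closure_normc_ge => {}v [/= ? _]; exact: ltW.
have clU2 v : closure U v -> N (v - c) <= 2 * D.
  by apply: closure_normc_le => {}v [_ /= ?]; exact: ltW.
have bU : bounded_set U.
  apply/bounded_setC_P; exists (2 * D + N c) => v [_]; rewrite /cball/= => vc.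
  by have := normc_dist_le c v 0; rewrite !subr0; lra.
have Uw : U w by split; rewrite /cball/= -/D; lra.
have bnd n : N (f w - a) <= M / 2 ^+ n.
  have dh v : closure U v -> cdiff (fun v => (f v - a) * ((v - c) ^+ n)^-1) v.
    move=> /clU1 vc; have vc0 : v - c != 0 by rewrite -normc_gt0; lra.
    apply: cdiffM; first exact: (cdiffB (df v) (@cdiff_cst _ a v)).
    apply: cdiffV; last exact: expf_neq0.
    by apply: cdiffX; exact: (cdiffB (@cdiff_id _ v) (@cdiff_cst _ c v)).
  have : N ((f w - a) * ((w - c) ^+ n)^-1) <= M / (2 * D) ^+ n.
    apply: (@max_principle _ (fun v => (f v - a) * ((v - c) ^+ n)^-1) U _ oU bU _ _ _ _ w Uw).
    - by rewrite divr_ge0// exprn_ge0//; lra.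
    - by move=> v Uv; apply: dh; exact: subset_closure.
    - by move=> v clv; exact: cdiff_cts (dh _ clv).
    move=> v; rewrite boundary_open// => -[clv nUv].
    have v1 := clU1 _ clv; have v2 := clU2 _ clv.
    have [vr|vr] := ltP (N (v - c)) rho.
      by rewrite fa// subrr mul0r normC0 divr_ge0// exprn_ge0//; lra.
    have -> : (2 * D) ^+ n = N ((v - c) ^+ n).
      rewrite normcX; congr (_ ^+ n); apply/eqP; rewrite eq_le v2 andbT leNgt.
      by apply/negP => vD; apply: nUv; split; rewrite /cball/=; lra.
    rewrite Normc.normcM Normc.normcV ler_wpM2r ?invr_ge0 ?normc_ge0//.
    exact: hM.
  rewrite Normc.normcM Normc.normcV normcX -/D exprMn invfM mulrA.
  by rewrite ler_pM2r// invr_gt0 exprn_gt0.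
apply/eqP; rewrite -subr_eq0 -normc_eq0; apply/eqP/le_anti.
rewrite normc_ge0 andbT leNgt; apply/negP => fwa.
have [n hn] := ex_natr_gt (M / N (f w - a)).
have := bnd n; rewrite ler_pdivlMr ?exprn_gt0// leNgt => /negP; apply.
move: hn; rewrite ltr_pdivrMr// => /lt_trans; apply.
by rewrite mulrC ltr_pM2l// -natrX ltr_nat ltn_expl.
Qed.

(* With [q = f / f z0 - 1] the maximum at [z0] means [Re q <= 0], so that
   [phi = q / (q - 2 d)] maps the disc to the unit disc and vanishes at [z0]. The
   maximum principle on the punctured disc for [phi ^ 2 / (w - z0)] then
   replaces Schwarz's lemma. *)
Lemma strong_max_principle f z0 (s : R) : (forall z, cdiff f z) -> N z0 < s ->
  (forall w, N w <= s -> N (f w) <= N (f z0)) -> forall w, f w = f z0.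
Proof.
move=> df z0s fmax.
pose rho := (s - N z0) / 2.
have rho0 : 0 < rho by rewrite divr_gt0// subr_gt0.
have inD w : N (w - z0) <= rho -> N (f w) <= N (f z0).
  move=> wr; apply: fmax; have := normc_le_add (w - z0) z0; rewrite subrK.
  by move: wr; rewrite /rho; lra.
apply: (identity_entire df rho0) => w wrho.
have [fz00|fz0] := eqVneq (f z0) 0.
  apply/eqP; rewrite fz00 -normc_eq0; apply/eqP/le_anti; rewrite normc_ge0 andbT.
  by have := inD w (ltW wrho); rewrite fz00 normC0.
pose q w := f w / f z0 - 1.
have dq v : cdiff q v.
  exact: (cdiffB (cdiffM (df v) (@cdiff_cst _ (f z0)^-1 v)) (@cdiff_cst _ 1 v)).
have q0 : q z0 = 0 by rewrite /q mulfV// subrr.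
have q1 v : N (v - z0) <= rho -> N (q v + 1) <= 1.
  by move=> /inD vr; rewrite /q subrK Normc.normcM Normc.normcV ler_pdivrMr ?mul1r ?normc_gt0.
have [-> //|wz0] := eqVneq w z0.
suff : q w = 0 by move=> /eqP; rewrite subr_eq0 => /eqP qw1; rewrite -[LHS](divfK fz0) qw1 mul1r.
apply/eqP; rewrite -normc_eq0 eq_le normc_ge0 andbT leNgt; apply/negP => qw0.
pose kap := N (w - z0) / rho.
have kap1 : kap < 1 by rewrite ltr_pdivrMr// mul1r.
have kap0 : 0 <= kap by rewrite divr_ge0 ?normc_ge0 ?ltW.
(* Now [2 * d] is [(1 - kap) / 4] times [N (q w)], and the final inequality
   [1 <= kap * (1 + (1 - kap) / 4) ^+ 2] is impossible for [0 <= kap < 1]. *)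
pose d := N (q w) * (1 - kap) / 8.
have d0 : 0 < d by rewrite divr_gt0// mulr_gt0// subr_gt0.
have qd v : N (v - z0) <= rho -> N (q v) <= N (q v - (2 * d)%:C) /\ q v - (2 * d)%:C != 0.
  move=> /q1 q1v; have q1v2 : N (q v + 1) ^+ 2 <= 1 by rewrite expr_le1 ?normc_ge0.
  rewrite addrC normc2D1 in q1v2.
  have qdE : N (q v - (2 * d)%:C) ^+ 2 = N (q v) ^+ 2 - 4 * d * Re (q v) + 4 * d ^+ 2.
    by case: (q v) => x y; rewrite !normcE2 /=; ring.
  have Nq := sqr_ge0 (N (q v)).
  have Req : Re (q v) <= 0 by lra.
  have dRe : 0 <= - (d * Re (q v)) by rewrite -mulrN; apply: mulr_ge0; [exact: ltW|rewrite oppr_ge0].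
  have d2 : 0 < d ^+ 2 by rewrite exprn_gt0.
  split; first by rewrite -(@ler_pXn2r _ 2)// ?nnegrE ?normc_ge0// qdE; lra.
  by apply/eqP => qd0; move: qdE; rewrite qd0 normC0; lra.
pose U := [set v | 0 < N (v - z0)] `&` cball z0 rho.
have oU : open U by apply: openI; [exact: open_normc_gt|exact: open_cball].
have clU v : closure U v -> N (v - z0) <= rho.
  by apply: closure_normc_le => {}v [_ /= ?]; exact: ltW.
have bU : bounded_set U.
  apply/bounded_setC_P; exists (rho + N z0) => v [_]; rewrite /cball/= => vc.
  by have := normc_dist_le z0 v 0; rewrite !subr0; lra.
pose phi v := q v / (q v - (2 * d)%:C).
have dphi v : N (v - z0) <= rho -> cdiff phi v.
  move=> /qd[_ qv]; apply: (cdiffM (dq v)); apply: cdiffV => //.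
  exact: (cdiffB (dq v) (@cdiff_cst _ (2 * d)%:C v)).
have phi1 v : N (v - z0) <= rho -> N (phi v) <= 1.
  move=> /qd[qv qv0]; rewrite Normc.normcM Normc.normcV ler_pdivrMr ?mul1r//.
  by rewrite normc_gt0.
have z00 : N (z0 - z0) <= rho by rewrite subrr normC0 ltW.
have [psi cpsi phiE] := dphi z0 z00.
have phi0 : phi z0 = 0 by rewrite /phi q0 mul0r.
(* Thanks to the square, [h] tends to [0] at [z0] by mere continuity of [psi]. No removable
   singularity has to be treated: [z0] counts as a boundary point. *)
pose h v := phi v ^+ 2 * (v - z0)^-1.
have hE : h = fun v => psi v * psi v * (v - z0).
  apply/funext => v; rewrite /h phiE phi0 add0r.
  by have [->|vz0] := eqVneq v z0; [rewrite subrr invr0 !mulr0|field; rewrite subr_eq0].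
have dh v : closure U v -> v != z0 -> cdiff h v.
  move=> /clU vr vz0; apply: cdiffM; first by apply: cdiffX; exact: dphi.
  apply: cdiffV; last by rewrite subr_eq0.
  exact: (cdiffB (@cdiff_id _ v) (@cdiff_cst _ z0 v)).
have : N (h w) <= rho^-1.
  have Uw : U w by split; rewrite //= normc_gt0 subr_eq0.
  apply: (@max_principle _ h U _ oU bU _ _ _ _ w Uw).
  - by rewrite invr_ge0 ltW.
  - move=> v Uv; apply: dh; first exact: subset_closure.
    by case: Uv => /=; rewrite normc_gt0 subr_eq0.
  - move=> v clv; have [->|vz0] := eqVneq v z0; last exact: cdiff_cts (dh _ clv vz0).
    rewrite hE; apply: (ctsM (ctsM cpsi cpsi)).
    exact: (ctsD (@cts_id _ z0) (@cts_cst _ _ (- z0) z0)).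
  - move=> v; rewrite boundary_open// => -[clv nUv].
    have [->|vz0] := eqVneq v z0.
      by rewrite hE subrr mulr0 normC0 invr_ge0 ltW.
    have vr : N (v - z0) = rho.
      apply/eqP; rewrite eq_le clU//= leNgt; apply/negP => vr; apply: nUv; split => //=.
      by rewrite normc_gt0 subr_eq0.
    rewrite /h Normc.normcM Normc.normcV vr normcX.
    apply: ler_piMl; first by rewrite invr_ge0 ltW.
    by rewrite exprn_ile1 ?normc_ge0// phi1 ?vr.
have wz00 : 0 < N (w - z0) by rewrite normc_gt0 subr_eq0.
rewrite /h Normc.normcM Normc.normcV normcX ler_pdivrMr// mulrC -/kap.
have [_ qw] := qd w (ltW wrho); rewrite /phi Normc.normcM Normc.normcV expr_div_n.
rewrite ler_pdivrMr ?exprn_gt0 ?normc_gt0//.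
have tri2 : N (q w - (2 * d)%:C) <= N (q w) + 2 * d.
  by rewrite (le_trans (normc_le_add _ _))// normcN normc_real gtr0_norm//; lra.
move=> bad.
have {}bad : N (q w) ^+ 2 <= kap * (N (q w) + 2 * d) ^+ 2.
  apply: le_trans bad _; rewrite ler_wpM2l// lerXn2r// ?nnegrE ?normc_ge0//.
  exact: le_trans (normc_ge0 _) tri2.
have {}bad : 1 <= kap * (1 + (1 - kap) / 4) ^+ 2.
  rewrite -(@ler_pM2r _ (N (q w) ^+ 2)) ?exprn_gt0// mul1r; apply: le_trans bad _.
  by rewrite le_eqVlt; apply/orP; left; apply/eqP; rewrite /d; field.
by move: bad kap0 kap1; clear; nra.
Qed.

Lemma maxmod_attained f (r : R) : (forall z, cdiff f z) -> 0 <= r ->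
  exists z, [/\ N z = r, N (f z) = maxmod f r & forall w, N w = r -> N (f w) <= maxmod f r].
Proof.
move=> df r0.
have [|||z zr hz] := @compact_max _ [set w | N w = r] (fun w => N (f w)).
- apply: (@subclosed_compact _ _ [set w | N (w - 0) <= r]); last 2 first.
  + exact: compact_cdisk.
  + by move=> w /= wr; rewrite subr0 wr.
  + move=> w clw /=; rewrite -[w]subr0; apply/eqP; rewrite eq_le.
    rewrite (@closure_normc_le 0 r _ _ _ clw) ?(@closure_normc_ge 0 r _ _ _ clw)//.
    * by move=> v /= vr; rewrite subr0 vr.
    * by move=> v /= vr; rewrite subr0 vr.
- by exists r%:C; rewrite /mkset normc_real ger0_norm.
- move=> z _; apply: (@continuous_comp _ _ _ f (@Normc.normc R)); last exact: cts_normc.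
  exact: cdiff_cts.
have ub : ubound [set N (f z) | z in [set z | N z = r]] (N (f z)).
  by move=> _ [w wr <-]; exact: hz.
have -> : maxmod f r = N (f z).
  apply/eqP; rewrite eq_le; apply/andP; split.
    by apply: ge_sup => //; exists (N (f z)); exists z.
  by apply: ub_le_sup; [exists (N (f z))|exists z].
by exists z.
Qed.

Lemma normc_le_maxmod f z : (forall z, cdiff f z) -> N (f z) <= maxmod f (N z).
Proof. by move=> df; have [w [_ _]] := maxmod_attained df (normc_ge0 z); apply. Qed.

Lemma maxmod_ge0 f (r : R) : (forall z, cdiff f z) -> 0 <= r -> 0 <= maxmod f r.
Proof. by move=> df /(maxmod_attained df)[z [_ <- _]]; exact: normc_ge0. Qed.

Lemma max_principle_disc f (s : R) w : (forall z, cdiff f z) -> N w <= s ->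
  N (f w) <= maxmod f s.
Proof.
move=> df ws; have s0 : 0 <= s by exact: le_trans (normc_ge0 w) ws.
have [z [zs fz hz]] := maxmod_attained df s0.
have [ws'|ws'] := ltP (N w) s; last by apply: hz; apply: le_anti; rewrite ws.
pose U : set C := cball 0 s.
have Uw : U w by rewrite /U /cball/= subr0.
have clU v : closure U v -> N v <= s.
  by move=> clv; rewrite -[v]subr0; apply: closure_normc_le clv => {}v /= /ltW.
apply: (@max_principle _ f U _ (@open_cball _ 0 s) _ _ _ _ _ w Uw).
- by apply/bounded_setC_P; exists s => v; rewrite /U /cball/= subr0 => /ltW.
- exact: maxmod_ge0.
- by move=> v _; exact: df.
- by move=> v _; exact: cdiff_cts.
- move=> v; rewrite (boundary_open (@open_cball _ 0 s)) => -[clv nUv]; apply: hz.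
  apply: le_anti; rewrite clU//= leNgt; apply/negP => vs; apply: nUv.
  by rewrite /cball/= subr0.
Qed.

(** Otherwise a maximum point on the smaller circle would be an interior maximum for the larger
    disc. *)
Lemma maxmod_lt f (r s : R) : (forall z, cdiff f z) -> ~ (exists a, forall z, f z = a) ->
  0 <= r -> r < s -> maxmod f r < maxmod f s.
Proof.
move=> df fnc r0 rs; rewrite ltNge; apply/negP => Msr; apply: fnc.
have [z0 [z0r fz0 _]] := maxmod_attained df r0.
exists (f z0); apply: (@strong_max_principle _ _ s) => //; first by rewrite z0r.
by move=> w ws; rewrite fz0 (le_trans _ Msr)// max_principle_disc.
Qed.

(** * Growth of the iterated maximum modulus *)

Section Growth.
Variables (f : C -> C) (r0 : R).
Hypothesis df : forall z, cdiff f z.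
Hypothesis r0_gt0 : 0 < r0.
Hypothesis r0M : forall r, r0 <= r -> r < maxmod f r.

Lemma not_constant : ~ exists a, forall z, f z = a.
Proof.
move=> [a fa]; pose r := Num.max r0 (N a).
have r0r : r0 <= r by rewrite le_max lexx.
have [z [_ fz _]] := maxmod_attained df (le_trans (ltW r0_gt0) r0r).
by have := r0M r0r; rewrite -fz fa ltNge le_max lexx orbT.
Qed.

Definition rad n : R := iter n (maxmod f) r0.

Lemma rad_ge n : r0 <= rad n.
Proof. by elim: n => [//|n IH]; rewrite (le_trans IH)// ltW// r0M. Qed.

Lemma rad_gt0 n : 0 < rad n.
Proof. exact: lt_le_trans r0_gt0 (rad_ge n). Qed.

Lemma radS n : rad n < rad n.+1.
Proof. exact: r0M (rad_ge n). Qed.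

Lemma rad_le m n : (m <= n)%N -> rad m <= rad n.
Proof.
move=> /subnK <-; elim: (n - m)%N => [//|k IH].
by rewrite (le_trans IH)// addSn ltW// radS.
Qed.

Lemma normc_lt_maxmod z (r : R) : N z < r -> N (f z) < maxmod f r.
Proof.
move=> zr; apply: le_lt_trans (normc_le_maxmod z df) _.
by apply: maxmod_lt => //; [exact: not_constant|exact: normc_ge0].
Qed.

Lemma iter_lt_rad k m z : N z < rad m -> N (iter k f z) < rad (k + m).
Proof. by move=> zm; elim: k => [//|k IH]; exact: normc_lt_maxmod. Qed.

(* A finite supremum [L] of the radii would satisfy [maxmod f t <= L] for all
   [t < L], hence [maxmod f L <= L] by continuity. *)
Lemma rad_unbounded (B : R) : exists n, B < rad n.
Proof.
apply: contrapT => nB.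
have {}nB n : rad n <= B by rewrite leNgt; apply/negP => Bn; apply: nB; exists n.
pose L := sup (range rad).
have ubL n : rad n <= L.
  by apply: ub_le_sup; [exists B => _ [m _ <-]|exists n].
have L0 : 0 < L by exact: lt_le_trans (rad_gt0 0) (ubL 0%N).
have [z [zL fz _]] := maxmod_attained df (ltW L0).
have Lf : L < N (f z) by rewrite fz r0M// (le_trans (rad_ge 0)).
have [e e0 he] : exists2 e : R, 0 < e & forall w, N (w - z) < e -> L < N (f w).
  apply/near_cball.
  have cf : {for z, continuous (fun w => N (f w))}.
    apply: (@continuous_comp _ _ _ f (@Normc.normc R)); last exact: cts_normc.
    exact: cdiff_cts.
  exact: (cvgr_gt _ cf).
(* [t] is so close to 1 that [t%:C * z] is within [e] of [z], yet strictly inside the disc of radius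
   [L]. *)
pose t := Num.max (1 - e / (2 * L)) 0.
have t1 : t < 1 by rewrite gt_max ltr01 andbT ltrBlDr ltrDl divr_gt0// mulr_gt0.
have t0 : 0 <= t by rewrite le_max lexx orbT.
have te : (1 - t) * L < e.
  apply: (@le_lt_trans _ _ (e / 2)); last by lra.
  have : 1 - e / (2 * L) <= t by rewrite le_max lexx.
  rewrite -ler_pdivlMr// (_ : e / 2 / L = e / (2 * L)); first by lra.
  by field; rewrite gt_eqF.
have fw := he (t%:C * z).
have {fw}fw : L < N (f (t%:C * z)).
  apply: fw; rewrite (_ : t%:C * z - z = (t - 1)%:C * z); last by rewrite rmorphB; ring.
  by rewrite Normc.normcM normc_real zL ler0_norm ?opprB// subr_le0 ltW.
have [n hn] : exists n, t * L < rad n.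
  apply: contrapT => h.
  have : L <= t * L.
    apply: ge_sup; first by exists (rad 0); exists 0%N.
    by move=> _ [n _ <-]; rewrite leNgt; apply/negP => tn; apply: h; exists n.
  by rewrite ler_pMl// leNgt t1.
have : N (f (t%:C * z)) < rad n.+1.
  by apply: normc_lt_maxmod; rewrite Normc.normcM normc_real ger0_norm// zL.
by rewrite ltNge (le_trans (ubL n.+1))// ltW.
Qed.

End Growth.
End MaximumModulus.

(** * Open and connected plane sets *)

Section PlaneSets.
Context {R : realType}.
Local Notation C := R[i].
Local Notation N := Normc.normc.
Local Notation Re := complex.Re.
Local Notation Im := complex.Im.
Local Open Scope complex_scope.
Implicit Types (f g h : C -> C) (z w a b c u : C) (U V E G H K O : set C).

Definition segm a b : set C := [set a + t%:C * (b - a) | t in `[0, 1]%classic].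

Lemma segm_l a b : segm a b a.
Proof. by exists 0; rewrite /= ?in_itv/= ?lexx ?ler01// mul0r addr0. Qed.

Lemma segm_r a b : segm a b b.
Proof. by exists 1; rewrite /= ?in_itv/= ?lexx ?ler01// mul1r addrC subrK. Qed.

Lemma cts_affine a b (t : R) : {for t, continuous (fun t : R => a + t%:C * b : C)}.
Proof.
apply: (ctsD (@cts_cst _ _ a t)); apply: ctsM; last exact: (@cts_cst _ _ b t).
by apply: (@cts_realC _ _ (fun t : R => t)); exact: cvg_id.
Qed.

Lemma connected_segm a b : connected (segm a b).
Proof.
apply: connected_continuous_connected.
  by apply/connected_intervalP; exact: interval_is_interval.
by apply: continuous_subspaceT => t; exact: cts_affine.
Qed.

Lemma starlike_connected c V : (forall z, V z -> segm c z `<=` V) -> connected V.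
Proof.
move=> sV; have -> : V = \bigcup_(z in V) segm c z.
  apply/seteqP; split => [z Vz|z [w Vw]]; last exact: sV.
  by exists z => //; exact: segm_r.
apply: bigcup_connected; last by move=> z _; exact: connected_segm.
by exists c => z _; exact: segm_l.
Qed.

Lemma cball_center c (r : R) : 0 < r -> cball c r c.
Proof. by rewrite /cball /mkset subrr normC0. Qed.

Lemma connected_cball c (r : R) : connected (cball c r).
Proof.
apply: (@starlike_connected c) => z; rewrite /cball/= => zr w [t /=]; rewrite in_itv/= => /andP[t0 t1] <-.
rewrite addrC addKr Normc.normcM normc_real ger0_norm// (le_lt_trans _ zr)//.
by rewrite ler_piMl// normc_ge0.
Qed.

Lemma connected_plane : connected [set: C].
Proof. exact: (@starlike_connected 0). Qed.

(** The part of [K] in [O] is relatively open, and relatively closed since [K] misses the boundary.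
    Many connectedness arguments below go through this lemma. *)
Lemma connected_sub_open K O : connected K -> open O -> K `&` O !=set0 ->
  K `&` boundary O = set0 -> K `<=` O.
Proof.
move=> cK oO KO KdO; have E : K `&` O = K `&` closure O.
  apply/seteqP; split => z [Kz]; first by move=> /subset_closure.
  move=> clz; split => //; apply: contrapT => nOz.
  have : (K `&` boundary O) z by split => //; rewrite boundary_open.
  by rewrite KdO.
rewrite -(cK _ KO); first by move=> z [].
  by exists O.
by exists (closure O) => //; exact: closed_closure.
Qed.

Lemma boundary_neq0 O : open O -> bounded_set O -> O !=set0 -> boundary O !=set0.
Proof.
move=> oO bO O0; apply/set0P/eqP => dO.
have /bounded_setC_P[r hr] := bO.
have : [set: C] `<=` O.
  apply: connected_sub_open => //; [exact: connected_plane| |].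
    by case: O0 => z Oz; exists z.
  by rewrite dO setI0.
move=> /(_ (`|r| + 1)%:C I) /hr; rewrite normc_real ger0_norm; last by rewrite addr_ge0.
by have := ler_norm r; lra.
Qed.

Lemma component_open V x : open V -> open (connected_component V x).
Proof.
move=> /openCP oV; apply/openCP => z cz.
have Vz : V z by exact: connected_component_sub cz.
have [e e0 he] := oV z Vz; exists e => //.
rewrite (same_connected_component cz); apply: connected_component_max => //.
  by rewrite /cball/= subrr normC0.
exact: connected_cball.
Qed.

Lemma component_boundary V x : open V -> boundary (connected_component V x) `<=` ~` V.
Proof.
move=> oV z; rewrite (boundary_open (@component_open V x oV)) => -[/closureCP clz nz] Vz.
have [e e0 he] := (iffLR (openCP V) oV) z Vz.
have [w cw wz] := clz e e0; apply: nz.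
rewrite (same_connected_component cw); apply: (@connected_component_max _ _ (cball z e)) => //.
- exact: connected_cball.
- by rewrite /cball/= subrr normC0.
Qed.

(* For closed [E] this says that all its components are unbounded. *)
Definition no_bounded_part E := forall O, open O -> bounded_set O ->
  boundary O `&` E = set0 -> O `&` E = set0.

(** For open connected [G] this stands in for simple connectivity and speaks of open sets instead of
    curves. *)
Definition hole_free G := forall O, open O -> bounded_set O -> boundary O `<=` G -> O `<=` G.

(** A point [y] of [O] outside the component would have its own component [K] of the complement of
    [E]. It cannot leave [O], so its boundary lies in [E] and in the closure of [O], which are
    disjoint. *)
Lemma hole_free_component E x : closed E -> no_bounded_part E ->
  hole_free (connected_component (~` E) x).
Proof.
move=> cE nE O oO bO dO y Oy; apply: contrapT => nHy.
have oE : open (~` E) by exact: closed_openC.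
have dOE : boundary O `&` E = set0.
  by apply/seteqP; split => // z [/dO /connected_component_sub].
have OE := nE O oO bO dOE.
have nEy : (~` E) y by move=> Ey; have : (O `&` E) y by []; rewrite OE.
pose K := connected_component (~` E) y.
have Ky : K y by exact: connected_component_refl.
have KO : K `<=` O.
  apply: connected_sub_open => //; first exact: component_connected.
    by exists y.
  apply/seteqP; split => // z [Kz /dO xz]; apply: nHy.
  apply: connected_component_trans xz _; exact: connected_component_sym.
have oK : open K by exact: component_open.
have [z dKz] : boundary K !=set0.
  by apply: boundary_neq0 => //; [exact: bounded_subset KO bO|exists y].
have Ez : E z by apply: contrapT; exact: (component_boundary oE dKz).
have clz : closure O z by apply: (closure_subset KO); exact: boundary_sub_closure.
have [Oz|nOz] := pselect (O z).
  by have : (O `&` E) z by []; rewrite OE.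
have : (boundary O `&` E) z by split => //; rewrite boundary_open.
by rewrite dOE.
Qed.

(* [g @` G] is open near [H]: at a value [w'] omitted by [g] on [G] the maximum
   principle applies to [1 / (g - w')]. *)
Lemma image_covers g G H : (forall z, cdiff g z) -> open G -> bounded_set G -> connected H ->
  H `&` (g @` boundary G) = set0 -> H `&` (g @` G) !=set0 -> H `<=` g @` G.
Proof.
move=> dg oG bG cH HdG HG.
have cg : continuous g by move=> z; exact: cdiff_cts.
have inner w : H w -> (g @` G) w -> (g @` G)^° w.
  move=> Hw [z Gz gzw].
  (* The gap is [2 * e], so that any [w'] within [e] of [w] is still at distance [e] from the image
     of the boundary. *)
  have [e e0 he] : exists2 e : R, 0 < e & forall v, boundary G v -> 2 * e <= N (g v - w).
    have [dG0|/set0P dG0] := eqVneq (boundary G) set0.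
      by exists 1 => // v; rewrite dG0.
    have [|v dv hv] := @compact_max _ (boundary G) (fun v => - N (g v - w))
        (compact_boundary bG) dG0.
      move=> v _; apply: (@cvgN _ _ _ (nbhs v)).
      apply: (@continuous_comp _ _ _ (fun v => g v - w) (@Normc.normc R)); last exact: cts_normc.
      exact: (ctsD (cg v) (@cts_cst _ _ (- w) v)).
    exists (N (g v - w) / 2) => [|u /hv]; last by rewrite lerN2; lra.
    rewrite divr_gt0// normc_gt0 subr_eq0; apply/eqP => gvw.
    have : (H `&` (g @` boundary G)) w by split => //; exists v.
    by rewrite HdG.
  apply/nbhs_cballP; exists e => // w'; rewrite /cball/= => w'w.
  apply: contrapT => nw'.
  have ndG v : boundary G v -> e <= N (g v - w').
    by move=> /he; have := normc_dist_le w' (g v) w; lra.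
  have neq v : closure G v -> g v - w' != 0.
    move=> clv; have [Gv|nGv] := pselect (G v).
      by rewrite subr_eq0; apply/eqP => gvw'; apply: nw'; exists v.
    rewrite -normc_gt0; apply: lt_le_trans e0 (ndG _ _).
    by rewrite boundary_open.
  have dh v : closure G v -> cdiff (fun v => (g v - w')^-1) v.
    by move=> /neq gv; exact: (cdiffV (cdiffB (dg v) (@cdiff_cst _ w' v)) gv).
  have : N ((g z - w')^-1) <= e^-1.
    apply: (@max_principle _ (fun v => (g v - w')^-1) G _ oG bG _ _ _ _ z Gz).
    - by rewrite invr_ge0 ltW.
    - by move=> v Gv; apply: dh; exact: subset_closure.
    - by move=> v clv; exact: cdiff_cts (dh _ clv).
    - move=> v dv; rewrite Normc.normcV lef_pV2 ?posrE//; first exact: ndG.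
      exact: lt_le_trans e0 (ndG _ dv).
  rewrite gzw Normc.normcV lef_pV2 ?posrE//; first by rewrite normcBC leNgt w'w.
  rewrite normc_gt0 -gzw; apply: neq; exact: subset_closure.
(* This set is open in [H] by [inner], and closed in [H] because the closure of [G] is compact. *)
have E : H `&` (g @` G) = H `&` (g @` closure G).
  apply/seteqP; split => w [Hw [z Gz gz]]; split => //.
    by exists z => //; exact: subset_closure.
  have [Gz'|nGz] := pselect (G z); first by exists z.
  have : (H `&` (g @` boundary G)) w by split => //; exists z => //; rewrite boundary_open.
  by rewrite HdG.
rewrite -(cH _ HG); first by move=> w [].
  exists (g @` G)^°; first exact: open_interior.
  apply/seteqP; split => w [Hw gw]; split => //; first exact: inner.
  exact: interior_subset gw.
exists (g @` closure G) => //; apply: compact_closed; first exact: norm_hausdorff.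
apply: continuous_compact; last exact: compact_closureC.
exact: continuous_subspaceT.
Qed.

End PlaneSets.

(** * Fast escaping points *)

Section FastEscaping.
Context {R : realType}.
Local Notation C := R[i].
Local Notation N := Normc.normc.
Variables (f : C -> C) (r0 : R).
Hypothesis df : forall z, cdiff f z.
Hypothesis r0_gt0 : 0 < r0.
Hypothesis r0M : forall r, r0 <= r -> r < maxmod f r.
Implicit Types (z w : C) (E G H K O : set C).

Local Notation rad := (rad f r0).

(* [level m L] is the set of points whose orbit, delayed by [L], stays ahead of
   the sequence of radii started at [rad m]: thus [A_ (rad m) f = level m 0]
   and the fast escaping set is the union of the [level 0 L]. *)
Definition level m L : set C :=
  [set z | forall n, (0 < n)%N -> rad (n + m) <= N (iter (n + L) f z)].

Lemma cts_iter n z : {for z, continuous (fun w => N (iter n f w) : R)}.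
Proof.
apply: (@continuous_comp _ _ _ (iter n f) (@Normc.normc R)); last exact: cts_normc.
exact: cdiff_cts (cdiff_iter n z df).
Qed.

Lemma near_iter_lt n z (r : R) : N (iter n f z) < r -> \forall w \near z, N (iter n f w) < r.
Proof. move=> zr; exact: (cvgr_lt _ (@cts_iter n z) _ zr). Qed.

Lemma iter_ahead k n m L z : N (iter (n + L) f z) < rad (n + m) ->
  N (iter (k + n + L) f z) < rad (k + n + m).
Proof.
move=> h; rewrite -addnA iterD -addnA.
exact: (iter_lt_rad df r0_gt0 r0M).
Qed.

Lemma level_closed m L : closed (level m L).
Proof.
move=> z clz n n0; rewrite leNgt; apply/negP => zn.
by have [w [/(_ n n0) + wn]] := clz _ (near_iter_lt zn); rewrite leNgt wn.
Qed.

Lemma level_no_bounded_part m L : no_bounded_part (level m L).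
Proof.
move=> O oO bO dOE; apply/seteqP; split => // z0 [Oz0 Ez0].
have : \forall n \near \oo, boundary O `<=` [set z | N (iter (n + L) f z) < rad (n + m)].
  apply: (iffLR (compact_near_coveringP _) (compact_boundary bO)) => z dz.
  have [n n0 zn] : exists2 n, (0 < n)%N & N (iter (n + L) f z) < rad (n + m).
    apply: contrapT => h; suff : (boundary O `&` level m L) z by rewrite dOE.
    split => // n n0; rewrite leNgt; apply/negP => zn; apply: h; by exists n.
  exists ([set w | N (iter (n + L) f w) < rad (n + m)], [set k | (n <= k)%N]).
    by split; [exact: near_iter_lt|exists n].
  move=> [w k] [/= wn nk]; rewrite -(subnK nk); exact: iter_ahead.
move=> [n _ hn].
(* [level] only tests positive times. *)
have {}hn := hn n.+1 (leqnSn n).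
(* Compactness turns the pointwise strict bound on the boundary into a uniform one. *)
have [M [M0 Mr Mh]] : exists M : R, [/\ 0 <= M, M < rad (n.+1 + m) &
    forall z, boundary O z -> N (iter (n.+1 + L) f z) <= M].
  have [dG0|/set0P dG0] := eqVneq (boundary O) set0.
    by exists 0; split => // [|z]; [exact: rad_gt0|rewrite dG0].
  have [|z dz hz] := @compact_max _ (boundary O) (fun z => N (iter (n.+1 + L) f z))
    (compact_boundary bO) dG0.
    by move=> z _; exact: cts_iter.
  by exists (N (iter (n.+1 + L) f z)); split => //; [exact: normc_ge0|exact: hn].
have := Ez0 n.+1 isT; apply/negP; rewrite -ltNge; apply: le_lt_trans Mr.
apply: (@max_principle _ _ O _ oO bO M0 _ _ Mh z0 Oz0) => z _.
  exact: cdiff_iter.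
exact: cdiff_cts (cdiff_iter _ _ df).
Qed.

Lemma level_m_sub m m' L : (m <= m')%N -> level m' L `<=` level m L.
Proof.
move=> mm z h n n0; apply: le_trans (h n n0); apply: rad_le => //.
by rewrite leq_add2l.
Qed.

(** A longer delay reads the condition of the shorter one at a later index, where the radius is
    larger. *)
Lemma level_L_sub m L L' : (L <= L')%N -> level m L `<=` level m L'.
Proof.
move=> LL z h n n0; have := h (n + (L' - L))%N; rewrite addn_gt0 n0 => /(_ isT).
rewrite -(addnA n _ L) subnK//; apply: le_trans; apply: rad_le => //.
by rewrite leq_add2r leq_addr.
Qed.

Definition core m : set C := connected_component (~` level m 0) 0.

Lemma level_compl_open m L : open (~` level m L).
Proof. exact/closed_openC/level_closed. Qed.

Lemma disc_sub_level_compl m : cball 0 (rad m) `<=` ~` level m 0.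
Proof.
move=> z; rewrite /cball/= subr0 => zm /(_ 1%N isT).
by rewrite leNgt addn0 (iter_lt_rad df r0_gt0 r0M).
Qed.

Lemma disc_sub_core m : cball 0 (rad m) `<=` core m.
Proof.
apply: connected_component_max.
- exact/cball_center/rad_gt0.
- exact: disc_sub_level_compl.
- exact: connected_cball.
Qed.

Lemma core0 m : core m 0.
Proof. exact/disc_sub_core/cball_center/rad_gt0. Qed.

Lemma core_open m : open (core m).
Proof. apply: component_open; exact: level_compl_open. Qed.

Lemma core_connected m : connected (core m).
Proof. exact: component_connected. Qed.

Lemma core_boundary m : boundary (core m) `<=` level m 0.
Proof.
move=> z /component_boundary h; apply: contrapT => nz.
by apply: h nz; exact: level_compl_open.
Qed.

Lemma core_hole_free m : hole_free (core m).
Proof.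
by apply: hole_free_component; [exact: level_closed|exact: level_no_bounded_part].
Qed.

Lemma core_sub m m' : (m <= m')%N -> core m `<=` core m'.
Proof.
move=> mm; apply: connected_component_max; first exact: core0.
  move=> z /connected_component_sub nz lz; apply: nz; exact: level_m_sub lz.
exact: core_connected.
Qed.

Lemma core_cover z : exists m, core m z.
Proof.
have [m zm] := rad_unbounded df r0_gt0 r0M (N z).
by exists m; apply: disc_sub_core; rewrite /cball/= subr0.
Qed.

Lemma core_bounded : has_bounded_component (~` level 0 0) ->
  exists n, forall m, (n <= m)%N -> bounded_set (core m).
Proof.
move=> [z nz bG]; set G := connected_component _ z in bG.
have oG : open G by apply: component_open; exact: level_compl_open.
have Gz : G z by exact: connected_component_refl.
have [n n0 zn] : exists2 n, (0 < n)%N & N (iter n f z) < rad n.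
  apply: contrapT => h; apply: nz => n n0; rewrite !addn0 leNgt; apply/negP => zn.
  by apply: h; exists n.
exists n => m nm.
have zm : N (iter m f z) < rad m.
  have := @iter_ahead (m - n) n 0 0 z; rewrite !addn0 subnK//; exact.
have : core m `<=` iter m f @` G.
  apply: image_covers => //.
  - by move=> w; exact: cdiff_iter.
  - exact: core_connected.
  - apply/seteqP; split => // w [cw [v dv vw]].
    have nw : ~ level m 0 w by exact: connected_component_sub cw.
    apply: nw => k k0; rewrite -vw addn0 -iterD.
    have lv : level 0 0 v.
      apply: contrapT => nv; apply: (@component_boundary _ (~` level 0 0) z _ v dv nv).
      exact: level_compl_open.
    by have := lv (k + m)%N; rewrite addn_gt0 k0 !addn0 => /(_ isT).
  - exists (iter m f z); split; last by exists z.
    by apply: disc_sub_core; rewrite /cball/= subr0.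
move=> cG; have /bounded_setC_P[r hr] := bG.
have [M _ hM] := @entire_bounded_on _ (iter m f) r 0 (fun w => cdiff_iter m w df).
apply/bounded_setC_P; exists M => w /cG[v Gv <-]; apply: hM; rewrite subr0; exact: hr.
Qed.

End FastEscaping.

(** * A connectedness criterion for closed plane sets *)

Section ConnectedPlaneSets.
Context {R : realType}.
Local Notation C := R[i].
Local Notation N := Normc.normc.
Local Notation Re := complex.Re.
Local Notation Im := complex.Im.
Local Open Scope complex_scope.
Implicit Types (z w a b c u x y : C) (U V E G H K O P Q : set C).

Lemma compact_pair_min P Q : compact P -> compact Q -> P !=set0 -> Q !=set0 ->
  exists p q, [/\ P p, Q q & forall p' q', P p' -> Q q' -> N (p - q) <= N (p' - q')].
Proof.
move=> cP cQ [p Pp] [q Qq].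
have [||[p0 q0] /set_mem[/= Pp0 Qq0] h] := @compact_EVT_min _ R (fun x : C * C => N (x.1 - x.2))
    (P `*` Q) _ (compact_setX cP cQ).
- by exists (p, q).
- apply: continuous_subspaceT => x.
  apply: (@continuous_comp _ _ _ (fun x : C * C => x.1 - x.2) (@Normc.normc R)); last exact: cts_normc.
  by apply: (@cvgB _ _ _ (nbhs x)); [exact: cvg_fst|exact: cvg_snd].
exists p0, q0; split => // p' q' Pp' Qq'.
by apply: (h (p', q')); apply/mem_set.
Qed.

(** The unions of [e]-balls around the points of either value are open and complementary on [K]. *)
Lemma connected_locally_constant K (s : C -> bool) (e : R) : connected K -> 0 < e ->
  (forall x y, K x -> K y -> N (x - y) < e -> s x = s y) ->
  forall x y, K x -> K y -> s x = s y.
Proof.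
move=> cK e0 sK x y Kx Ky.
pose B (b : bool) := \bigcup_(z in [set z | K z /\ s z = b]) cball z e.
have oB (b : bool) : open (B b) by apply: bigcup_open => z _; exact: open_cball.
have BE (b : bool) w : K w -> B b w <-> s w = b.
  move=> Kw; split=> [[z [Kz <-] wz]|<-]; first exact: sK.
  by exists w => //; exact: cball_center.
have E : K `&` B (s x) = K.
  apply: cK; first by exists x; split => //; apply/BE.
    by exists (B (s x)).
  exists (~` B (~~ s x)); first exact: open_closedC.
  apply/seteqP; split => z [Kz Bz]; split => //.
    by move=> /(BE _ _ Kz); move/(BE _ _ Kz): Bz => ->; case: (s x).
  apply/(BE _ _ Kz); apply/eqP; rewrite -[_ == _]negbK; apply/negP => szx; apply: Bz.
  by apply/(BE _ _ Kz); move: szx; case: (s z); case: (s x).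
have : (K `&` B (s x)) y by rewrite E.
by move=> [_ /(BE _ _ Ky)].
Qed.

Lemma segm_cross U x y : open U -> U x -> ~ U y -> exists2 v, boundary U v &
  N (x - v) <= N (x - y) /\ N (y - v) <= N (x - y).
Proof.
move=> oU Ux nUy.
have [v [[t /=]]] : segm x y `&` boundary U !=set0.
  apply/set0P/eqP => h; apply: nUy; apply: (@connected_sub_open _ (segm x y) U).
  - exact: connected_segm.
  - exact: oU.
  - by exists x; split => //; exact: segm_l.
  - exact: h.
  - exact: segm_r.
rewrite in_itv/= => /andP[t0 t1] vE dv; exists v => //; rewrite -vE; split.
  rewrite opprD addNKr normcN Normc.normcM normc_real ger0_norm// normcBC.
  by rewrite ler_piMl// normc_ge0.
rewrite (_ : y - _ = (1 - t)%:C * (y - x)); last by rewrite rmorphB rmorph1; ring.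
rewrite Normc.normcM normc_real ger0_norm ?subr_ge0// normcBC.
by rewrite ler_piMl ?normc_ge0//; lra.
Qed.

(* [crossings n n x] is the parity of the number of times that the radius from [0]
   to [x], sampled at [n] points, crosses the part of the boundary of [U] that is
   close to [Q0]. *)
Section Crossing.
Variables (U Q0 : set C) (eta : R).
Hypothesis eta0 : 0 < eta.
Let inU x := `[< U x >].
Definition close_to x := `[< exists2 q, Q0 q & N (x - q) < eta >].
Hypothesis close_eq : forall x y, N (x - y) < eta -> inU x != inU y -> close_to x = close_to y.

Definition crossing x y := (inU x (+) inU y) && close_to x.

(** Among three nearby points either no pair or exactly two pairs change sides, and such pairs agree
    on being close to [Q0]. *)
Lemma crossing_cocycle x y z : N (x - y) < eta -> N (y - z) < eta -> N (x - z) < eta ->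
  crossing x y (+) crossing y z = crossing x z.
Proof.
move=> /close_eq xy /close_eq yz /close_eq xz; rewrite /crossing.
move: xy yz xz; case: (inU x); case: (inU y); case: (inU z); case: (close_to x);
  case: (close_to y); case: (close_to z) => //= xy yz xz;
  first [by have := xy isT|by have := yz isT|by have := xz isT].
Qed.

Definition radius_pt n k x : C := (k%:R / n%:R)%:C * x.

Fixpoint crossings n k x : bool :=
  if k is j.+1 then crossings n j x (+) crossing (radius_pt n j x) (radius_pt n j.+1 x)
  else false.

(** The two radii and the chords between their sample points form a ladder. Each of its cells has
    sum zero by [crossing_cocycle], and both radii start at [0]. *)
Lemma crossingsP n k (rho : R) x y : (k <= n)%N -> (0 < n)%N -> rho / n%:R < eta / 2 ->
  N x <= rho -> N y <= rho -> N (x - y) < eta / 2 ->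
  crossings n k x (+) crossings n k y = crossing (radius_pt n k x) (radius_pt n k y).
Proof.
move=> kn n0 rhon xr yr xy.
have n0' : 0 < n%:R :> R by rewrite ltr0n.
have step j z : N z <= rho -> N (radius_pt n j z - radius_pt n j.+1 z) < eta / 2.
  move=> zr; rewrite /radius_pt -mulrBl -rmorphB Normc.normcM normc_real -mulrBl -natr1.
  rewrite opprD addNKr mulN1r normrN ger0_norm ?invr_ge0 ?ltW// mulrC.
  by apply: le_lt_trans rhon; rewrite ler_pM2r ?invr_gt0.
have dist j : (j <= n)%N -> N (radius_pt n j x - radius_pt n j y) < eta / 2.
  move=> jn; rewrite /radius_pt -mulrBr Normc.normcM normc_real ger0_norm; last first.
    by rewrite divr_ge0.
  apply: le_lt_trans xy; rewrite ler_piMl ?normc_ge0// ler_pdivrMr// mul1r.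
  by rewrite ler_nat.
elim: k kn => [_|k IH kn].
  by rewrite /radius_pt mul0r !mul0r /crossing addbb.
rewrite /= addbACA IH ?(ltnW kn)//.
set p := radius_pt n k x; set p' := radius_pt n k y.
set p1 := radius_pt n k.+1 x; set p1' := radius_pt n k.+1 y.
have e1 : N (p - p') < eta / 2 by exact: dist (ltnW kn).
have e2 : N (p1 - p1') < eta / 2 by exact: dist kn.
have e3 : N (p - p1) < eta / 2 by exact: step.
have e4 : N (p' - p1') < eta / 2 by exact: step.
have e5 : N (p - p1') < eta by have := normc_dist_le p' p p1'; lra.
have c1 : crossing p p' (+) crossing p' p1' = crossing p p1'.
  by apply: crossing_cocycle => //; move: eta0 e1 e2 e3 e4; clear; lra.
have c2 : crossing p p1 (+) crossing p1 p1' = crossing p p1'.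
  by apply: crossing_cocycle => //; move: eta0 e1 e2 e3 e4; clear; lra.
have : crossing p p' (+) crossing p' p1' = crossing p p1 (+) crossing p1 p1' by rewrite c1 c2.
by case: (crossing p p'); case: (crossing p' p1'); case: (crossing p p1); case: (crossing p1 p1').
Qed.

Lemma crossings_end n (rho : R) x y : (0 < n)%N -> rho / n%:R < eta / 2 ->
  N x <= rho -> N y <= rho -> N (x - y) < eta / 2 ->
  crossings n n x (+) crossings n n y = crossing x y.
Proof.
move=> n0 rhon xr yr xy; rewrite (crossingsP (leqnn n) n0 rhon xr yr xy) /radius_pt.
by rewrite divff ?mul1r// pnatr_eq0 -lt0n.
Qed.

End Crossing.

Definition clamp (r t : R) : R := Num.max (- r) (Num.min r t).

Lemma clamp_id (r t : R) : - r <= t <= r -> clamp r t = t.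
Proof. by move=> /andP[t1 t2]; rewrite /clamp min_r// max_r. Qed.

Lemma clamp_bound (r t : R) : 0 <= r -> - r <= clamp r t <= r.
Proof. by move=> r0; rewrite le_max lexx ge_max ge_min lexx /=; lra. Qed.

Lemma clamp_dist (r s t : R) : 0 <= r -> `|clamp r s - clamp r t| <= `|s - t|.
Proof.
move=> r0; rewrite /clamp; have := ler_norm (s - t); have := ler_norm (t - s).
rewrite (distrC t) => h1 h2; rewrite ler_norml.
case: (leP r s) => ?; case: (leP r t) => ?; case: (leP (- r) r) => ?;
  case: (leP (- r) s) => ?; case: (leP (- r) t) => ?; apply/andP; split; lra.
Qed.

(** Retracting to a box bounds the length of all sampled radii, so that one [n] is fine enough for
    the whole plane. *)
Definition box_retract (r : R) z : C := clamp r (Re z) +i* clamp r (Im z).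

Lemma box_retract_dist (r : R) z w : 0 <= r -> N (box_retract r z - box_retract r w) <= N (z - w).
Proof.
move=> r0; rewrite -(@ler_pXn2r _ 2)// ?nnegrE ?normc_ge0// !normcE2.
rewrite -[Re (z - w) ^+ 2]real_normK ?num_real// -[Im (z - w) ^+ 2]real_normK ?num_real//.
rewrite -[Re (box_retract r z - _) ^+ 2]real_normK ?num_real//.
rewrite -[Im (box_retract r z - _) ^+ 2]real_normK ?num_real//.
by rewrite lerD// lerXn2r ?nnegrE// !raddfB/= clamp_dist.
Qed.

Lemma halfplane_connected u (k : R) c : k <= Re (c * u) -> connected [set z | k <= Re (z * u)].
Proof.
move=> kc; apply: (@starlike_connected _ c) => z /= kz v [t /=]; rewrite in_itv/= => /andP[t0 t1] <-.
have -> : Re ((c + t%:C * (z - c)) * u) = (1 - t) * Re (c * u) + t * Re (z * u).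
  by case: (c) (z) (u) => [c1 c2] [z1 z2] [u1 u2] /=; ring.
have : 0 <= (1 - t) * (Re (c * u) - k) by rewrite mulr_ge0 ?subr_ge0.
have : 0 <= t * (Re (z * u) - k) by rewrite mulr_ge0 ?subr_ge0.
by lra.
Qed.

Lemma box_exterior_connected (r : R) : 0 <= r ->
  connected [set z | r <= `|Re z| \/ r <= `|Im z|].
Proof.
move=> r0.
pose H u := [set z | r <= Re (z * u)].
have -> : [set z | r <= `|Re z| \/ r <= `|Im z|] =
    (H 1 `|` H (0 -i* 1)) `|` (H (-1) `|` H (0 +i* 1)).
  apply/seteqP; split => -[x y]; rewrite /H/= !mulr0 !mulr1 !mulrN1 !subr0 !add0r ?opprK oppr0 mulr0 subr0.
    case=> [|]; rewrite real_ler_normr ?num_real// => /orP[] h; tauto.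
  by move=> [[h|h]|[h|h]]; [left|right|left|right];
    rewrite real_ler_normr ?num_real// h ?orbT.
apply: connectedU.
- by exists (r -i* r); split; [left|right]; rewrite /H/=; lra.
- apply: connectedU.
  + by exists (r +i* r); split; rewrite /H/=; lra.
  + by apply: (@halfplane_connected _ _ r%:C) => /=; lra.
  + by apply: (@halfplane_connected _ _ (0 +i* r)) => /=; lra.
- apply: connectedU.
  + by exists ((- r) -i* r); split; rewrite /H/=; lra.
  + by apply: (@halfplane_connected _ _ (- r)%:C) => /=; lra.
  + by apply: (@halfplane_connected _ _ (0 -i* r)) => /=; lra.
Qed.

(* The parity [S] jumps exactly across the part of the boundary of [U] near [Q0].
   It thus takes both values on the boundary of [U] but is locally constant off
   [U], hence constant outside a large box. The set [F] of the points off [U] with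
   the other parity is then bounded, and the boundary of its neighbourhood [O]
   avoids [E], although [O] meets [E]. *)
Lemma boundary_not_split E U P0 Q0 a b : no_bounded_part E -> open U -> connected U ->
  bounded_set U -> U `&` E = set0 -> boundary U `<=` E -> boundary U `<=` P0 `|` Q0 ->
  compact P0 -> compact Q0 -> (forall z, P0 z -> Q0 z -> False) ->
  boundary U a -> P0 a -> boundary U b -> Q0 b -> False.
Proof.
move=> nE oU cU bU UE dUE dU cP cQ PQ dUa Pa dUb Qb.
have [||p0 [q0 [Pp0 Qq0 pqmin]]] := compact_pair_min cP cQ; [by exists a|by exists b|].
(* With a quarter of the distance, a step shorter than [eta] across the boundary of [U] is near
   exactly one of the two parts. *)
pose eta := N (p0 - q0) / 4.
have pq0 : 0 < N (p0 - q0).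
  rewrite normc_gt0 subr_eq0; apply/eqP => pq; apply: (PQ p0) => //; by rewrite pq.
have eta0 : 0 < eta by rewrite divr_gt0.
have PQeta p q : P0 p -> Q0 q -> 4 * eta <= N (p - q).
  by move=> Pp Qq; have := pqmin _ _ Pp Qq; rewrite /eta; lra.
have close_b x y : U x -> ~ U y -> N (x - y) < eta ->
    close_to Q0 eta x = close_to Q0 eta y.
  move=> Ux nUy xy; have [v /dU[Pv|Qv] [xv yv]] := segm_cross oU Ux nUy.
    rewrite /close_to; apply/asboolP/asboolP => -[q Qq vq].
      by have := PQeta _ _ Pv Qq; have := normc_dist_le x v q; rewrite (normcBC v x); lra.
    by have := PQeta _ _ Pv Qq; have := normc_dist_le y v q; rewrite (normcBC v y); lra.
  by rewrite /close_to; apply/asboolP/asboolP => _; exists v => //; lra.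
have close_eq x y : N (x - y) < eta -> `[< U x >] != `[< U y >] ->
    close_to Q0 eta x = close_to Q0 eta y.
  move=> xy; case: asboolP => Ux; case: asboolP => Uy //= _; first exact: close_b.
  by apply/esym/close_b => //; rewrite normcBC.
have /bounded_setC_P[rho0 hrho0] := bounded_closure bU.
pose r := `|rho0| + 1.
have r0 : 0 < r by rewrite ltr_wpDl.
have boxU z : closure U z -> `|Re z| < r /\ `|Im z| < r.
  move=> /hrho0 zr; have := Re_le_normc z; have := Im_le_normc z; have := ler_norm rho0.
  by rewrite /r; split; lra.
pose V := [set z : C | r <= `|Re z| \/ r <= `|Im z|].
have VU z : V z -> ~ U z.
  by move=> Vz Uz; have [] := boxU z (subset_closure Uz); case: Vz; lra.
have boxN z : `|Re z| <= r -> `|Im z| <= r -> N z <= 2 * r.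
  by move=> h1 h2; have := normc_le_ReIm z; lra.
have retN z : N (box_retract r z) <= 2 * r.
  by apply: boxN; rewrite /= ler_norml clamp_bound// ltW.
have ret_id z : `|Re z| <= r -> `|Im z| <= r -> box_retract r z = z.
  by case: z => x y /= /ler_normlP[x1 x2] /ler_normlP[y1 y2]; rewrite /box_retract/= !clamp_id//;
    apply/andP; split; lra.
have ret_out z : ~ U z -> ~ U (box_retract r z).
  move=> nUz Uz; have [z1 z2] := boxU _ (subset_closure Uz).
  apply: nUz; rewrite -(ret_id z)//.
    rewrite leNgt; apply/negP => rz; move: z1; rewrite /= /clamp.
    move: rz; rewrite real_ltr_normr ?num_real// => /orP[] rz.
      by rewrite min_l ?(ltW rz)// max_r ?gtr0_norm ?ltxx//; lra.
    by rewrite min_r ?max_l ?normrN ?gtr0_norm ?ltxx//; lra.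
  rewrite leNgt; apply/negP => rz; move: z2; rewrite /= /clamp.
  move: rz; rewrite real_ltr_normr ?num_real// => /orP[] rz.
    by rewrite min_l ?(ltW rz)// max_r ?gtr0_norm ?ltxx//; lra.
  by rewrite min_r ?max_l ?normrN ?gtr0_norm ?ltxx//; lra.
have [n hn] := ex_natr_gt (2 * r / (eta / 2)).
have n0 : (0 < n)%N.
  rewrite -(ltr_nat R); apply: lt_trans hn; rewrite divr_gt0// ?divr_gt0// mulr_gt0//.
have rhon : 2 * r / n%:R < eta / 2.
  by rewrite ltr_pdivrMr ?ltr0n// (mulrC (eta / 2)) -ltr_pdivrMr// divr_gt0.
pose S := crossings U Q0 eta n n.
have SP x y : N x <= 2 * r -> N y <= 2 * r -> N (x - y) < eta / 2 ->
    S x (+) S y = crossing U Q0 eta x y.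
  exact: crossings_end.
have eta20 : 0 < eta / 2 by rewrite divr_gt0.
(* [S] is only controlled at points of modulus at most [2 * r]; the retraction extends it to the
   plane and keeps points off [U] off [U]. *)
pose sg z := S (box_retract r z).
have sg_loc x y : ~ U x -> ~ U y -> N (x - y) < eta / 2 -> sg x = sg y.
  move=> Ux Uy xy; have := SP _ _ (retN x) (retN y) (le_lt_trans (box_retract_dist _ _ (ltW r0)) xy).
  rewrite /crossing; have /asboolPn/negbTE-> := ret_out _ Ux; have /asboolPn/negbTE-> := ret_out _ Uy.
  by rewrite /= /sg; case: (S (box_retract r x)); case: (S (box_retract r y)).
have clN z : closure U z -> N z <= 2 * r.
  by move=> /boxU[h1 h2]; apply: boxN; exact: ltW.
have SU x y : U x -> U y -> S x = S y.
  apply: (connected_locally_constant cU eta20) => {}x {}y Ux Uy xy.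
  have := SP _ _ (clN _ (subset_closure Ux)) (clN _ (subset_closure Uy)) xy.
  rewrite /crossing; have /asboolP-> := Ux; have /asboolP-> := Uy.
  by case: (S x); case: (S y).
have near_bd z : boundary U z -> exists x, [/\ U x, ~ U z & S z (+) S x = close_to Q0 eta z].
  rewrite boundary_open// => -[clz nUz].
  have [x Ux xz] := (iffLR (closureCP U z) clz) _ eta20.
  rewrite normcBC in xz; exists x; split; [exact: Ux|exact: nUz|].
  rewrite (SP _ _ (clN _ clz) (clN _ (subset_closure Ux)) xz).
  by rewrite /crossing; have /asboolP-> := Ux; have /asboolPn/negbTE-> := nUz.
have [xa [Uxa nUa Sa]] := near_bd _ dUa.
have [xb [Uxb nUb Sb]] := near_bd _ dUb.
(* Compared with its constant value on [U], the parity flips at [b] but not at [a]. *)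
have Sab : S a != S b.
  have ca : close_to Q0 eta a = false.
    by apply/asboolPn => -[q Qq aq]; have := PQeta _ _ Pa Qq; lra.
  have cb : close_to Q0 eta b = true.
    by apply/asboolP; exists b => //; rewrite subrr normC0.
  move: Sa Sb; rewrite ca cb (SU _ _ Uxa Uxb).
  by case: (S a); case: (S b); case: (S xb).
have sgid z : boundary U z -> sg z = S z.
  move=> [/boxU[h1 h2] _]; rewrite /sg ret_id//; exact: ltW.
pose v0 : C := r%:C.
have Vv0 : V v0 by left; rewrite /= gtr0_norm.
have sgV z : V z -> sg z = sg v0.
  move=> Vz; apply: (connected_locally_constant (box_exterior_connected (ltW r0)) eta20) => // x y Vx Vy xy.
  by apply: sg_loc => //; exact: VU.
(* As [sg] differs at [a] and [b], at least one of them does not have the parity of the exterior. *)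
have [d [dUd nUd sgd]] : exists d, [/\ boundary U d, ~ U d & sg d != sg v0].
  have [sa|sa] := eqVneq (sg a) (sg v0); last by exists a.
  by exists b; split => //; rewrite -sa !sgid// eq_sym.
pose F := [set z | ~ U z /\ sg z = sg d].
pose O := \bigcup_(z in F) cball z (eta / 4).
have eta40 : 0 < eta / 4 by rewrite divr_gt0.
have oO : open O by apply: bigcup_open => z _; exact: open_cball.
have bO : bounded_set O.
  apply/bounded_setC_P; exists (2 * r + eta / 4) => w [z [nUz sz]]; rewrite /cball/= => wz.
  have zr : N z <= 2 * r.
    have nVz : ~ V z by move=> /sgV sv; move: sgd; rewrite -sz sv eqxx.
    by apply: boxN; rewrite leNgt; apply/negP => h; apply: nVz; [left|right]; exact: ltW.
  by have := normc_dist_le z w 0; rewrite !subr0; lra.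
have OE : O `&` E = set0.
  apply: nE => //; apply/seteqP; split => // z []; rewrite boundary_open// => -[clz nOz] Ez.
  have eta80 : 0 < eta / 8 by rewrite divr_gt0.
  have [w [y [nUy sy] wy] wz] := (iffLR (closureCP O z) clz) _ eta80.
  have nUz : ~ U z by move=> Uz; have : (U `&` E) z by []; rewrite UE.
  apply: nOz; exists z; last exact: cball_center.
  split => //; rewrite -sy; apply: sg_loc => //.
  move: wy; rewrite /cball/= => wy.
  by have := normc_dist_le w z y; rewrite (normcBC z w); lra.
have : (O `&` E) d.
  split; last exact: dUE.
  by exists d; [split|exact: cball_center].
by rewrite OE.
Qed.

(** If [E] splits, two closest points of its parts are joined by an open segment off [E], and the
    component of the complement around it is bounded with both points on its boundary, against
    [boundary_not_split]. The parts may be unbounded, so the closest pair is taken in a disc;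
    convexity keeps the segment there. *)
Theorem connected_of_no_bounded_part E : closed E -> no_bounded_part E ->
  (forall x, ~ E x -> bounded_set (connected_component (~` E) x)) -> connected E.
Proof.
move=> cE nE bE; apply: contrapT => /connectedPn[B [B0 EB [sep1 sep2]]].
pose P := B false; pose Q := B true.
have PE : P `<=` E by rewrite EB; left.
have QE : Q `<=` E by rewrite EB; right.
have cP : closed P.
  move=> z clz; have : E z by apply: cE; exact: closure_subset PE _ clz.
  by rewrite EB => -[//|Qz]; have : (closure P `&` Q) z by []; rewrite sep1.
have cQ : closed Q.
  move=> z clz; have : E z by apply: cE; exact: closure_subset QE _ clz.
  by rewrite EB => -[Pz|//]; have : (P `&` closure Q) z by []; rewrite sep2.
have PQ z : P z -> Q z -> False.
  move=> Pz Qz; have : (closure P `&` Q) z by split => //; exact: subset_closure.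
  by rewrite sep1.
have [p Pp] := B0 false; have [q Qq] := B0 true.
pose r := N p + N q.
pose K : set C := [set w | N (w - 0) <= r].
have Kp : K p by rewrite /K/= subr0 lerDl normc_ge0.
have Kq : K q by rewrite /K/= subr0 lerDr normc_ge0.
have cK : compact K by exact: compact_cdisk.
have [||a [b [[Ka Pa] [Kb Qb] abmin]]] := @compact_pair_min (K `&` P) (K `&` Q)
  (compact_closedI cK cP) (compact_closedI cK cQ).
- by exists p.
- by exists q.
have ab0 : 0 < N (a - b).
  by rewrite normc_gt0 subr_eq0; apply/eqP => ab; apply: (PQ a) => //; rewrite ab.
pose c (t : R) : C := a + t%:C * (b - a).
have Kc t : 0 <= t <= 1 -> K (c t).
  move=> /andP[t0 t1]; rewrite /K /mkset subr0.
  have -> : c t = (1 - t)%:C * a + t%:C * b by rewrite /c rmorphB rmorph1; ring.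
  rewrite (le_trans (normc_le_add _ _))// !Normc.normcM !normc_real !ger0_norm ?subr_ge0//.
  move: Ka Kb; rewrite /K/= !subr0 => Ka Kb.
  have : 0 <= (1 - t) * (r - N a) by rewrite mulr_ge0 ?subr_ge0.
  have : 0 <= t * (r - N b) by rewrite mulr_ge0 ?subr_ge0.
  by lra.
have nEc t : 0 < t < 1 -> ~ E (c t).
  move=> /andP[t0 t1]; rewrite EB; have Kct := Kc t ltac:(by rewrite !ltW).
  have ca : N (a - c t) = t * N (a - b).
    by rewrite /c opprD addNKr normcN Normc.normcM normc_real gtr0_norm// normcBC.
  have cb : N (c t - b) = (1 - t) * N (a - b).
    rewrite (_ : c t - b = (1 - t)%:C * (a - b)); last by rewrite /c rmorphB rmorph1; ring.
    by rewrite Normc.normcM normc_real gtr0_norm ?subr_gt0.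
  have h1 : 0 < t * N (a - b) by rewrite mulr_gt0.
  have h2 : 0 < (1 - t) * N (a - b) by rewrite mulr_gt0// subr_gt0.
  case=> [Pc|Qc].
    by have := abmin _ _ (conj Kct Pc) (conj Kb Qb); rewrite cb; lra.
  by have := abmin _ _ (conj Ka Pa) (conj Kct Qc); rewrite ca; lra.
pose x0 := c (1 / 2).
have nEx0 : (~` E) x0 by apply: nEc; lra.
pose U := connected_component (~` E) x0.
have oE : open (~` E) by exact: closed_openC.
have oU : open U by exact: component_open.
have Uc t : 0 < t < 1 -> U (c t).
  move=> /andP[t0 t1].
  apply: (@connected_component_max _ _ (segm x0 (c t)) x0 (segm_l _ _) _ (@connected_segm _ _ _) _ (segm_r _ _)).
  move=> v [s /=]; rewrite in_itv/= => /andP[s0 s1] <-.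
  have -> : x0 + s%:C * (c t - x0) = c ((1 - s) / 2 + s * t).
    rewrite /x0 /c (_ : 1 / 2 = 2^-1 :> R) ?mul1r// rmorphD !rmorphM rmorphB rmorph1.
    by ring.
  apply: nEc; have : 0 <= s * t by rewrite mulr_ge0// ltW.
  have : 0 <= s * (1 - t) by rewrite mulr_ge0// subr_ge0 ltW.
  by move=> h1 h2; apply/andP; split; nra.
have dUE : boundary U `<=` E.
  by move=> z /(component_boundary oE) nz; apply: contrapT.
have UE : U `&` E = set0.
  by apply/seteqP; split => // z [/connected_component_sub].
have small e : 0 < e -> exists2 t, 0 < t < 1 & t * N (a - b) < e.
  move=> e0; exists (Num.min (1 / 2) (e / (2 * N (a - b)))).
    apply/andP; split; last by rewrite gt_min; apply/orP; left; lra.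
    by rewrite lt_min divr_gt0// divr_gt0// mulr_gt0.
  apply: (@le_lt_trans _ _ (e / (2 * N (a - b)) * N (a - b))).
    by rewrite ler_wpM2r ?normc_ge0// ge_min lexx orbT.
  by rewrite (_ : _ * _ = e / 2); [lra|field; rewrite gt_eqF].
have dUa : boundary U a.
  rewrite boundary_open//; split; last first.
    move=> Ua; have : (U `&` E) a by split => //; exact: PE.
    by rewrite UE.
  apply/closureCP => e /small[t t01 te]; exists (c t); first exact: Uc.
  case/andP: t01 => t0 t1.
  by rewrite /c addrC addKr Normc.normcM normc_real gtr0_norm// normcBC.
have dUb : boundary U b.
  rewrite boundary_open//; split; last first.
    move=> Ub; have : (U `&` E) b by split => //; exact: QE.
    by rewrite UE.
  apply/closureCP => e /small[t t01 te]; exists (c (1 - t)); first by apply: Uc; lra.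
  case/andP: t01 => t0 t1.
  rewrite (_ : c (1 - t) - b = t%:C * (a - b)); last by rewrite /c rmorphB rmorph1; ring.
  by rewrite Normc.normcM normc_real gtr0_norm.
have bU : bounded_set U by exact: bE.
apply: (@boundary_not_split E U (boundary U `&` P) (boundary U `&` Q) a b) => //.
- exact: component_connected.
- by move=> z dz; have := dUE z dz; rewrite EB => -[Pz|Qz]; [left|right].
- exact: compact_closedI (compact_boundary bU) cP.
- exact: compact_closedI (compact_boundary bU) cQ.
- by move=> z [_ Pz] [_]; exact: PQ.
Qed.

End ConnectedPlaneSets.

(** * Contracting closed walks in a grid *)

Section PathEquivalence.
Variables (T : Type) (cell : T -> T -> T -> Prop).
Implicit Types (x y z : T) (p q l : seq T).

(* Paths as vertex sequences, up to repetition of a vertex and replacement of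
   [x, y, z] by [x, z] across a cell: a combinatorial homotopy relation. *)
Inductive heq : seq T -> seq T -> Prop :=
| heq_refl p : heq p p
| heq_sym p q : heq p q -> heq q p
| heq_trans p q r : heq p q -> heq q r -> heq p r
| heq_stut l1 x l2 : heq (l1 ++ [:: x, x & l2]) (l1 ++ x :: l2)
| heq_cell l1 x y z l2 : cell x y z -> heq (l1 ++ [:: x, y, z & l2]) (l1 ++ [:: x, z & l2]).

Lemma heq_ctx l1 l2 p q : heq p q -> heq (l1 ++ p ++ l2) (l1 ++ q ++ l2).
Proof.
elim=> {p q}.
- by move=> p; exact: heq_refl.
- by move=> p q _; exact: heq_sym.
- by move=> p q r _ h _; exact: heq_trans.
- by move=> l x l' ; rewrite -!catA !catA -[(l1 ++ l) ++ _]catA -[(l1 ++ l) ++ _]catA /= !catA;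
    rewrite -!(catA (l1 ++ l)) /=; exact: heq_stut.
- by move=> l x y z l' c; rewrite !catA -!(catA (l1 ++ l)) /=; exact: heq_cell.
Qed.

End PathEquivalence.

Lemma heq_map (T U : Type) (f : T -> U) cellT cellU (p q : seq T) :
  (forall x y z, cellT x y z -> cellU (f x) (f y) (f z)) ->
  heq cellT p q -> heq cellU (map f p) (map f q).
Proof.
move=> cTU; elim=> {p q}.
- by move=> p; exact: heq_refl.
- by move=> p q _; exact: heq_sym.
- by move=> p q r _ h _; exact: heq_trans.
- by move=> l1 x l2; rewrite !map_cat /=; exact: heq_stut.
- by move=> l1 x y z l2 /cTU c; rewrite !map_cat /=; exact: heq_cell.
Qed.

Lemma split_first (T : eqType) (v : T) p : v \in p ->
  exists q r, p = rcons q v ++ r /\ v \notin q.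
Proof.
elim: p => [//|x p IH]; rewrite inE; have [<- _|vx /= /IH[q [r [-> nvq]]]] := eqVneq v x.
  by exists [::], p.
by exists (x :: q), r; rewrite inE negb_or vx.
Qed.

Section GridWalks.
Local Notation V := (int * int)%type.
Implicit Types (x y z u v w s : V) (p q l : seq V).

Definition shift_h v : V := (v.1 + 1, v.2).
Definition shift_v v : V := (v.1, v.2 + 1).

Variables (hok vok sok : pred V).
Hypothesis sok_edges : forall s, sok s ->
  [/\ hok s, hok (shift_v s), vok s & vok (shift_h s)].

(* A vertex also names the horizontal edge to its right ([hok]), the vertical edge
   above it ([vok]) and the square of which it is the lower left corner ([sok]). *)
Definition hstep u v := (v == shift_h u) && hok u.
Definition vstep u v := (v == shift_v u) && vok u.
Definition step u v := [|| u == v, hstep u v, hstep v u, vstep u v | vstep v u].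

Lemma step_sym u v : step u v = step v u.
Proof.
rewrite /step eq_sym; congr (_ || _).
by case: (hstep u v); case: (hstep v u); case: (vstep u v); case: (vstep v u).
Qed.

Definition corners s : seq V := [:: s; shift_h s; shift_v s; shift_h (shift_v s)].

(** The first alternative removes spurs. It excludes [x = y], because a constant step uses no edge
    and so does not place its vertex in the domain; repetitions are left to stuttering. *)
Definition gcell x y z := [/\ x != y, step x y & x = z] \/
  exists2 s, sok s & [/\ x \in corners s, y \in corners s & z \in corners s].

Local Notation "p ~~ q" := (heq gcell p q) (at level 70).

Lemma heq_spur l1 x y l2 : step x y -> l1 ++ [:: x, y, x & l2] ~~ l1 ++ x :: l2.
Proof.
move=> xy; apply: heq_trans (heq_stut _ l1 x l2).
have [->|xny] := eqVneq x y; first exact: heq_stut.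
by apply: heq_cell; left.
Qed.

Lemma heq_retrace a t : path step a t -> a :: t ++ rev (belast a t) ~~ [:: a].
Proof.
elim/last_ind: t => [_|t z IH]; first exact: heq_refl.
rewrite rcons_path => /andP[pt tz].
apply: heq_trans (IH pt).
rewrite belast_rcons (lastI a t) rev_rcons -cats1 -catA /= -!cat_cons lastI -!cats1 -!catA /=.
exact: heq_spur.
Qed.

(* Whether the step from [a] to [b] crosses the horizontal ray issued from the
   centre of the square [s] to the right. *)
Definition crossing_step s a b := [&& a.1 == b.1, s.1 < a.1 &
  ((a.2 == s.2) && (b.2 == s.2 + 1)) || ((b.2 == s.2) && (a.2 == s.2 + 1))].

Fixpoint xor_path (F : V -> V -> bool) x p : bool :=
  if p is y :: p' then F x y (+) xor_path F y p' else false.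

Definition winding s x p := xor_path (crossing_step s) x p.

Lemma xor_path_cat F x p q : xor_path F x (p ++ q) = xor_path F x p (+) xor_path F (last x p) q.
Proof. by elim: p x => [|y p IH] x //=; rewrite IH addbA. Qed.

Lemma xor_path0 F (e : rel V) x p : path e x p ->
  (forall a b, a \in x :: p -> b \in x :: p -> e a b -> F a b = false) ->
  xor_path F x p = false.
Proof.
elim: p x => [//|y p IH] x /= /andP[xy yp] h.
rewrite h ?inE ?eqxx ?orbT// IH// => a b ay byp; apply: h.
  by rewrite inE ay orbT.
by rewrite inE byp orbT.
Qed.

(** [F] and [G] differ by a coboundary, which sums to zero around a closed walk. *)
Lemma xor_path_telescope F G (h : V -> bool) (e : rel V) x p : path e x p -> last x p = x ->
  (forall a b, e a b -> F a b = G a b (+) (h a (+) h b)) -> xor_path F x p = xor_path G x p.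
Proof.
move=> + + FG.
suff : forall y, path e y p -> xor_path F y p = xor_path G y p (+) (h y (+) h (last y p)).
  by move=> H /H-> ->; rewrite addbb addbF.
elim: p => [|b p IH] y /=; first by rewrite addbb.
move=> /andP[yb bp]; rewrite IH// FG//.
by case: (G y b); case: (xor_path G b p); case: (h y); case: (h b); case: (h (last b p)).
Qed.

Lemma xor_path_ex F (e : rel V) x p : path e x p -> xor_path F x p ->
  exists a b, [/\ a \in x :: p, e a b & F a b].
Proof.
elim: p x => [//|y p IH] x /= /andP[xy yp].
case Fxy: (F x y); first by move=> _; exists x, y; rewrite mem_head.
by move=> /(IH _ yp)[a [b [ap ab Fab]]]; exists a, b; rewrite inE ap orbT.
Qed.

Lemma xor_path_addb F G x p : xor_path F x p (+) xor_path G x p =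
  xor_path (fun a b => F a b (+) G a b) x p.
Proof. by elim: p x => [//|y p IH] x /=; rewrite -IH addbACA. Qed.

(** The two rays differ by the vertical edge between the squares, so the parities differ only if the
    walk uses that edge. *)
Lemma winding_addh s x p : path step x p -> last x p = x ->
  winding s x p (+) winding (shift_h s) x p -> vok (shift_h s).
Proof.
move=> px _; rewrite xor_path_addb => /(xor_path_ex px)[[a1 a2] [[b1 b2] [_]]].
case: s => s1 s2; rewrite /step /hstep /vstep /crossing_step /shift_h /shift_v /=.
have sa (a : int) : (s1 + 1 < a) = (s1 < a) && (a != s1 + 1) by lia.
rewrite !sa; case: (altP (a1 =P b1)) => //= ab; subst b1.
case: (s1 < a1) => //=; have [->|//] := eqVneq a1 (s1 + 1) => /=; last by rewrite addbb.
rewrite addbF => st /orP[/andP[/eqP e1 /eqP e2]|/andP[/eqP e1 /eqP e2]]; subst a2 b2.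
  by case/or4P: st => [/eqP[]|/andP[/eqP[]]|/andP[/eqP[]]|/orP[/andP[]|/andP[/eqP[]]]] //; lia.
by case/or4P: st => [/eqP[]|/andP[/eqP[]]|/andP[/eqP[]]|/orP[/andP[/eqP[]]|/andP[]]] //; lia.
Qed.

(** The crossings of the two rays differ by the coboundary of the half row of vertices between them,
    up to the traversals [T] of the edge separating the squares. *)
Lemma winding_addv s x p : path step x p -> last x p = x ->
  winding s x p (+) winding (shift_v s) x p -> hok (shift_v s).
Proof.
move=> px lx; rewrite xor_path_addb.
pose T (a b : V) := [&& a.2 == s.2 + 1, b.2 == s.2 + 1 &
  ((a.1 == s.1) && (b.1 == s.1 + 1)) || ((b.1 == s.1) && (a.1 == s.1 + 1))].
rewrite (@xor_path_telescope _ T (fun a => (s.1 < a.1) && (a.2 == s.2 + 1)) _ _ _ px lx).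
  move=> /(xor_path_ex px)[[a1 a2] [[b1 b2] [_]]].
  case: s @T => s1 s2 T; rewrite /T /step /hstep /vstep /shift_h /shift_v /=.
  move=> st /and3P[/eqP ? /eqP ? /orP[/andP[/eqP ? /eqP ?]|/andP[/eqP ? /eqP ?]]]; subst.
    by case/or4P: st => [/eqP[]|/andP[]|/andP[/eqP[]]|/orP[/andP[/eqP[]]|/andP[/eqP[]]]] //; lia.
  by case/or4P: st => [/eqP[]|/andP[/eqP[]]|/andP[]|/orP[/andP[/eqP[]]|/andP[/eqP[]]]] //; lia.
case: s @T => s1 s2 T [a1 a2] [b1 b2].
rewrite /T /step /hstep /vstep /crossing_step /shift_h /shift_v /=.
case/or4P => [/eqP[]|/andP[/eqP[]]|/andP[/eqP[]]|/orP[/andP[/eqP[]]|/andP[/eqP[]]]];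
  try move=> ++ _; move=> ??; subst; lia.
Qed.

(** Too far to the right, above or below, the ray meets no step. Too far to the left, all vertices
    lie beyond the start of the ray and crossing it is the coboundary of [a.2 <= s.2]. *)
Lemma winding_bounded s x p (k : int) : path step x p -> last x p = x ->
  (forall a, a \in x :: p -> `|a.1| < k /\ `|a.2| < k) -> winding s x p ->
  `|s.1| <= k /\ `|s.2| <= k.
Proof.
move=> px lx bk ws.
have [[a1 a2] [[b1 b2] [ap _]]] := xor_path_ex px ws.
have [/= a1k a2k] := bk _ ap.
rewrite /crossing_step /= => /and3P[_ sa ab].
have s2 : `|s.2| <= k by move: ab a2k; lia.
split => //; rewrite leNgt; apply/negP => ks.
have sk : s.1 < - k by lia.
suff : winding s x p = false by rewrite ws.
pose e (a b : V) := step a b && (s.1 < a.1).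
have pe : path e x p.
  have {}bk a : a \in x :: p -> s.1 < a.1 by move=> /bk[]; lia.
  elim: p (x) px bk {lx ws ap} => [//|y p IH] x' /= /andP[xy yp] bk.
  by rewrite /e xy bk ?mem_head//= IH// => a ap; apply: bk; rewrite inE ap orbT.
rewrite /winding (@xor_path_telescope _ (fun _ _ => false) (fun a => a.2 <= s.2) _ _ _ pe lx).
  by elim: p (x) {px lx bk ws ap pe} => //= y p IH x'.
move=> [c1 c2] [d1 d2]; rewrite /e /step /hstep /vstep /crossing_step /shift_h /shift_v /=.
case/andP => + ->; case/or4P => [/eqP[]|/andP[/eqP[]]|/andP[/eqP[]]|/orP[/andP[/eqP[]]|/andP[/eqP[]]]];
  try move=> ++ _; move=> ??; subst; lia.
Qed.

Hypothesis winding_sok : forall s x p, path step x p -> last x p = x -> winding s x p -> sok s.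

Variable k : int.

Definition inbox v := [&& - k < v.1, v.1 < k, - k < v.2 & v.2 < k].
(** Lexicographic order on the box, column first, as one integer: the neighbours of smaller rank are
    the left and the lower one. *)
Definition rank v : int := (v.1 + k) * (2 * k) + (v.2 + k).

Lemma rank_ge0 v : inbox v -> 0 <= rank v.
Proof. by case: v => a b; rewrite /inbox /rank /= => /and4P[] *; nia. Qed.

Lemma rank_inj v w : inbox v -> inbox w -> rank v = rank w -> v = w.
Proof.
case: v w => a b [c d]; rewrite /inbox /rank /= => /and4P[a1 a2 b1 b2] /and4P[c1 c2 d1 d2] h.
have ac : a = c by nia.
by rewrite ac in h *; congr pair; lia.
Qed.

Lemma step_below v y : inbox v -> inbox y -> step v y -> rank y < rank v ->
  (v = shift_h y /\ hok y) \/ (v = shift_v y /\ vok y).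
Proof.
case: v y => a b [c d] bv by_; rewrite /step /hstep /vstep.
case/or4P => [/eqP->|/andP[/eqP-> _]|/andP[/eqP-> ?]|/orP[/andP[/eqP-> _]|/andP[/eqP-> ?]]];
  rewrite ?ltxx//; last 2 first.
- by rewrite /rank /shift_v/= => h; lia.
- by move=> _; right.
- by move: bv by_; rewrite /inbox /rank /shift_h /= => /and4P[????] /and4P[????] ?; nia.
- by move=> _; left.
Qed.

Lemma gcell_corners s x y z : sok s -> x \in corners s -> y \in corners s -> z \in corners s ->
  gcell x y z.
Proof. by move=> ? ? ? ?; right; exists s. Qed.

(** The ray from [s] crosses vertical edges whose upper end has rank at least [rank v]. The
    excursion stays below that rank, so only its first and last steps can cross. *)
Lemma winding_excursion s v y q : inbox v -> s = (v.1 - 1, v.2 - 1) ->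
  path step y q -> all inbox (y :: q) -> all (fun w => rank w < rank v) (y :: q) ->
  winding s v (y :: q ++ [:: v]) =
  ((y.1 == v.1) && (y.2 == v.2 - 1)) (+) (((last y q).1 == v.1) && ((last y q).2 == v.2 - 1)).
Proof.
move=> bv sE pyq bq rq; rewrite /winding /= xor_path_cat /= addbF.
have bnd w : w \in y :: q -> inbox w /\ rank w < rank v.
  by move=> wq; split; [exact: (allP bq)|exact: (allP rq)].
have first_step w : w \in y :: q -> crossing_step s v w = (w.1 == v.1) && (w.2 == v.2 - 1).
  move=> /bnd[bw rw]; move: bv bw rw; rewrite sE.
  case: (v) w => a b [c d]; rewrite /inbox /rank /crossing_step /= => /and4P[????] /and4P[????] ?.
  apply/idP/idP; first by move=> /and3P[/eqP ? _ /orP[/andP[/eqP ? _]|/andP[/eqP ? _]]]; lia.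
  by move=> /andP[/eqP-> /eqP->]; lia.
have sym a b : crossing_step s a b = crossing_step s b a.
  rewrite /crossing_step eq_sym; case: eqP => //= ->; congr (_ && _); exact: orbC.
rewrite first_step ?mem_head// sym first_step ?mem_last//.
rewrite (_ : xor_path _ y q = false) ?addFb//.
apply: (xor_path0 pyq) => a b /bnd[ba ra] /bnd[bb rb] _.
move: bv ba ra bb rb; rewrite sE; case: (v) a b => x1 x2 [a1 a2] [b1 b2].
rewrite /inbox /rank /crossing_step /= => /and4P[????] /and4P[????] ? /and4P[????] ?.
apply/negbTE/negP => /and3P[/eqP ab la /orP[/andP[/eqP e1 /eqP e2]|/andP[/eqP e1 /eqP e2]]]; subst.
  have : x1 <= b1 by lia.
  by nia.
have : x1 <= b1 by lia.
by nia.
Qed.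

Lemma shift_h_corner v w : v = shift_h w -> w = shift_v (v.1 - 1, v.2 - 1).
Proof. by move=> ->; case: w => c d; rewrite /shift_h /shift_v /=; congr pair; ring. Qed.

Lemma shift_v_corner v w : v = shift_v w -> w = shift_h (v.1 - 1, v.2 - 1).
Proof. by move=> ->; case: w => c d; rewrite /shift_h /shift_v /=; congr pair; ring. Qed.

Lemma shift_hv_corner v : v = shift_h (shift_v (v.1 - 1, v.2 - 1)).
Proof. by case: v => c d; rewrite /shift_h /shift_v /=; congr pair; ring. Qed.

Lemma shift_h_inj v w : shift_h v = shift_h w -> v = w.
Proof. by case: v w => a b [c d] [/addIr-> ->]. Qed.

Lemma shift_v_inj v w : shift_v v = shift_v w -> v = w.
Proof. by case: v w => a b [c d] [-> /addIr->]. Qed.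

Definition lower_nbr v y := (v = shift_h y /\ hok y) \/ (v = shift_v y /\ vok y).

Lemma lower_nbr_parity v y z : y != z -> lower_nbr v y -> lower_nbr v z ->
  ((y.1 == v.1) && (y.2 == v.2 - 1)) (+) ((z.1 == v.1) && (z.2 == v.2 - 1)).
Proof.
move=> /eqP yz [] [vy _] [] [vz _].
- by case: yz; apply: shift_h_inj; rewrite -vy.
- have -> : (y.1 == v.1) = false by apply/eqP; rewrite vy /=; lia.
  have -> : z.1 == v.1 by rewrite vz.
  by have -> : z.2 == v.2 - 1 by rewrite vz /= addrK.
- have -> : (z.1 == v.1) = false by apply/eqP; rewrite vz /=; lia.
  have -> : y.1 == v.1 by rewrite vy.
  by have -> : y.2 == v.2 - 1 by rewrite vy /= addrK.
- by case: yz; apply: shift_v_inj; rewrite -vy.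
Qed.

Lemma lower_corner_bound v y z : inbox v -> inbox y -> inbox z -> y != z ->
  lower_nbr v y -> lower_nbr v z ->
  inbox (v.1 - 1, v.2 - 1) /\ rank (v.1 - 1, v.2 - 1) < rank v.
Proof.
case: v y z => a b [c d] [e f] bv by_ bz /eqP ne Hy Hz.
suff [h1 h2] : - k < a - 1 /\ - k < b - 1.
  move: bv; rewrite /inbox /rank /= => /and4P[????]; split; last by nia.
  by apply/and4P; split; lia.
move: by_ bz; rewrite /inbox /= => /and4P[????] /and4P[????].
case: Hy Hz => [] [[? ?] _] [] [[? ?] _]; subst; split; try lia; case: ne; congr pair; lia.
Qed.

Section Induction.
Variable n : int.
Hypothesis IH : forall x p, path step x p -> last x p = x ->
  all inbox (x :: p) -> all (fun v => rank v < n) (x :: p) -> x :: p ~~ [:: x].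
Variable v : V.
Hypothesis bv : inbox v.
Hypothesis rv : rank v = n.

(* [v] has maximal rank on the walk, so its neighbours on it are the ones to its
   left and below it. If they differ the square [s] between them has odd winding
   number, so [v] can be replaced by the opposite corner of [s]. *)
Lemma excursion_trivial q : path step v (rcons q v) -> all inbox q ->
  all (fun w => rank w < n) q -> v :: rcons q v ~~ [:: v].
Proof.
case: q => [_ _ _|y q]; first exact: (heq_stut _ [::]).
rewrite -rv => pq bq rq; have := pq; rewrite /= rcons_path => /and3P[vy yq zv].
set z := last y q in zv.
have yin : y \in y :: q by exact: mem_head.
have zin : z \in y :: q by exact: mem_last.
have by_ := allP bq _ yin; have bz := allP bq _ zin.
have ry := allP rq _ yin; have rz := allP rq _ zin.
have [yz|yz] := eqVneq y z.
  have h := IH yq (esym yz) bq; rewrite rv in rq; have {}h := h rq.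
  rewrite -cats1; apply: heq_trans (heq_ctx [:: v] [:: v] h) _ => /=.
  exact: (@heq_spur [::] v y [::]).
pose s := (v.1 - 1, v.2 - 1).
have [Hy Hz] : ((v = shift_h y /\ hok y) \/ (v = shift_v y /\ vok y)) /\
    ((v = shift_h z /\ hok z) \/ (v = shift_v z /\ vok z)).
  by split; apply: step_below => //; rewrite step_sym.
have wind : winding s v (y :: q ++ [:: v]).
  rewrite (winding_excursion bv erefl yq bq rq) -/z.
  exact: lower_nbr_parity yz Hy Hz.
have sk : sok s.
  apply: winding_sok wind; last by rewrite /= last_cat.
  by rewrite cats1.
have [e1 e2 e3 e4] := sok_edges sk.
have nbr w : (v = shift_h w /\ hok w) \/ (v = shift_v w /\ vok w) ->
    w \in corners s /\ step s w.
  move=> -[[/shift_h_corner-> _]|[/shift_v_corner-> _]]; rewrite -/s.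
    by rewrite !inE eqxx ?orbT; split; rewrite ?orbT// /step /vstep eqxx e3 /= ?orbT.
  by rewrite !inE eqxx ?orbT; split; rewrite ?orbT// /step /hstep eqxx e1 /= ?orbT.
have [ys sy] := nbr _ Hy; have [zs sz] := nbr _ Hz.
have vs : v \in corners s by rewrite !inE -(shift_hv_corner v) eqxx !orbT.
have ss : s \in corners s by exact: mem_head.
have [bs1 rs1] := lower_corner_bound bv by_ bz yz Hy Hz; rewrite rv -/s in bs1 rs1.
(* Rerouted through [s] at both ends, the excursion becomes a loop of smaller rank, to which the
   induction hypothesis applies. *)
have h : s :: (y :: q) ++ [:: s] ~~ [:: s].
  apply: IH.
  - by rewrite cat_path /= sy yq step_sym sz.
  - by rewrite last_cat.
  - apply/allP => w; rewrite inE mem_cat mem_seq1 => /or3P[/eqP->|wq|/eqP->] //.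
    exact: (allP bq).
  - apply/allP => w; rewrite inE mem_cat mem_seq1 => /or3P[/eqP->|wq|/eqP->] //.
    by rewrite -rv; exact: (allP rq).
have h1 : [:: v] ++ [:: s, y & q] ++ [:: s; v] ~~ [:: v] ++ [:: s] ++ [:: v].
  have := heq_ctx [:: v] [:: v] h; rewrite /= -catA; exact.
have h2 : [:: v, s, y & q] ++ [:: s; v] ~~ [:: v, y & q] ++ [:: s; v].
  exact: (@heq_cell _ _ [::] v s y (q ++ [:: s; v]) (gcell_corners sk vs ss ys)).
have h3 : [:: v, y & q] ++ [:: s; v] ~~ [:: v, y & q] ++ [:: v].
  have -> : [:: v, y & q] = (v :: belast y q) ++ [:: z] by rewrite cats1 /= -lastI.
  rewrite -!catA.
  exact: (@heq_cell _ _ (v :: belast y q) z s v [::] (gcell_corners sk zs ss vs)).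
have h4 : [:: v; s; v] ~~ [:: v].
  apply: heq_trans (@heq_cell _ _ [::] v s v [::] (gcell_corners sk vs ss vs)) _.
  exact: (heq_stut _ [::]).
rewrite -cats1; apply: heq_trans (heq_sym h3) _; apply: heq_trans (heq_sym h2) _.
exact: heq_trans h1 h4.
Qed.

(** The walk is cut at its first return to [v]: the first piece is an excursion, the rest is
    shorter. *)
Lemma closed_walk_at_max p : path step v p -> last v p = v -> all inbox p ->
  all (fun w => rank w < n + 1) p -> v :: p ~~ [:: v].
Proof.
have [m] := ubnP (size p); elim: m p => [//|m IHm] p; rewrite ltnS => pm pp lp bp rp.
case: p pm pp lp bp rp => [|y p0] pm pp lp bp rp; first exact: heq_refl.
have vin : v \in y :: p0 by rewrite -{1}lp /= mem_last.
have [q [r [pE nvq]]] := split_first vin.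
rewrite pE in pm pp lp bp rp *.
move: pp bp rp lp; rewrite cat_path last_cat !all_cat last_rcons -!cats1 !all_cat /= cats1.
move=> /andP[pq pr] /andP[/andP[bq _] br] /andP[/andP[rq _] rr] lr.
have rq' : all (fun w => rank w < n) q.
  apply/allP => w wq; have := allP rq w wq; rewrite ltzD1 le_eqVlt => /orP[/eqP rw|//].
  have wv : w = v by apply: rank_inj; rewrite ?rv//; exact: (allP bq).
  by move: nvq; rewrite -wv wq.
have h := excursion_trivial pq bq rq'.
have := heq_ctx [::] r h; rewrite /= => {}h; apply: heq_trans h _.
apply: IHm => //; move: pm; rewrite size_cat size_rcons; lia.
Qed.
End Induction.

(** Induction on the rank bound. If the vertex [v] of maximal rank is not the base point, the
    initial part [t] is appended together with its reverse, which exhibits the walk as a conjugate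
    by [t] of a closed walk at [v]. *)
Lemma closed_walk_ranked (n : nat) x p : path step x p -> last x p = x ->
  all inbox (x :: p) -> all (fun v => rank v < n%:Z) (x :: p) -> x :: p ~~ [:: x].
Proof.
elim: n x p => [|n IH] x p px lx bx rx.
  by have := rank_ge0 (allP bx x (mem_head _ _)); have := allP rx x (mem_head _ _); lia.
have [/hasP[v vx /eqP rv]|] := boolP (has (fun v => rank v == n%:Z) (x :: p)); last first.
  rewrite -all_predC => nx; apply: IH => //; apply/allP => w wx.
  by have := allP nx w wx; have := allP rx w wx; rewrite /= -addn1 PoszD ltzD1 lt_def eq_sym => -> ->.
have bv := allP bx v vx.
have at_max q : path step v q -> last v q = v -> all inbox q ->
    all (fun w => rank w < n%:Z + 1) q -> v :: q ~~ [:: v].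
  exact: (closed_walk_at_max IH bv rv).
have rx' : all (fun w => rank w < n%:Z + 1) (x :: p) by rewrite -PoszD addn1.
have [xv|xv] := eqVneq x v.
  by subst x; apply: at_max => //; [case/andP: bx|case/andP: rx'].
have vp : v \in p by move: vx; rewrite inE eq_sym (negbTE xv).
case/splitPr: p / vp px lx bx rx rx' vx => l1 l2; rewrite cat_path last_cat /=.
move=> /and3P[pl1 l1v pl2] ll2 bx _ rx _.
have l2x : last v l2 = x by [].
have h : v :: l2 ++ l1 ++ [:: v] ~~ [:: v].
  apply: at_max.
  - by rewrite !cat_path l2x pl2 pl1 /= l1v.
  - by rewrite !last_cat.
  - by move: bx; rewrite !all_cat /= => /and4P[_ -> _ ->]; rewrite bv.
  - by move: rx; rewrite !all_cat /= => /and4P[_ -> -> ->].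
pose t := rcons l1 v.
have pt : path step x t by rewrite rcons_path pl1.
have h1 := heq_retrace pt.
have [l2' l2E] : exists l2', v :: l2 = rcons l2' x by exists (belast v l2); rewrite lastI l2x.
have h2 : x :: l1 ++ v :: l2 ~~ (x :: l1 ++ l2') ++ x :: t ++ rev (belast x t).
  have := heq_sym (heq_ctx (x :: l1 ++ l2') [::] h1).
  by rewrite !cats0 l2E -cats1 /= -!catA.
apply: heq_trans h2 _; apply: heq_trans _ h1.
have := heq_ctx (x :: l1) (rev (belast x t)) h.
rewrite (_ : (x :: l1) ++ (v :: l2 ++ l1 ++ [:: v]) ++ rev (belast x t) =
  (x :: l1 ++ l2') ++ x :: t ++ rev (belast x t)); last first.
  rewrite -[v :: l2 ++ _]cat_cons l2E /t -!cats1 -!catA /= -?catA //.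
by rewrite /t -cats1 /= -?catA.
Qed.

End GridWalks.

Lemma closed_walk_trivial (hok vok sok : pred (int * int)) :
  (forall s, sok s -> [/\ hok s, hok (shift_v s), vok s & vok (shift_h s)]) ->
  (forall s x p, path (step hok vok) x p -> last x p = x -> winding s x p -> sok s) ->
  forall x p, path (step hok vok) x p -> last x p = x ->
  heq (gcell hok vok sok) (x :: p) [:: x].
Proof.
move=> sok_edges winding_sok x p px lx.
pose k : int := \sum_(v <- x :: p) (`|v.1| + `|v.2|) + 1.
have bk v : v \in x :: p -> `|v.1| < k /\ `|v.2| < k.
  move=> vx; have : `|v.1| + `|v.2| <= \sum_(v <- x :: p) (`|v.1| + `|v.2|).
    by rewrite (big_rem v)//= lerDl sumr_ge0.
  by rewrite /k; lia.
have bx : all (inbox k) (x :: p).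
  by apply/allP => v /bk[]; rewrite /inbox !ltr_norml => /andP[-> ->] /andP[-> ->].
pose n : int := \sum_(v <- x :: p) `|rank k v| + 1.
have n0 : 0 <= n by rewrite addr_ge0// sumr_ge0.
apply: (@closed_walk_ranked _ _ _ sok_edges winding_sok k `|n|%N) => //.
apply/allP => v vx; rewrite gez0_abs// /n ltzD1.
by apply: le_trans (ler_norm _) _; rewrite (big_rem v)//= lerDl sumr_ge0.
Qed.

(** * Squares of odd winding number around walks in an open set without holes *)

Section Grid.
Context {R : realType}.
Local Notation C := R[i].
Local Notation N := Normc.normc.
Local Notation Re := complex.Re.
Local Notation Im := complex.Im.
Local Open Scope complex_scope.
Local Notation V := (int * int)%type.
Implicit Types (z w : C) (s v : V).
Variables (G : set C) (o : C) (e : R).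
Hypothesis e0 : 0 < e.
Hypothesis oG : open G.
Hypothesis hG : hole_free G.

Definition grid_x z : R := (Re z - Re o) / e.
Definition grid_y z : R := (Im z - Im o) / e.
Definition grid_pt v : C := (Re o + e * v.1%:~R) +i* (Im o + e * v.2%:~R).

Lemma grid_xK v : grid_x (grid_pt v) = v.1%:~R.
Proof. by rewrite /grid_x /= addrC addKr mulrC mulKf// gt_eqF. Qed.

Lemma grid_yK v : grid_y (grid_pt v) = v.2%:~R.
Proof. by rewrite /grid_y /= addrC addKr mulrC mulKf// gt_eqF. Qed.

Definition in_unit (n : int) (x : R) := n%:~R <= x <= n%:~R + 1.

Definition square s : set C := [set z | in_unit s.1 (grid_x z) /\ in_unit s.2 (grid_y z)].
Definition hedge s : set C := [set z | in_unit s.1 (grid_x z) /\ grid_y z = s.2%:~R].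
Definition vedge s : set C := [set z | grid_x z = s.1%:~R /\ in_unit s.2 (grid_y z)].

Definition sok s := `[< square s `<=` G >].
Definition hok s := `[< hedge s `<=` G >].
Definition vok s := `[< vedge s `<=` G >].

Lemma in_unit_l n (x : R) : x = n%:~R -> in_unit n x.
Proof. by move=> ->; rewrite /in_unit lexx/= lerDl. Qed.

Lemma in_unit_r n (x : R) : x = (n + 1)%:~R -> in_unit n x.
Proof. by move=> ->; rewrite /in_unit intrD lexx lerDl ler01. Qed.

Lemma sok_edges s : sok s -> [/\ hok s, hok (shift_v s), vok s & vok (shift_h s)].
Proof.
move=> /asboolP sG; split; apply/asboolP => z [zx zy]; apply: sG; split => //.
- exact: in_unit_l.
- exact: in_unit_r.
- exact: in_unit_l.
- exact: in_unit_r.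
Qed.

Lemma in_unit_near (x : R) : exists2 d : R, 0 < d &
  forall y (n : int), `|y - x| < d -> in_unit n y -> in_unit n x.
Proof.
pose k := Num.floor x.
have kx : k%:~R <= x < k%:~R + 1.
  have /andP[h1 h2] := floor_itv x; rewrite h1/=; by rewrite intrD in h2.
(* At an integer [x] the closed interval to its left still contains [x], so the next obstacle on
   that side is at distance 1. *)
exists (Num.min (k%:~R + 1 - x) (if x == k%:~R then 1 else x - k%:~R)).
  rewrite lt_min subr_gt0 (andP kx).2/=; case: eqVneq => [_|xk]; first exact: ltr01.
  by rewrite subr_gt0 lt_def xk (andP kx).1.
move=> y n; rewrite lt_min => /andP[yx1 yx2] /andP[ny yn].
apply/andP; split; rewrite leNgt; apply/negP => h.
  have kn : (k < n)%R by rewrite -(ltr_int R); lra.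
  have : (k + 1)%:~R <= n%:~R :> R by rewrite ler_int; lia.
  rewrite intrD; move: yx1; rewrite ltr_norml => /andP[_]; lra.
have nk : n + 1 <= k by rewrite -ltzD1 -(ltr_int R) !intrD; lra.
move: yx2; have : (n + 1)%:~R <= k%:~R :> R by rewrite ler_int.
rewrite intrD ltr_norml; case: eqVneq => [xk|xk] h1 /andP[h2 _]; last by lra.
have : n + 1 != k by apply: contraTneq h => nk'; rewrite xk -nk' intrD ltxx.
move=> nk'; have : (n + 2)%:~R <= k%:~R :> R by rewrite ler_int; lia.
by rewrite intrD; lra.
Qed.

Lemma grid_x_dist z w : `|grid_x z - grid_x w| <= N (z - w) / e.
Proof.
rewrite /grid_x -mulrBl normrM [X in _ * X]gtr0_norm ?invr_gt0// ler_pM2r ?invr_gt0//.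
rewrite (_ : _ - _ = Re (z - w)); first exact: Re_le_normc.
by rewrite raddfB/=; ring.
Qed.

Lemma grid_y_dist z w : `|grid_y z - grid_y w| <= N (z - w) / e.
Proof.
rewrite /grid_y -mulrBl normrM [X in _ * X]gtr0_norm ?invr_gt0// ler_pM2r ?invr_gt0//.
rewrite (_ : _ - _ = Im (z - w)); first exact: Im_le_normc.
by rewrite raddfB/=; ring.
Qed.

Lemma square_near z : exists2 d : R, 0 < d &
  forall w s, N (w - z) < d -> square s w -> square s z.
Proof.
have [d1 d10 h1] := in_unit_near (grid_x z).
have [d2 d20 h2] := in_unit_near (grid_y z).
exists (Num.min d1 d2 * e); first by rewrite mulr_gt0// lt_min d10.
move=> w s; rewrite -ltr_pdivrMr// lt_min => /andP[wd1 wd2] [wx wy]; split.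
  by apply: h1 wx; apply: le_lt_trans wd1; exact: grid_x_dist.
by apply: h2 wy; apply: le_lt_trans wd2; exact: grid_y_dist.
Qed.

Lemma square_ex z : exists s, square s z.
Proof.
exists (Num.floor (grid_x z), Num.floor (grid_y z)); split => /=.
  by have /andP[h1 /ltW] := floor_itv (grid_x z); rewrite intrD /in_unit h1.
by have /andP[h1 /ltW] := floor_itv (grid_y z); rewrite intrD /in_unit h1.
Qed.

Lemma in_unit2 n m (x : R) : in_unit n x -> in_unit m x ->
  [\/ n = m, m = n + 1 /\ x = m%:~R | n = m + 1 /\ x = n%:~R].
Proof.
move=> /andP[n1 n2] /andP[m1 m2].
have nm : n <= m + 1 by rewrite -(ler_int R) intrD; lra.
have mn : m <= n + 1 by rewrite -(ler_int R) intrD; lra.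
have [h|[h|h]] : n = m \/ m = n + 1 \/ n = m + 1 by lia.
- by constructor 1.
- by constructor 2; split => //; rewrite h intrD in m1 *; lra.
- by constructor 3; split => //; rewrite h intrD in n1 *; lra.
Qed.

Section Walk.
Variables (x : V) (p : seq V).
Hypothesis px : path (step hok vok) x p.
Hypothesis lx : last x p = x.

Local Notation odd_sq s := (winding s x p).

Lemma odd_h s z : odd_sq s != odd_sq (shift_h s) -> square s z -> square (shift_h s) z -> G z.
Proof.
move=> ne [/andP[_ sx] sy] [/andP[sx' _] _].
have /asboolP : vok (shift_h s).
  by apply: (winding_addh px lx); move: ne; case: (odd_sq s); case: (odd_sq (shift_h s)).
by apply; split => //; move: sx'; rewrite /= intrD; lra.
Qed.

Lemma odd_v s z : odd_sq s != odd_sq (shift_v s) -> square s z -> square (shift_v s) z -> G z.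
Proof.
move=> ne [sx /andP[_ sy]] [_ /andP[sy' _]].
have /asboolP : hok (shift_v s).
  by apply: (winding_addv px lx); move: ne; case: (odd_sq s); case: (odd_sq (shift_v s)).
by apply; split => //; move: sy'; rewrite /= intrD; lra.
Qed.

Lemma odd_same_row (a b c : int) z : odd_sq (a, c) != odd_sq (b, c) ->
  square (a, c) z -> square (b, c) z -> G z.
Proof.
move=> ne sa sb; have [ax _] := sa; have [bx _] := sb.
have [ab|[ab _]|[ab _]] := in_unit2 ax bx; rewrite /= in ab; subst.
- by rewrite eqxx in ne.
- exact: (@odd_h (a, c)).
- by apply: (@odd_h (b, c)) => //; rewrite eq_sym.
Qed.

Lemma odd_same_col (a b c : int) z : odd_sq (c, a) != odd_sq (c, b) ->
  square (c, a) z -> square (c, b) z -> G z.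
Proof.
move=> ne sa sb; have [_ ay] := sa; have [_ by_] := sb.
have [ab|[ab _]|[ab _]] := in_unit2 ay by_; rewrite /= in ab; subst.
- by rewrite eqxx in ne.
- exact: (@odd_v (c, a)).
- by apply: (@odd_v (c, b)) => //; rewrite eq_sym.
Qed.

(** The squares may be diagonal neighbours; the square in the column of [t] and the row of [s] also
    contains [z], and the parity changes on one of the two legs. *)
Lemma odd_change s t z : odd_sq s != odd_sq t -> square s z -> square t z -> G z.
Proof.
case: s t => a b [c d] ne sz tz; have [sx sy] := sz; have [tx ty] := tz.
have uz : square (c, b) z by [].
have [e1|e1] := eqVneq (odd_sq (a, b)) (odd_sq (c, b)).
  by apply: (@odd_same_col b d c) => //; rewrite -e1.
exact: odd_same_row e1 _ _.
Qed.

(* The interior [O] of the union of the odd squares is bounded, with boundary in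
   [G], so it lies in [G]. *)
Lemma winding_square s : odd_sq s -> sok s.
Proof.
move=> os; pose O : set C := [set z | forall t, square t z -> odd_sq t].
have oO : open O.
  apply/openCP => z Oz; have [d d0 hd] := square_near z; exists d => // w wz t tw.
  exact/Oz/(hd w).
have [k bk] : exists k : int, forall a, a \in x :: p -> `|a.1| < k /\ `|a.2| < k.
  exists (\sum_(v <- x :: p) (`|v.1| + `|v.2|) + 1) => v vx.
  have : `|v.1| + `|v.2| <= \sum_(v <- x :: p) (`|v.1| + `|v.2|).
    by rewrite (big_rem v)//= lerDl sumr_ge0.
  by lia.
have bO : bounded_set O.
  apply/bounded_setC_P; exists (`|Re o| + `|Im o| + 2 * (e * (k%:~R + 1))) => z Oz.
  have [t tz] := square_ex z; have [/= tk1 tk2] := winding_bounded px lx bk (Oz t tz).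
  have aux (n : int) (u : R) : `|n| <= k -> in_unit n u -> `|u| <= k%:~R + 1.
    move=> nk /andP[u1 u2]; have : - k <= n by lia.
    have : n <= k by lia.
    rewrite -!(ler_int R) rmorphN/= => h1 h2; rewrite ler_norml; apply/andP; split; lra.
  have [zx zy] := tz.
  have hx := aux _ _ tk1 zx; have hy := aux _ _ tk2 zy.
  have Rex : Re z = Re o + e * grid_x z by rewrite /grid_x mulrC divfK ?gt_eqF//; ring.
  have Imx : Im z = Im o + e * grid_y z by rewrite /grid_y mulrC divfK ?gt_eqF//; ring.
  apply: le_trans (normc_le_ReIm z) _; rewrite Rex Imx.
  have h1 : `|Re o + e * grid_x z| <= `|Re o| + e * (k%:~R + 1).
    by rewrite (le_trans (ler_normD _ _))// lerD2l normrM gtr0_norm// ler_pM2l.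
  have h2 : `|Im o + e * grid_y z| <= `|Im o| + e * (k%:~R + 1).
    by rewrite (le_trans (ler_normD _ _))// lerD2l normrM gtr0_norm// ler_pM2l.
  by lra.
have dO : boundary O `<=` G.
  move=> z; rewrite boundary_open// => -[/closureCP clz nOz].
  have [t tz ot] : exists2 t, square t z & ~~ odd_sq t.
    by apply: contrapT => h; apply: nOz => t tz; apply/negP => /negP ot; apply: h; exists t.
  have [d d0 hd] := square_near z; have [w Ow wz] := clz d d0.
  have [u uw] := square_ex w; have ou := Ow u uw.
  by apply: (@odd_change u t z) => //; [rewrite ou (negbTE ot)|exact: hd uw].
have OG := hG oO bO dO.
apply/asboolP => z [/andP[zx1 zx2] /andP[zy1 zy2]].
suff clz : closure O z.
  by have [/OG//|nOz] := pselect (O z); apply: dO; rewrite boundary_open.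
(* Moving from [z] towards the centre [c] enters the interior of the square, where it is the only
   square. *)
pose c : C := (Re o + e * (s.1%:~R + 2^-1)) +i* (Im o + e * (s.2%:~R + 2^-1)).
apply/closureCP => d d0.
pose t := Num.min (1 / 2) (d / (2 * (N (c - z) + 1))).
have cz0 : 0 < N (c - z) + 1 by rewrite ltr_wpDl ?normc_ge0.
have t0 : 0 < t by rewrite lt_min; apply/andP; split; rewrite ?divr_gt0// mulr_gt0.
have t1 : t < 1 by rewrite gt_min; apply/orP; left; lra.
have td : t * (N (c - z) + 1) < d.
  apply: (@le_lt_trans _ _ (d / 2)); last by lra.
  have : t <= d / (2 * (N (c - z) + 1)) by rewrite ge_min lexx orbT.
  move=> h; apply: le_trans (ler_wpM2r (ltW cz0) h) _.
  by rewrite le_eqVlt; apply/orP; left; apply/eqP; field; rewrite gt_eqF.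
exists (z + t%:C * (c - z)); last first.
  rewrite addrC addKr Normc.normcM normc_real gtr0_norm//.
  by apply: le_lt_trans td; rewrite ler_pM2l// lerDl.
have gx : grid_x (z + t%:C * (c - z)) = (1 - t) * grid_x z + t * (s.1%:~R + 2^-1).
  rewrite /grid_x; case: (z) => z1 z2 /=; field; exact: lt0r_neq0.
have gy : grid_y (z + t%:C * (c - z)) = (1 - t) * grid_y z + t * (s.2%:~R + 2^-1).
  rewrite /grid_y; case: (z) => z1 z2 /=; field; exact: lt0r_neq0.
have uniq_unit (n m : int) (u : R) : in_unit n ((1 - t) * u + t * (m%:~R + 2^-1)) ->
    m%:~R <= u -> u <= m%:~R + 1 -> n = m.
  move=> /andP[n1 n2] u1 u2.
  have h1 : 0 <= (1 - t) * (u - m%:~R) by rewrite mulr_ge0 ?subr_ge0// ltW.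
  have h2 : 0 <= (1 - t) * (m%:~R + 1 - u) by rewrite mulr_ge0 ?subr_ge0// ltW.
  have nm : n < m + 1 by rewrite -(ltr_int R) intrD; nra.
  have mn : m < n + 1 by rewrite -(ltr_int R) intrD; nra.
  by apply/eqP; rewrite eq_le -!ltzD1 nm mn.
move=> [a b] [/=]; rewrite gx gy => /uniq_unit/(_ zx1 zx2)-> /uniq_unit/(_ zy1 zy2)->.
by case: (s) os.
Qed.

End Walk.

Lemma grid_walk_trivial x p : path (step hok vok) x p -> last x p = x ->
  heq (gcell hok vok sok) (x :: p) [:: x].
Proof.
apply: closed_walk_trivial; first exact: sok_edges.
by move=> s y q py ly; exact: (winding_square py ly).
Qed.

End Grid.

(** * Contracting loops in open sets without holes *)

Section Homotopy.
Context {R : realType}.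
Local Notation C := R[i].
Local Notation N := Normc.normc.
Local Open Scope complex_scope.
Implicit Types (z w : C) (g : R -> C) (K : set C).
Variable G : set C.

Definition unit_clamp (t : R) : R := Num.max 0 (Num.min 1 t).

Lemma unit_clamp_itv (t : R) : 0 <= unit_clamp t <= 1.
Proof. by rewrite le_max lexx/= ge_max ler01 ge_min lexx. Qed.

Lemma unit_clamp_id (t : R) : 0 <= t <= 1 -> unit_clamp t = t.
Proof. by move=> /andP[t0 t1]; rewrite /unit_clamp min_r// max_r. Qed.

Lemma unit_clamp0 (t : R) : t <= 0 -> unit_clamp t = 0.
Proof. by move=> t0; rewrite /unit_clamp min_r ?max_l// (le_trans t0). Qed.

Lemma unit_clamp1 (t : R) : 1 <= t -> unit_clamp t = 1.
Proof. by move=> t1; rewrite /unit_clamp min_l ?max_r. Qed.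

Lemma unit_clamp_cts : continuous unit_clamp.
Proof.
move=> t; apply/continuous_realP => d d0.
apply/(@nbhs_ballP R R); exists d => // s; rewrite /ball/= => ts.
apply: le_lt_trans ts; have := ler_norm (t - s); have := ler_norm (s - t).
have m01 : Num.max 0 1 = 1 :> R by rewrite max_r.
rewrite /unit_clamp (distrC s t) ler_norml => ? ?.
by case: (leP 1 t) => ?; case: (leP 1 s) => ?; case: (leP 0 t) => ?; case: (leP 0 s) => ?;
  rewrite ?m01; apply/andP; split; lra.
Qed.

Lemma cts_unit_clamp_comp (T : topologicalType) (f : T -> R) (x : T) : {for x, continuous f} ->
  {for x, continuous (fun y => unit_clamp (f y))}.
Proof. by move=> cf; apply: (@continuous_comp _ _ _ f unit_clamp) => //; exact: unit_clamp_cts. Qed.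

Lemma cts_pair (T U V : topologicalType) (f : T -> U) (g : T -> V) (x : T) :
  {for x, continuous f} -> {for x, continuous g} -> {for x, continuous (fun y => (f y, g y))}.
Proof.
by move=> cf cg; exact: (@cvg_pair _ _ _ (nbhs x) (nbhs (f x)) (nbhs (g x)) _ _ _ f g cf cg).
Qed.

(* Homotopies are taken continuous on the whole plane of parameters, so that
   gluing them needs no pasting along subsets. *)
Definition contractible g := exists H : R * R -> C, [/\ continuous H,
  forall s t, 0 <= s <= 1 -> 0 <= t <= 1 -> G (H (s, t)),
  forall t, 0 <= t <= 1 -> H (0, t) = g t /\ H (1, t) = g 0 &
  forall s, 0 <= s <= 1 -> H (s, 0) = g 0 /\ H (s, 1) = g 0].

Lemma i01 : 0 <= (0 : R) <= 1. Proof. by apply/andP; split. Qed.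
Lemma i11 : 0 <= (1 : R) <= 1. Proof. by apply/andP; split. Qed.

Lemma contractible_homotopic g g' (K : R * R -> C) : continuous K ->
  (forall s t, 0 <= s <= 1 -> 0 <= t <= 1 -> G (K (s, t))) ->
  (forall t, 0 <= t <= 1 -> K (0, t) = g t /\ K (1, t) = g' t) ->
  (forall s, 0 <= s <= 1 -> K (s, 0) = g 0 /\ K (s, 1) = g 0) ->
  contractible g' -> contractible g.
Proof.
move=> cK GK Kt Ks [H [cH GH Ht Hs]].
pose a (x : R * R) := unit_clamp (2 * x.1); pose b (x : R * R) := unit_clamp (2 * x.1 - 1).
have c1 x : {for x, continuous (fun y : R * R => 2 * y.1)}.
  by apply: (@cvgM _ _ (nbhs x)); [exact: cvg_cst|exact: cvg_fst].
have ca x : {for x, continuous (fun y => (a y, y.2) : R * R)}.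
  exact: (cts_pair (cts_unit_clamp_comp (@c1 x)) (@cvg_snd _ _ _ _ _)).
have cb x : {for x, continuous (fun y => (b y, y.2) : R * R)}.
  apply: (@cts_pair _ _ _ b snd); last exact: cvg_snd.
  apply: (@cts_unit_clamp_comp _ (fun y : R * R => 2 * y.1 - 1)).
  by apply: (@cvgB _ _ _ (nbhs x)); [exact: c1|exact: cvg_cst].
have ce (x : R * R) : {for x, continuous (fun y : R * R => (1, y.2) : R * R)}.
  exact: (@cts_pair (R * R)%type R R (fun=> 1) snd x (@cvg_cst _ _ _ _ _) (@cvg_snd _ _ _ _ _)).
(* One formula for both halves: the bracket vanishes for [s <= 1 / 2], and the two values of [K]
   cancel for [s >= 1 / 2]. *)
pose F x := K (a x, x.2) + (H (b x, x.2) - K (1, x.2)).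
have F1 (s t : R) : 0 <= s <= 1 / 2 -> 0 <= t <= 1 -> F (s, t) = K (2 * s, t).
  move=> s01 t01; rewrite /F /a /b /= unit_clamp_id ?(@unit_clamp0 (2 * s - 1)); [|lra|lra].
  by rewrite (Ht t t01).1 (Kt t t01).2 subrr addr0.
have F2 (s t : R) : 1 / 2 <= s <= 1 -> 0 <= t <= 1 -> F (s, t) = H (2 * s - 1, t).
  move=> s01 t01; rewrite /F /a /b /= unit_clamp1 ?(@unit_clamp_id (2 * s - 1)); [|lra|lra].
  by rewrite addrC subrK.
have half (s : R) : 0 <= s <= 1 -> (0 <= s <= 1 / 2 /\ 0 <= 2 * s <= 1) \/
    (1 / 2 <= s <= 1 /\ 0 <= 2 * s - 1 <= 1).
  by move=> s01; case: (leP s (1 / 2)) => h; [left|right]; split; apply/andP; split; lra.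
have g00 : g' 0 = g 0 by have [_ <-] := Kt 0 i01; have [-> _] := Ks 1 i11.
exists F; split.
- move=> x.
  have h1 := @continuous_comp _ _ _ (fun y => (a y, y.2) : R * R) K x (@ca x) (cK _).
  have h2 := @continuous_comp _ _ _ (fun y => (b y, y.2) : R * R) H x (@cb x) (cH _).
  have h3 := @continuous_comp _ _ _ (fun y => (1, y.2) : R * R) K x (@ce x) (cK _).
  exact: (ctsD h1 (ctsD h2 (ctsN h3))).
- move=> s t s01 t01; have [[h1 h2]|[h1 h2]] := half s s01.
    by rewrite F1//; exact: GK.
  by rewrite F2//; exact: GH.
- move=> t t01; split; first by rewrite F1 ?mulr0 ?(Kt t t01).1//; lra.
  rewrite F2//; last lra.
  by rewrite (_ : 2 * 1 - 1 = 1) ?(Ht t t01).2//; lra.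
- move=> s s01; have [[h1 h2]|[h1 h2]] := half s s01.
    by rewrite !F1 ?i01 ?i11//; exact: Ks.
  by rewrite !F2 ?i01 ?i11// -g00; exact: Hs.
Qed.

Lemma cts_fst_snd (g : R -> C) : continuous g ->
  continuous (fun x : R * R => g x.2).
Proof. move=> cg x; exact: (@continuous_comp _ _ _ snd g x (@cvg_snd _ _ _ _ _) (cg _)). Qed.

Lemma contractible_straight g g' : continuous g -> continuous g' -> g 1 = g 0 ->
  g' 0 = g 0 -> g' 1 = g 0 ->
  (forall s t, 0 <= s <= 1 -> 0 <= t <= 1 -> G (g t + s%:C * (g' t - g t))) ->
  contractible g' -> contractible g.
Proof.
move=> cg cg' g1 g'0 g'1 Gs.
apply: (@contractible_homotopic _ _ (fun x => g x.2 + x.1%:C * (g' x.2 - g x.2))).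
- move=> x.
  have h1 : {for x, continuous (fun y : R * R => g y.2)} by exact: cts_fst_snd.
  have h2 : {for x, continuous (fun y : R * R => g' y.2)} by exact: cts_fst_snd.
  have h3 : {for x, continuous (fun y : R * R => y.1%:C)}.
    by apply: (@cts_realC _ _ (fun y : R * R => y.1)); exact: cvg_fst.
  exact: (ctsD h1 (ctsM h3 (ctsD h2 (ctsN h1)))).
- by move=> s t /= s01 t01; exact: Gs.
- by move=> t _ /=; rewrite mul0r addr0 mul1r addrC subrK.
- by move=> s _ /=; rewrite g'0 g'1 g1 subrr mulr0 addr0.
Qed.

Lemma contractible_reparam g (phi : R -> R) : continuous g -> continuous phi ->
  (forall t, 0 <= t <= 1 -> G (g t)) -> g 1 = g 0 ->
  (forall t, 0 <= phi t <= 1) -> phi 0 = 0 -> phi 1 = 1 ->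
  contractible (fun t => g (phi t)) -> contractible g.
Proof.
move=> cg cphi Gg g1 phi01 phi0 phi1.
apply: (@contractible_homotopic _ _ (fun x => g (x.2 + x.1 * (phi x.2 - x.2)))).
- move=> x; apply: (@continuous_comp _ _ _ (fun x : R * R => x.2 + x.1 * (phi x.2 - x.2)) g); last exact: cg.
  apply: (@cvgD _ _ _ (nbhs x)); first exact: cvg_snd.
  apply: (@cvgM _ _ (nbhs x)); first exact: cvg_fst.
  apply: (@cvgB _ _ _ (nbhs x)); last exact: cvg_snd.
  exact: (@continuous_comp _ _ _ snd phi x (@cvg_snd _ _ _ _ _) (cphi _)).
- move=> s t s01 t01 /=; apply: Gg; have := phi01 t; move: s01 t01.
  move=> /andP[s0 s1] /andP[t0 t1] /andP[p0 p1].
  have h1 : 0 <= (1 - s) * t by rewrite mulr_ge0 ?subr_ge0.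
  have h2 : 0 <= s * phi t by rewrite mulr_ge0.
  have h3 : 0 <= (1 - s) * (1 - t) by rewrite mulr_ge0 ?subr_ge0.
  have h4 : 0 <= s * (1 - phi t) by rewrite mulr_ge0 ?subr_ge0.
  by apply/andP; split; lra.
- by move=> t _ /=; rewrite mul0r addr0 mul1r addrC subrK.
- by move=> s _ /=; rewrite phi0 phi1 !subrr !mulr0 !addr0.
Qed.

Lemma contractible_cst z : G z -> contractible (fun=> z).
Proof. by move=> Gz; exists (fun=> z); split => // x; exact: cvg_cst. Qed.

Lemma contractible_null_homotopic g : contractible g -> null_homotopic_in G g.
Proof.
move=> [H [cH GH Ht Hs]]; exists H; split.
- exact: continuous_subspaceT.
- by move=> _ [[s t] [/= s01 t01] <-]; apply: GH; [move: s01|move: t01]; rewrite in_itv.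
- by move=> t; rewrite in_itv/=; exact: Ht.
- by move=> s; rewrite in_itv/=; exact: Hs.
Qed.

End Homotopy.

(** * Polylines and their homotopies *)

Section PiecewiseLinear.
Context {R : realType}.
Local Notation C := R[i].
Local Notation N := Normc.normc.
Local Open Scope complex_scope.
Implicit Types (z w a b c : C) (P : nat -> C) (n : nat).

(** Each increment is switched on by its own clamped parameter, so continuity needs no case
    distinction and repeated vertices contribute zero. *)
Definition polyline P n (t : R) : C :=
  P 0%N + \sum_(i < n) (unit_clamp (n%:R * t - i%:R))%:C * (P i.+1 - P i).

Lemma cts_sum (T : topologicalType) (F : nat -> T -> C) n (x : T) :
  (forall i, {for x, continuous (F i)}) -> {for x, continuous (fun y => \sum_(i < n) F i y)}.
Proof.
move=> cF; elim: n => [|n IH].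
  rewrite (_ : (fun _ => _) = fun=> 0); first exact: cts_cst.
  by apply/funext => y; rewrite big_ord0.
rewrite (_ : (fun _ => _) = fun y => \sum_(i < n) F i y + F n y); first exact: (ctsD IH (cF n)).
by apply/funext => y; rewrite big_ord_recr.
Qed.

Lemma polyline_cts P n : continuous (polyline P n).
Proof.
move=> t.
have cu (i : nat) : {for t, continuous (fun s : R => (unit_clamp (n%:R * s - i%:R))%:C)}.
  have c1 : {for t, continuous (fun s : R => n%:R * s - i%:R)}.
    apply: (@cvgB _ _ _ (nbhs t)); last exact: cvg_cst.
    by apply: (@cvgM _ _ (nbhs t)); [exact: cvg_cst|exact: cvg_id].
  exact: cts_realC (cts_unit_clamp_comp c1).
have cF i := ctsM (cu i) (@cts_cst _ _ (P i.+1 - P i) t).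
have h := @cts_sum _ (fun i (s : R) => (unit_clamp (n%:R * s - i%:R))%:C * (P i.+1 - P i)) n t cF.
exact: (ctsD (@cts_cst _ _ (P 0%N) t) h).
Qed.

Lemma polyline_sum P n (u th : R) k : 0 <= th <= 1 -> u = k%:R + th ->
  P 0%N + \sum_(i < n) (unit_clamp (u - i%:R))%:C * (P i.+1 - P i) =
  if (k < n)%N then (1 - th)%:C * P k + th%:C * P k.+1 else P n.
Proof.
move=> th01 ->; elim: n => [|n IH]; first by rewrite big_ord0 addr0.
rewrite big_ord_recr /= addrA IH ltnS.
case: (ltngtP k n) => [kn|kn|->].
- rewrite unit_clamp0; first by rewrite mul0r addr0.
  have : k.+1%:R <= n%:R :> R by rewrite ler_nat.
  by rewrite -natr1; lra.
- rewrite unit_clamp1; first by rewrite mul1r addrC subrK.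
  have : n.+1%:R <= k%:R :> R by rewrite ler_nat.
  by rewrite -natr1; lra.
- rewrite addrAC subrr add0r unit_clamp_id; last exact: th01.
  by rewrite rmorphB rmorph1; ring.
Qed.

Lemma polyline_param n (t : R) : (0 < n)%N -> 0 <= t <= 1 ->
  exists k th, [/\ (k < n)%N, 0 <= th <= 1, n%:R * t = k%:R + th &
    forall P, polyline P n t = (1 - th)%:C * P k + th%:C * P k.+1].
Proof.
move=> n0 /andP[t0 t1].
have n0' : 0 < n%:R :> R by rewrite ltr0n.
suff [k [th [kn th01 e]]] : exists k th, [/\ (k < n)%N, 0 <= th <= 1 & n%:R * t = k%:R + th :> R].
  by exists k, th; split => // P; rewrite /polyline (polyline_sum _ _ th01 e) kn.
have [t1'|t1'] := eqVneq t 1.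
  exists n.-1, 1; split; [by rewrite prednK|by rewrite ler01 lexx|].
  by rewrite t1' mulr1 natr1 prednK.
have /andP[h1 h2] := truncn_itv (mulr_ge0 (ltW n0') t0).
exists (Num.truncn (n%:R * t)), (n%:R * t - (Num.truncn (n%:R * t))%:R); split.
- rewrite -(ltr_nat R) (le_lt_trans h1)// gtr_pMr// lt_neqAle t1' t1//.
- by move: h2; rewrite -natr1; lra.
- by ring.
Qed.

Lemma polyline0 P n : polyline P n 0 = P 0%N.
Proof.
rewrite /polyline (@polyline_sum P n _ 0 0%N) ?i01 ?mulr0 ?addr0//.
by case: n => //= n; rewrite subr0 mul1r mul0r addr0.
Qed.

Lemma polyline1 P n : polyline P n 1 = P n.
Proof. by rewrite /polyline (@polyline_sum P n _ 0 n) ?i01 ?mulr1 ?addr0 ?ltnn. Qed.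

Definition convexC (K : set C) := forall a b (t : R), K a -> K b -> 0 <= t <= 1 ->
  K ((1 - t)%:C * a + t%:C * b).

Variable G : set C.

(** Convexity keeps straight-line homotopies between such points in [G]; an edge is the degenerate
    case [ccell a b b]. *)
Definition ccell a b c := exists K, [/\ convexC K, K `<=` G, K a, K b & K c].

Lemma convexC1 a : convexC [set a].
Proof. by move=> _ _ t -> -> _; rewrite -mulrDl -rmorphD subrK mul1r. Qed.

Lemma contractible_polyline P P' n : (0 < n)%N -> P n = P 0%N -> P' 0%N = P 0%N ->
  P' n = P 0%N -> (forall i, (i < n)%N -> exists K, [/\ convexC K, K `<=` G &
     [/\ K (P i), K (P i.+1), K (P' i) & K (P' i.+1)]]) ->
  contractible G (polyline P' n) -> contractible G (polyline P n).
Proof.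
move=> n0 Pn P'0 P'n PP'; apply: contractible_straight.
- exact: polyline_cts.
- exact: polyline_cts.
- by rewrite polyline1 polyline0.
- by rewrite !polyline0.
- by rewrite polyline0 polyline1.
move=> s t s01 t01; have [k [th [kn th01 _ e]]] := polyline_param n0 t01.
have [K [cK KG [K1 K2 K3 K4]]] := PP' k kn.
apply: KG; rewrite !e; set a := (_ * P k + _); set b := (_ * P' k + _).
rewrite (_ : a + s%:C * (b - a) = (1 - s)%:C * a + s%:C * b); last by rewrite rmorphB rmorph1; ring.
by apply: (cK _ _ s) => //; exact: cK.
Qed.

Variable z0 : C.
Hypothesis Gz0 : G z0.

Definition adj a b := `[< ccell a b b >].

Definition loop_list (L : seq C) := [/\ head z0 L = z0, last z0 L = z0 & sorted adj L].

Local Notation line L n := (polyline (nth z0 L) n).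

Lemma loop_list_nth L n : loop_list L -> (size L <= n.+1)%N -> nth z0 L n = z0.
Proof.
move=> [_ lL _]; rewrite leq_eqVlt => /orP[/eqP sL|sL].
  by have := nth_last z0 L; rewrite sL /= lL.
by rewrite nth_default.
Qed.

Lemma loop_list_cell L i : loop_list L -> ccell (nth z0 L i) (nth z0 L i.+1) (nth z0 L i.+1).
Proof.
move=> lL; have [_ _ sL] := lL; have [iL|iL] := ltnP i.+1 (size L).
  by apply/asboolP; exact: (sortedP z0 sL).
rewrite (nth_default _ iL) (loop_list_nth lL iL); exists [set z0]; split => //.
  exact: convexC1.
by move=> _ ->.
Qed.

Lemma loop_list_change l1 a y y' b l2 n : (0 < n)%N ->
  loop_list (l1 ++ [:: a, y, b & l2]) -> loop_list (l1 ++ [:: a, y', b & l2]) ->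
  ccell a y y' -> ccell y y' b -> (size (l1 ++ [:: a, y, b & l2]) <= n.+1)%N ->
  contractible G (line (l1 ++ [:: a, y', b & l2]) n) ->
  contractible G (line (l1 ++ [:: a, y, b & l2]) n).
Proof.
set L := l1 ++ _; set L' := l1 ++ _; move=> n0 lL lL' c1 c2 sL.
have sL' : (size L' <= n.+1)%N by move: sL; rewrite /L /L' !size_cat.
have L0 : nth z0 L 0 = z0 by rewrite nth0; case: lL.
have L'0 : nth z0 L' 0 = z0 by rewrite nth0; case: lL'.
apply: contractible_polyline => //; rewrite ?L0 ?L'0 ?(loop_list_nth lL)// ?(loop_list_nth lL')//.
move=> i _; have nE j : nth z0 L j = if (j < size l1)%N then nth z0 l1 j else
    nth z0 [:: a, y, b & l2] (j - size l1) by rewrite nth_cat.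
have nE' j : nth z0 L' j = if (j < size l1)%N then nth z0 l1 j else
    nth z0 [:: a, y', b & l2] (j - size l1) by rewrite nth_cat.
have same j : j != (size l1).+1 -> nth z0 L' j = nth z0 L j.
  move=> jl; rewrite nE nE'; case: ltnP => // lj.
  case E : (j - size l1)%N => [|[|m]] //; move: jl; rewrite -(subnK lj) E add1n.
  by rewrite eqxx.
have at1 : nth z0 L (size l1).+1 = y by rewrite nE ltnNge leqnSn /= subSn// subnn.
have at1' : nth z0 L' (size l1).+1 = y' by rewrite nE' ltnNge leqnSn /= subSn// subnn.
have at0 : nth z0 L (size l1) = a by rewrite nE ltnn subnn.
have at2 : nth z0 L (size l1).+2 = b.
  by rewrite nE ltnNge (leq_trans (leqnSn _) (leqnSn _))/= -addn2 addKn.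
have [i0|i0] := eqVneq i (size l1).
  subst i; rewrite (same (size l1)) ?neq_ltn ?ltnSn// at0 at1 at1'.
  by have [K [? ? ? ? ?]] := c1; exists K.
have [i1|i1] := eqVneq i (size l1).+1.
  subst i; rewrite (same (size l1).+2) ?neq_ltn ?ltnSn ?orbT// at2 at1 at1'.
  by have [K [? ? ? ? ?]] := c2; exists K.
rewrite !same//; have [K [? ? ? ? ?]] := loop_list_cell i lL.
by exists K.
Qed.

Lemma ccell_sub a b c x y z : ccell a b c -> x \in [:: a; b; c] -> y \in [:: a; b; c] ->
  z \in [:: a; b; c] -> ccell x y z.
Proof.
move=> [K [cK KG Ka Kb Kc]] xi yi zi.
have H u : u \in [:: a; b; c] -> K u by rewrite !inE => /or3P[] /eqP->.
by exists K; split => //; exact: H.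
Qed.

Lemma adj_ccell a b c : ccell a b c -> [/\ adj a b, adj b c & adj a c].
Proof. by move=> abc; split; apply/asboolP; apply: (ccell_sub abc); rewrite !inE eqxx ?orbT. Qed.

Lemma adj_refl a b : adj a b -> adj a a /\ adj b b.
Proof. by move=> /asboolP ab; split; apply/asboolP; apply: (ccell_sub ab); rewrite !inE eqxx ?orbT. Qed.

(** The repetition is pushed to the right by moving one vertex at a time, until the padding absorbs
    it. *)
Lemma loop_list_stut l1 x l2 n : (0 < n)%N -> loop_list (l1 ++ [:: x, x & l2]) ->
  (size (l1 ++ [:: x, x & l2]) <= n.+1)%N ->
  contractible G (line (l1 ++ [:: x, x & l2]) n) <-> contractible G (line (l1 ++ x :: l2) n).
Proof.
move=> n0; elim: l2 l1 x => [|y l2 IH] l1 x lL sL.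
  have [_ + _] := lL; rewrite last_cat /= => xz0; subst x.
  suff -> : nth z0 (l1 ++ [:: z0; z0]) = nth z0 (l1 ++ [:: z0]) by [].
  apply/funext => i; rewrite !nth_cat; case: ltnP => // _.
  by case: (i - size l1)%N => [|[|m]] //=; rewrite ?nth_nil.
have [h1 h2] : head z0 (l1 ++ [:: x, y, y & l2]) = head z0 (l1 ++ [:: x, x, y & l2]) /\
    last z0 (l1 ++ [:: x, y, y & l2]) = last z0 (l1 ++ [:: x, x, y & l2]).
  by case: (l1) => [|? ?] /=; rewrite ?last_cat.
have [_ _] := lL; rewrite sorted_cat_cons => /and4P[s1 xx xy yl].
have {}lL' : loop_list (l1 ++ [:: x, y, y & l2]).
  case: lL => ? ? _; split; rewrite ?h1 ?h2//.
  by rewrite sorted_cat_cons /= s1 xy (adj_refl xy).2.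
have /asboolP cxy := xy.
have sL' : (size (l1 ++ [:: x, y, y & l2]) <= n.+1)%N by move: sL; rewrite !size_cat.
have e1 : contractible G (line (l1 ++ [:: x, x, y & l2]) n) <->
    contractible G (line (l1 ++ [:: x, y, y & l2]) n).
  split; apply: loop_list_change => //; apply: (ccell_sub cxy); by rewrite !inE eqxx ?orbT.
apply: iff_trans e1 _.
have := IH (rcons l1 x) y; rewrite -!cats1 -!catA /=; exact.
Qed.

Lemma loop_list_adj_refl L x : loop_list L -> x \in L -> adj x x.
Proof.
move=> lL xL; have := loop_list_cell (index x L) lL; rewrite nth_index// => h.
by have [xb _ _] := adj_ccell h; exact: (adj_refl xb).1.
Qed.

(* A vertex list padded by its base point has the same polyline up to
   parametrization, so both polylines can be sampled with a common large [n]. *)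
Lemma heq_contractible L L' : heq ccell L L' -> (loop_list L <-> loop_list L') /\
  (loop_list L -> exists M, forall n, (M <= n)%N ->
    (contractible G (line L n) <-> contractible G (line L' n))).
Proof.
elim=> {L L'} [L|L L' _ [h1 h2]|L L' L'' _ [h1 h2] _ [h3 h4]|l1 x l2|l1 x y z l2 c].
- by split => // _; exists 0%N.
- split; first exact: iff_sym.
  by move=> /h1/h2[M hM]; exists M => n /hM; exact: iff_sym.
- split; first exact: iff_trans h1 h3.
  move=> lL; have [M hM] := h2 lL; have [M' hM'] := h4 (h1.1 lL).
  exists (maxn M M') => n; rewrite geq_max => /andP[/hM h /hM' h'].
  exact: iff_trans h h'.
- have hd : head z0 (l1 ++ [:: x, x & l2]) = head z0 (l1 ++ x :: l2) by case: (l1).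
  have la : last z0 (l1 ++ [:: x, x & l2]) = last z0 (l1 ++ x :: l2) by rewrite !last_cat.
  split; last first.
    move=> lL; exists (size (l1 ++ [:: x, x & l2])).+1 => n nM.
    by apply: loop_list_stut => //; [exact: leq_ltn_trans nM|exact: leq_trans (ltnW nM) (leqnSn _)].
  split => lL.
    case: (lL); rewrite /loop_list hd la !sorted_cat_cons /= => ? ? /and3P[s1 _ s2].
    by split => //; rewrite s1.
  have xx : adj x x by apply: (loop_list_adj_refl lL); rewrite mem_cat mem_head orbT.
  case: lL; rewrite /loop_list hd la !sorted_cat_cons /= => ? ? /andP[s1 s2].
  by split => //; rewrite s1 xx.
- have hd u : head z0 (l1 ++ [:: x, u, z & l2]) = head z0 (l1 ++ [:: x, z & l2]) by case: (l1).
  have la u : last z0 (l1 ++ [:: x, u, z & l2]) = last z0 (l1 ++ [:: x, z & l2]).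
    by rewrite !last_cat.
  have [xy yz xz] := adj_ccell c; have [xx _] := adj_refl xy.
  have e : loop_list (l1 ++ [:: x, y, z & l2]) <-> loop_list (l1 ++ [:: x, z & l2]).
    by rewrite /loop_list hd la !sorted_cat_cons /= xy yz xz.
  have e' : loop_list (l1 ++ [:: x, x, z & l2]) <-> loop_list (l1 ++ [:: x, z & l2]).
    by rewrite /loop_list hd la !sorted_cat_cons /= xx xz.
  split => // lL; exists (size (l1 ++ [:: x, y, z & l2])).+1 => n nM.
  have n0 : (0 < n)%N by exact: leq_ltn_trans nM.
  have sz : (size (l1 ++ [:: x, y, z & l2]) <= n.+1)%N.
    exact: leq_trans (ltnW nM) (leqnSn _).
  have sz' : (size (l1 ++ [:: x, x, z & l2]) <= n.+1)%N by move: sz; rewrite !size_cat.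
  have lL' : loop_list (l1 ++ [:: x, x, z & l2]) by apply/e'/e.
  (* Moving [y] to [x] within the cell leaves a repetition, which [loop_list_stut] removes. *)
  apply: iff_trans (loop_list_stut n0 lL' sz').
  by split; apply: loop_list_change => //; apply: (ccell_sub c); rewrite !inE eqxx ?orbT.
Qed.

End PiecewiseLinear.

(** * Replacing a loop by a grid walk *)

Section LoopSampling.
Context {R : realType}.
Local Notation C := R[i].
Local Notation N := Normc.normc.
Local Notation Re := complex.Re.
Local Notation Im := complex.Im.
Local Open Scope complex_scope.
Implicit Types (z w : C) (g : R -> C) (G K : set C).

Lemma loop_extension_cts g : {within `[0, 1], continuous g} ->
  continuous (fun t => g (unit_clamp t)).
Proof.
move=> /subspace_continuousP cg t; apply/continuousC_realP => d d0.
have ct : `[0, 1]%classic (unit_clamp t) by rewrite /= in_itv/= unit_clamp_itv.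
have /cvgC_realP/(_ _ d0) := cg _ ct; rewrite near_withinE => h.
have H := @unit_clamp_cts _ t _ h; apply: (@filterS _ (nbhs t) _ _ _ _ H) => s hs.
by apply: hs; rewrite /= in_itv/= unit_clamp_itv.
Qed.

Lemma nbhs0_right_ex (P : R -> Prop) : (\forall e \near 0^'+, P e) -> exists2 e : R, 0 < e & P e.
Proof.
move=> h.
have [e [he e0]] := @filter_ex _ _ (at_right_proper_filter (0 : R)) _ (filterI h (@nbhs_right_gt R 0)).
by exists e.
Qed.

Lemma uniform_cts01 g (d : R) : continuous g -> 0 < d -> exists2 e : R, 0 < e &
  forall s t, 0 <= s <= 1 -> `|t - s| < e -> N (g t - g s) < d.
Proof.
move=> cg d0.
have d20 : 0 < d / 2 by rewrite divr_gt0.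
have : \forall e \near 0^'+,
    `[0, 1]%classic `<=` [set s | forall t : R, `|t - s| < e -> N (g t - g s) < d].
  apply: (iffLR (compact_near_coveringP _) (@segment_compact _ 0 1)) => s _.
  have [r /= r0 hr] : exists2 r : R, 0 < r & forall t, `|s - t| < r -> N (g t - g s) < d / 2.
    by have /continuousC_realP/(_ _ d20)/(@nbhs_ballP R R)[r r0 hr] := cg s; exists r.
  exists ([set t : R | `|s - t| < r / 2], [set e : R | e < r / 2]).
    split => /=; last exact: nbhs_right_lt (divr_gt0 r0 _).
    by apply/(@nbhs_ballP R R); exists (r / 2); rewrite //= divr_gt0.
  move=> [s' e] [/= ss' er] t ts'.
  have h1 : N (g t - g s) < d / 2.
    by apply: hr; have := ler_distD s' s t; rewrite (distrC s' t); lra.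
  have h2 : N (g s' - g s) < d / 2 by apply: hr; move: ss'; have := normr_ge0 (s - s'); lra.
  by have := normc_dist_le (g s) (g t) (g s'); rewrite (normcBC (g s) (g s')); lra.
move=> /nbhs0_right_ex[e e0 he].
by exists e => // s t s01; apply: he; rewrite /= in_itv.
Qed.

Lemma compact_margin g G : continuous g -> open G -> (forall t, 0 <= t <= 1 -> G (g t)) ->
  exists2 e : R, 0 < e & forall t, 0 <= t <= 1 -> cball (g t) e `<=` G.
Proof.
move=> cg oG gG.
have : \forall e \near 0^'+, `[0, 1]%classic `<=` [set s | cball (g s) e `<=` G].
  apply: (iffLR (compact_near_coveringP _) (@segment_compact _ 0 1)) => s /=.
  rewrite in_itv/= => s01.
  have [r r0 hr] := (iffLR (openCP G) oG) _ (gG s s01).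
  have r20 : 0 < r / 2 by rewrite divr_gt0.
  exists ([set t : R | N (g t - g s) < r / 2], [set e : R | e < r / 2]).
    split => /=; last exact: nbhs_right_lt r20.
    by have /continuousC_realP/(_ _ r20) := cg s.
  move=> [s' e] [/= ss' er] w; rewrite /cball/= => ws'; apply: hr; rewrite /cball/=.
  by have := normc_dist_le (g s') w (g s); lra.
move=> /nbhs0_right_ex[e e0 he].
by exists e => // t t01; apply: he; rewrite /= in_itv.
Qed.

Section Boxes.
Variables (o : C) (e : R).
Hypothesis e0 : 0 < e.
Local Notation V := (int * int)%type.
Local Notation X := (grid_x o e).
Local Notation Y := (grid_y o e).

Lemma grid_x_mix (t : R) z w : X ((1 - t)%:C * z + t%:C * w) = (1 - t) * X z + t * X w.
Proof. by rewrite /grid_x; case: z w => [a b] [c d] /=; field; rewrite gt_eqF. Qed.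

Lemma grid_y_mix (t : R) z w : Y ((1 - t)%:C * z + t%:C * w) = (1 - t) * Y z + t * Y w.
Proof. by rewrite /grid_y; case: z w => [a b] [c d] /=; field; rewrite gt_eqF. Qed.

Lemma itv_mix (a b t x y : R) : a <= x <= b -> a <= y <= b -> 0 <= t <= 1 ->
  a <= (1 - t) * x + t * y <= b.
Proof.
move=> /andP[x1 x2] /andP[y1 y2] /andP[t0 t1].
have h1 : 0 <= (1 - t) * (x - a) by rewrite mulr_ge0 ?subr_ge0.
have h2 : 0 <= (1 - t) * (b - x) by rewrite mulr_ge0 ?subr_ge0.
have h3 : 0 <= t * (y - a) by rewrite mulr_ge0 ?subr_ge0.
have h4 : 0 <= t * (b - y) by rewrite mulr_ge0 ?subr_ge0.
by apply/andP; split; lra.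
Qed.

Lemma convex_square s : convexC (square o e s).
Proof.
by move=> a b t [a1 a2] [b1 b2] t01; split; rewrite ?grid_x_mix ?grid_y_mix; exact: itv_mix.
Qed.

Lemma convex_hedge s : convexC (hedge o e s).
Proof.
move=> a b t [a1 a2] [b1 b2] t01; split; rewrite ?grid_x_mix ?grid_y_mix; first exact: itv_mix.
by rewrite a2 b2; ring.
Qed.

Lemma convex_vedge s : convexC (vedge o e s).
Proof.
move=> a b t [a1 a2] [b1 b2] t01; split; rewrite ?grid_x_mix ?grid_y_mix; last exact: itv_mix.
by rewrite a1 b1; ring.
Qed.

Lemma grid_pt_corner s v : v \in corners s -> square o e s (grid_pt o e v).
Proof.
rewrite !inE => /or4P[] /eqP->; split; rewrite ?grid_xK ?grid_yK//=;
  by [exact: in_unit_l|exact: in_unit_r].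
Qed.

Lemma gcell_ccell G (x y z : V) : gcell (hok G o e) (vok G o e) (sok G o e) x y z ->
  ccell G (grid_pt o e x) (grid_pt o e y) (grid_pt o e z).
Proof.
move=> [[xny xy <-]|[s /asboolP sG [xs ys zs]]]; last first.
  by exists (square o e s); split; [exact: convex_square|exact: sG|exact: grid_pt_corner..].
have hG u : hok G o e u -> ccell G (grid_pt o e u) (grid_pt o e (shift_h u)) (grid_pt o e (shift_h u)).
  move=> /asboolP uG.
  have h1 : hedge o e u (grid_pt o e u) by split; rewrite ?grid_xK ?grid_yK//; exact: in_unit_l.
  have h2 : hedge o e u (grid_pt o e (shift_h u)).
    by split; rewrite ?grid_xK ?grid_yK//; exact: in_unit_r.
  by exists (hedge o e u); split => //; exact: convex_hedge.
have vG u : vok G o e u -> ccell G (grid_pt o e u) (grid_pt o e (shift_v u)) (grid_pt o e (shift_v u)).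
  move=> /asboolP uG.
  have h1 : vedge o e u (grid_pt o e u) by split; rewrite ?grid_xK ?grid_yK//; exact: in_unit_l.
  have h2 : vedge o e u (grid_pt o e (shift_v u)).
    by split; rewrite ?grid_xK ?grid_yK//; exact: in_unit_r.
  by exists (vedge o e u); split => //; exact: convex_vedge.
move: xy; rewrite /step (negbTE xny)/= => /or4P[]/andP[/eqP E].
- by move=> /hG h; apply: (ccell_sub h); rewrite ?E !inE eqxx ?orbT.
- by move=> /hG h; apply: (ccell_sub h); rewrite ?E !inE eqxx ?orbT.
- by move=> /vG h; apply: (ccell_sub h); rewrite ?E !inE eqxx ?orbT.
- by move=> /vG h; apply: (ccell_sub h); rewrite ?E !inE eqxx ?orbT.
Qed.

(** Wide enough for a sample point [c], the grid points got by rounding down [c] and the next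
    sample, and the edges joining them. *)
Definition box c : set C := [set z | -2 <= X z - X c <= 2 /\ -2 <= Y z - Y c <= 2].

Lemma convex_box c : convexC (box c).
Proof.
move=> a b t [a1 a2] [b1 b2] t01; split; rewrite ?grid_x_mix ?grid_y_mix.
  rewrite (_ : _ - _ = (1 - t) * (X a - X c) + t * (X b - X c)); [exact: itv_mix|ring].
rewrite (_ : _ - _ = (1 - t) * (Y a - Y c) + t * (Y b - Y c)); [exact: itv_mix|ring].
Qed.

Lemma box_ball c z : box c z -> N (z - c) <= 4 * e.
Proof.
move=> [zx zy]; apply: le_trans (normc_le_ReIm _) _.
have -> : Re (z - c) = e * (X z - X c) by rewrite /grid_x raddfB/=; field; rewrite gt_eqF.
have -> : Im (z - c) = e * (Y z - Y c) by rewrite /grid_y raddfB/=; field; rewrite gt_eqF.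
rewrite !normrM (gtr0_norm e0).
have h1 : `|X z - X c| <= 2 by rewrite ler_norml.
have h2 : `|Y z - Y c| <= 2 by rewrite ler_norml.
have := ler_wpM2l (ltW e0) h1; have := ler_wpM2l (ltW e0) h2; lra.
Qed.

Lemma ball_box c z : N (z - c) < e -> box c z.
Proof.
move=> zc; have h : N (z - c) / e < 1 by rewrite ltr_pdivrMr// mul1r.
have /ler_normlP[x1 x2] := le_trans (grid_x_dist o e0 z c) (ltW h).
have /ler_normlP[y1 y2] := le_trans (grid_y_dist o e0 z c) (ltW h).
by split; apply/andP; split; lra.
Qed.

Lemma box_step G c (u v : V) : box c `<=` G -> box c (grid_pt o e u) -> box c (grid_pt o e v) ->
  (u.2 = v.2 /\ `|u.1 - v.1| <= 1) \/ (u.1 = v.1 /\ `|u.2 - v.2| <= 1) ->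
  step (hok G o e) (vok G o e) u v.
Proof.
move=> cG; rewrite /box /= !grid_xK// !grid_yK// => -[u1 u2] [v1 v2].
have hG (w : V) : -2 <= w.1%:~R - X c <= 2 -> -2 <= (w.1 + 1)%:~R - X c <= 2 ->
    -2 <= w.2%:~R - Y c <= 2 -> hok G o e w.
  rewrite intrD => w1 w1' w2; apply/asboolP => z [/andP[z1 z2] z3]; apply: cG; split.
    by apply/andP; split; lra.
  by rewrite z3.
have vG (w : V) : -2 <= w.2%:~R - Y c <= 2 -> -2 <= (w.2 + 1)%:~R - Y c <= 2 ->
    -2 <= w.1%:~R - X c <= 2 -> vok G o e w.
  rewrite intrD => w1 w1' w2; apply/asboolP => z [z3 /andP[z1 z2]]; apply: cG; split.
    by rewrite z3.
  by apply/andP; split; lra.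
case: u v u1 u2 v1 v2 => a b [c' d] /= u1 u2 v1 v2 [[bd ac]|[ac bd]]; subst.
  have [->|[ac'|ac']] : a = c' \/ c' = a + 1 \/ a = c' + 1 by move: ac; clear; lia.
  - by rewrite /step eqxx.
  - subst c'; rewrite /step /hstep /shift_h /= eqxx (hG (a, d))// ?orbT//.
  - subst a; rewrite /step /hstep /shift_h /= eqxx (hG (c', d))// ?orbT//.
have [->|[bd'|bd']] : b = d \/ d = b + 1 \/ b = d + 1 by move: bd; clear; lia.
- by rewrite /step eqxx.
- subst d; rewrite /step /vstep /shift_v /= eqxx (vG (c', b))// ?orbT//.
- subst b; rewrite /step /vstep /shift_v /= eqxx (vG (c', d))// ?orbT//.
Qed.

End Boxes.

Lemma floor_near (x y : R) : `|x - y| < 1 -> `|Num.floor x - Num.floor y| <= 1.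
Proof.
move=> xy; have /andP[x1 x2] := floor_itv x; have /andP[y1 y2] := floor_itv y.
rewrite ltr_norml in xy; case/andP: xy => h1 h2.
rewrite !intrD in x2 y2.
have : Num.floor x < Num.floor y + 2 by rewrite -(ltr_int R) intrD; lra.
have : Num.floor y < Num.floor x + 2 by rewrite -(ltr_int R) intrD; lra.
by clear; lia.
Qed.

(** The loop is rounded to a walk in a fine grid, inside boxes contained in [G]. The walk contracts
    combinatorially, hence so does its polyline, and segments within the boxes join the
    reparametrized loop to the polyline. *)
Theorem hole_free_null_homotopic G g : open G -> hole_free G -> loop_in G g ->
  null_homotopic_in G g.
Proof.
move=> oG hG [cg0 g0G g001].
pose h t := g (unit_clamp t).
have ch : continuous h by exact: loop_extension_cts.
have hin t : G (h t) by apply: g0G; exists (unit_clamp t) => //; rewrite /= in_itv/= unit_clamp_itv.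
have hE t : 0 <= t <= 1 -> h t = g t by move=> t01; rewrite /h unit_clamp_id.
have h1 : h 1 = h 0 by rewrite !hE ?i01 ?i11// g001.
suff : contractible G h.
  move=> /contractible_null_homotopic[H [cH GH Ht Hs]]; exists H; split => //.
    by move=> t t01; have [-> ->] := Ht t t01; rewrite !hE ?i01//; move: t01; rewrite in_itv.
  by move=> s s01; have [-> ->] := Hs s s01; rewrite !hE ?i01.
have [eta eta0 heta] := compact_margin ch oG (fun t _ => hin t).
(* A box has radius at most [4 * e], which is less than [eta]. *)
pose e := eta / 8.
have e0 : 0 < e by rewrite divr_gt0.
have [d d0 hd] := uniform_cts01 ch e0.
have [n hn] := ex_natr_gt d^-1.
have n0' : 0 < n%:R :> R by apply: lt_trans hn; rewrite invr_gt0.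
have n0 : (0 < n)%N by rewrite -(ltr_nat R).
have nd : n%:R^-1 < d by rewrite -[d]invrK ltf_pV2 ?posrE ?invr_gt0.
pose tm i : R := i%:R / n%:R.
have tm01 i : (i <= n)%N -> 0 <= tm i <= 1.
  by move=> ni; rewrite divr_ge0//= ler_pdivrMr// mul1r ler_nat.
(* With the grid centred at the base point, the walk starts and ends exactly there. *)
pose o := h 0.
pose v i : int * int := (Num.floor (grid_x o e (h (tm i))), Num.floor (grid_y o e (h (tm i)))).
pose B i := box o e (h (tm i)).
have BG i : (i <= n)%N -> B i `<=` G.
  move=> ni z /(box_ball e0) zc; apply: (heta _ (tm01 i ni)); rewrite /cball/=.
  by apply: le_lt_trans zc _; rewrite /e; lra.
have close i : (i < n)%N -> N (h (tm i.+1) - h (tm i)) < e.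
  move=> ni; apply: hd; first exact: tm01 (ltnW ni).
  by rewrite /tm -mulrBl -natr1 addrAC subrr add0r mul1r ger0_norm// invr_ge0 ltW.
have closex i : (i < n)%N -> `|grid_x o e (h (tm i.+1)) - grid_x o e (h (tm i))| < 1.
  move=> /close ni; apply: le_lt_trans (grid_x_dist o e0 _ _) _.
  by rewrite ltr_pdivrMr// mul1r.
have closey i : (i < n)%N -> `|grid_y o e (h (tm i.+1)) - grid_y o e (h (tm i))| < 1.
  move=> /close ni; apply: le_lt_trans (grid_y_dist o e0 _ _) _.
  by rewrite ltr_pdivrMr// mul1r.
(* Consecutive rounded points may differ in both coordinates; the odd entries insert the corner
   between the horizontal and the vertical move. *)
pose W j : int * int := if odd j then ((v j./2.+1).1, (v j./2).2) else v j./2.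
have W0 i : W i.*2 = v i by rewrite /W odd_double doubleK.
have W1 i : W i.*2.+1 = ((v i.+1).1, (v i).2) by rewrite /W /= odd_double /= uphalf_double.
have inB i : (i < n)%N -> [/\ B i (grid_pt o e (W i.*2)), B i (grid_pt o e (W i.*2.+1)) &
    B i (grid_pt o e (W i.+1.*2))].
  move=> ni; rewrite !W0 W1 /B /box /= !grid_xK// !grid_yK//=.
  have := closex i ni; have := closey i ni; rewrite !ltr_norml => /andP[y1 y2] /andP[x1 x2].
  have /andP[fx1 fx2] := floor_itv (grid_x o e (h (tm i))).
  have /andP[fy1 fy2] := floor_itv (grid_y o e (h (tm i))).
  have /andP[fx1' fx2'] := floor_itv (grid_x o e (h (tm i.+1))).
  have /andP[fy1' fy2'] := floor_itv (grid_y o e (h (tm i.+1))).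
  rewrite !intrD in fx2 fy2 fx2' fy2'.
  by split; split; apply/andP; split; lra.
have inBk k : (k < n.*2)%N -> [/\ (k./2 < n)%N, B k./2 (grid_pt o e (W k)) &
    B k./2 (grid_pt o e (W k.+1))].
  move=> kn; have k2 : (k./2 < n)%N.
    by rewrite -ltn_double (leq_ltn_trans _ kn)// -{2}(odd_double_half k) leq_addl.
  have [b1 b2 b3] := inB _ k2; split => //.
    by rewrite -[in W k](odd_double_half k); case: (odd k).
  by rewrite -[in W k.+1](odd_double_half k); case: (odd k).
have Wstep k : (k < n.*2)%N -> step (hok G o e) (vok G o e) (W k) (W k.+1).
  move=> kn; have [k2 b1 b2] := inBk k kn.
  apply: (box_step e0 (BG _ (ltnW k2)) b1 b2).
  rewrite -[in W k](odd_double_half k) -[in W k.+1](odd_double_half k).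
  case: (odd k); rewrite ?add0n ?add1n -?doubleS ?W0 ?W1 /v /=; [right|left]; split => //.
    by apply: floor_near; rewrite distrC closey.
  by apply: floor_near; rewrite distrC closex.
pose p := map W (iota 1 n.*2).
have LE : W 0%N :: p = mkseq W n.*2.+1 by [].
have nthL i : (i <= n.*2)%N -> nth (W 0%N) (W 0%N :: p) i = W i by move=> ni; rewrite LE nth_mkseq.
have szp : size p = n.*2 by rewrite size_map size_iota.
have pW : path (step (hok G o e) (vok G o e)) (W 0%N) p.
  apply/(pathP (W 0%N)) => i; rewrite szp => ni; rewrite nthL ?(ltnW ni)//.
  by have := nthL i.+1 ni; rewrite /= => ->; exact: Wstep.
have v0 : v 0%N = (0, 0).
  by rewrite /v /tm mul0r /grid_x /grid_y -/o !subrr !mul0r floor0.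
have vn : v n = (0, 0) by rewrite /v /tm divff ?gt_eqF// h1 -v0 /v /tm mul0r.
have W00 : W 0%N = (0, 0) by rewrite -v0 -W0.
have Wn : W n.*2 = (0, 0) by rewrite W0.
have lW : last (W 0%N) p = W 0%N.
  by have := nth_last (W 0%N) (W 0%N :: p); rewrite /= szp => <-; rewrite (nthL _ (leqnn _)) Wn W00.
have hq := grid_walk_trivial e0 hG pW lW.
have {}hq := heq_map (@gcell_ccell _ _ e0 G) hq.
have pt0 : grid_pt o e (0, 0) = o.
  by rewrite /grid_pt /= !mulr0 !addr0; case: (o).
pose L := map (grid_pt o e) (W 0%N :: p).
have Go : G o by exact: hin.
have nL i : (i <= n.*2)%N -> nth o L i = grid_pt o e (W i).
  by move=> ni; rewrite (nth_map (W 0%N)) ?nthL//= szp ltnS.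
have szL : size L = n.*2.+1 by rewrite size_map /= szp.
have loopL : loop_list G o L.
  split; first by rewrite /L /= W00 pt0.
    by rewrite -nth_last szL nL//= Wn pt0.
  apply/(sortedP o) => i; rewrite szL ltnS => ni.
  rewrite !nL ?(ltnW ni)//; have [k2 b1 b2] := inBk i ni.
  apply/asboolP; exists (B i./2); split => //; [exact: convex_box|exact: BG (ltnW k2)].
have [_ /(_ loopL)[M hM]] := heq_contractible Go hq.
pose m := maxn M n.*2.
have mn : (n.*2 <= m)%N by rewrite leq_maxr.
have n20 : (0 < n.*2)%N by rewrite double_gt0.
have m0 : (0 < m)%N by exact: leq_trans mn.
have n20' : 0 < n.*2%:R :> R by rewrite ltr0n.
have cL : contractible G (polyline (nth o L) m).
  apply/(hM m (leq_maxl _ _)); rewrite /= W00 pt0.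
  rewrite (_ : polyline _ _ = fun=> o); first exact: contractible_cst.
  have no i : nth o [:: o] i = o by case: i => [|[|i]].
  by apply/funext => t; rewrite /polyline no big1 ?addr0// => i _; rewrite !no subrr mulr0.
(* The padded polyline runs through its [n.*2] edges first and then rests at [o]; [phi] gives the
   loop the same pace. *)
pose phi (t : R) := unit_clamp (m%:R * t / n.*2%:R).
have cphi : continuous phi.
  move=> t; apply: (@cts_unit_clamp_comp _ _ (fun t : R => m%:R * t / n.*2%:R)).
  apply: (@cvgM _ _ (nbhs t)); last exact: cvg_cst.
  by apply: (@cvgM _ _ (nbhs t)); [exact: cvg_cst|exact: cvg_id].
have phi0 : phi 0 = 0 by rewrite /phi mulr0 mul0r unit_clamp0.
have phi1 : phi 1 = 1 by rewrite /phi mulr1 unit_clamp1// ler_pdivlMr// mul1r ler_nat.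
apply: (@contractible_reparam _ G h phi) => //.
  by move=> t; exact: unit_clamp_itv.
have Lo k : (n.*2 <= k)%N -> nth o L k = o.
  rewrite leq_eqVlt => /orP[/eqP<-|nk]; first by rewrite nL// Wn pt0.
  by rewrite nth_default// szL.
apply: (@contractible_straight _ G (fun t => h (phi t)) (polyline (nth o L) m) _ _ _ _ _ _ cL).
- move=> t; exact: (@continuous_comp _ _ _ phi h t (cphi t) (ch _)).
- exact: polyline_cts.
- by rewrite phi1 phi0.
- by rewrite polyline0 phi0 nL// W00 pt0.
- by rewrite polyline1 phi0 Lo.
move=> s t s01 t01; have [k [th [km th01 mt ->]]] := polyline_param m0 t01.
rewrite (_ : forall a b : C, a + s%:C * (b - a) = (1 - s)%:C * a + s%:C * b); last first.
  by move=> a b; rewrite rmorphB rmorph1; ring.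
have [kn|kn] := ltnP k n.*2; last first.
  have -> : phi t = 1.
    rewrite /phi unit_clamp1// ler_pdivlMr// mul1r mt.
    have nk : n.*2%:R <= k%:R :> R by rewrite ler_nat.
    by move: nk th01; clear; lra.
  rewrite h1 !Lo ?(leqW kn)// -/o -!mulrDl -!rmorphD !subrK !mul1r.
  by rewrite -mulrDl -rmorphD subrK mul1r.
have [k2 b1 b2] := inBk k kn.
apply: (BG _ (ltnW k2)); apply: convex_box => //; last first.
  by rewrite !nL ?(ltnW kn)//; exact: convex_box.
(* During edge [k] the parameter [phi t] is within [1 / n] of the sample time [tm k./2]. *)
apply: ball_box => //; apply: hd; first exact: tm01 (ltnW k2).
have k1 : k.+1%:R <= n.*2%:R :> R by rewrite ler_nat.
have n2E : n.*2%:R = 2 * n%:R :> R by rewrite -mul2n natrM.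
have kE : k%:R = (odd k)%:R + 2 * (k./2)%:R :> R.
  by rewrite -{1}(odd_double_half k) natrD -mul2n natrM.
have phiE : phi t = (k%:R + th) / n.*2%:R.
  rewrite /phi mt unit_clamp_id//; rewrite divr_ge0 ?addr_ge0 ?(andP th01).1//=.
  by rewrite ler_pdivrMr// mul1r; move: k1 th01; rewrite -natr1; clear; lra.
apply: le_lt_trans nd; rewrite phiE n2E kE /tm.
rewrite (_ : _ - _ = ((odd k)%:R + th) / 2 / n%:R); last by field; rewrite gt_eqF.
rewrite ger0_norm; last by rewrite !divr_ge0// addr_ge0// (andP th01).1.
rewrite ler_pdivrMr// mulVf ?gt_eqF// ler_pdivrMr// mul1r.
by case: (odd k); move: th01; rewrite /=; clear; lra.
Qed.

End LoopSampling.

(** * Spiders' webs *)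

Section SpidersWeb.
Context {R : realType}.
Local Notation C := R[i].
Local Notation N := Normc.normc.
Variables (f : C -> C) (r0 : R).
Hypothesis df : forall z, cdiff f z.
Hypothesis r0_gt0 : 0 < r0.
Hypothesis r0M : forall r, r0 <= r -> r < maxmod f r.
Variable n : nat.
Hypothesis bounded_core : forall m, (n <= m)%N -> bounded_set (core f r0 m).
Implicit Types (z w : C) (E U : set C).

Local Notation level := (level f r0).
Local Notation core := (core f r0).
Local Notation rad := (rad f r0).

Lemma level00 : A_ r0 f = level 0 0.
Proof. by apply/seteqP; split => z h k k0; have := h k k0; rewrite ?addn0. Qed.

Lemma core_boundary_level00 m : boundary (core m) `<=` level 0 0.
Proof. by move=> z /(core_boundary df); exact: (level_m_sub r0M (leq0n m)). Qed.

(** The set stays in a bounded core containing one of its points, since it cannot meet the boundary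
    of that core. *)
Lemma connected_avoiding_bounded U : connected U -> U `&` level 0 0 = set0 -> bounded_set U.
Proof.
move=> cU UE; have [->|/set0P[x Ux]] := eqVneq U set0.
  by apply/bounded_setC_P; exists 0.
have [m xm] := core_cover df r0_gt0 r0M x.
have xnm : core (n + m) x by apply: (core_sub df r0_gt0 r0M) xm; exact: leq_addl.
apply: bounded_subset (bounded_core (leq_addr m n)).
apply: connected_sub_open => //; first exact: core_open.
  by exists x.
by apply/seteqP; split => // z [Uz /core_boundary_level00 Ez]; rewrite -UE.
Qed.

(** All three webs use the same domains, the cores from index [n] on. *)
Lemma web_of_superset E : connected E -> level 0 0 `<=` E -> spiders_web E.
Proof.
move=> cE sE; split => //; exists (fun k => core (n + k)); split.
- move=> k; split; last exact/bounded_core/leq_addr.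
  split; first by split; [exists 0; exact: core0|exact: core_open|exact: core_connected].
  move=> g; apply: hole_free_null_homotopic; first exact: core_open.
  exact: core_hole_free.
- by move=> k; apply: core_sub => //; rewrite leq_add2l.
- by move=> k z /core_boundary_level00; exact: sE.
- apply/seteqP; split => // z _; have [m zm] := core_cover df r0_gt0 r0M z.
  by exists m => //; apply: (core_sub df r0_gt0 r0M) zm; exact: leq_addl.
Qed.

(** The components of the complement also avoid the smaller [level 0 0], hence are bounded. *)
Lemma level_connected L : connected (level 0 L).
Proof.
apply: connected_of_no_bounded_part; [exact: level_closed|exact: level_no_bounded_part|].
move=> x nx; apply: connected_avoiding_bounded; first exact: component_connected.
apply/seteqP; split => // z [/connected_component_sub nz lz]; apply: nz.
by apply: (level_L_sub r0M) lz.
Qed.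

Lemma level00_neq0 : level 0 0 !=set0.
Proof.
have [z dz] : boundary (core n) !=set0.
  apply: boundary_neq0; [exact: core_open|exact: bounded_core|by exists 0; exact: core0].
by exists z; exact: core_boundary_level00 dz.
Qed.

Lemma fast_escapingE : fast_escaping_set r0 f = \bigcup_(L in [set L | (0 < L)%N]) level 0 L.
Proof.
apply/seteqP; split => z [L L0 h]; exists L => // k k0; have := h k k0; by rewrite addn0.
Qed.

Lemma level_sub_fast L : level 0 L `<=` fast_escaping_set r0 f.
Proof.
(* Delays are positive in [fast_escaping_set], hence the successor. *)
move=> z zL; rewrite fast_escapingE; exists L.+1 => //.
exact: (level_L_sub r0M) (leqnSn L) _ zL.
Qed.

Lemma fast_escaping_connected : connected (fast_escaping_set r0 f).
Proof.
rewrite fast_escapingE; apply: bigcup_connected => [|L _]; last exact: level_connected.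
have [z z00] := level00_neq0; exists z => L _.
exact: (level_L_sub r0M) (leq0n L) _ z00.
Qed.

Lemma escaping_setP z : escaping_set f z <->
  forall B : R, exists k0, forall k, (k0 <= k)%N -> B <= N (iter k f z).
Proof.
split => [/cvgryPge h B|h].
  by have [k0 _ hk] := h B; exists k0 => k kk; exact: hk.
by apply/cvgryPge => B; have [k0 hk] := h B; exists k0.
Qed.

Lemma fast_sub_escaping : fast_escaping_set r0 f `<=` escaping_set f.
Proof.
move=> z; rewrite fast_escapingE => -[L _ zL]; apply/escaping_setP => B.
have [m Bm] := rad_unbounded df r0_gt0 r0M B.
exists (m.+1 + L)%N => k mk; have kL : (L <= k)%N by apply: leq_trans mk; exact: leq_addl.
have mk' : (m.+1 <= k - L)%N by rewrite leq_subRL// addnC.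
have := zL (k - L)%N; rewrite subnK// addn0 => /(_ (leq_ltn_trans (leq0n m) mk')).
apply: le_trans; apply: le_trans (ltW Bm) _; apply: rad_le => //; exact: ltnW.
Qed.

(* The iterates of a connected set avoiding the fast escaping set never meet
   the boundaries of the cores, so they all escape if one of its points does. *)
Lemma closure_escaping U z : connected U -> U `&` fast_escaping_set r0 f = set0 ->
  U z -> escaping_set f z -> closure U `<=` escaping_set f.
Proof.
move=> cU UA Uz /escaping_setP ez x clx; apply/escaping_setP => B.
have [m0 Bm0] := rad_unbounded df r0_gt0 r0M B.
pose m := (n + m0)%N.
have Bm : B <= rad m by apply: le_trans (ltW Bm0) _; apply: rad_le => //; exact: leq_addl.
have /bounded_setC_P[r hr] := bounded_core (leq_addr m0 n).
have [k0 hk] := ez (r + 1); exists k0 => k kk; apply: le_trans Bm _.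
have avoid u : U u -> ~ core m (iter k f u).
  move=> Uu cu.
  have : iter k f @` U `<=` core m.
    apply: connected_sub_open; last 2 first.
    - by exists (iter k f u); split => //; exists u.
    - apply/seteqP; split => // _ [[v Uv <-] /core_boundary_level00 lv].
      (* A point sent to the boundary of a core by the [k]-th iterate lies in [level 0 k], hence is
         fast escaping. *)
      suff : (U `&` fast_escaping_set r0 f) v by rewrite UA.
      split => //; apply: (@level_sub_fast k) => j j0; rewrite addn0 iterD.
      by have := lv j j0; rewrite !addn0.
    - have cf v : {for v, continuous (iter k f)} by exact: cdiff_cts (cdiff_iter k v df).
      exact: (connected_continuous_connected cU (continuous_subspaceT cf)).
    - exact: core_open.
  move=> /(_ (iter k f z)) h; have /hr : core m (iter k f z) by apply: h; exists z.
  by have := hk k kk; lra.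
(* A failure at [x] would be shared by a point of [U], which is then mapped into the disc inside the
   core. *)
rewrite leNgt; apply/negP => xk.
have [u [Uu uk]] := clx _ (near_iter_lt df xk).
apply: (avoid u Uu); apply: (disc_sub_core df r0_gt0 r0M).
by rewrite /cball/= subr0.
Qed.

Lemma escaping_not_split (P Q : set C) : escaping_set f = P `|` Q -> separated P Q ->
  fast_escaping_set r0 f `<=` P -> Q !=set0 -> False.
Proof.
set A := fast_escaping_set r0 f; move=> EPQ sPQ AP [z Qz].
have [PQ1 PQ2] := sPQ.
have nclA w : closure A w -> ~ Q w.
  move=> clw Qw; have : (closure P `&` Q) w by split => //; exact: closure_subset clw.
  by rewrite PQ1.
have nz : (~` closure A) z by move=> clz; exact: nclA clz Qz.
have oA : open (~` closure A) by apply: closed_openC; exact: closed_closure.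
pose U := connected_component (~` closure A) z.
have Uz : U z by exact: connected_component_refl.
have cU : connected U by exact: component_connected.
have UA : U `&` A = set0.
  apply/seteqP; split => // w [/connected_component_sub nw Aw].
  by apply: nw; exact: subset_closure.
have bU : bounded_set U.
  apply: connected_avoiding_bounded => //; apply/seteqP; split => // w [Uw lw].
  by rewrite -UA; split => //; exact: level_sub_fast lw.
have [w dw] : boundary U !=set0.
  by apply: boundary_neq0 => //; [exact: component_open|exists z].
have clwA : closure A w by apply: contrapT; exact: (component_boundary oA dw).
have clU : closure U `<=` P `|` Q.
  rewrite -EPQ; apply: closure_escaping cU UA Uz _; rewrite EPQ; by right.
have [UP|UQ] := connected_subset sPQ clU (connected_closure cU).
  have : (closure P `&` Q) z by exact: conj (subset_closure (UP z (subset_closure Uz))) Qz.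
  by rewrite PQ1.
by apply: nclA clwA _; apply: UQ; exact: boundary_sub_closure.
Qed.

Lemma escaping_connected : connected (escaping_set f).
Proof.
apply: contrapT => /connectedPn[B [B0 EB sB]].
have AB : fast_escaping_set r0 f `<=` B false `|` B true.
  by rewrite -EB; exact: fast_sub_escaping.
have [AF|AT] := connected_subset sB AB fast_escaping_connected.
  exact: escaping_not_split EB sB AF (B0 true).
rewrite setUC in EB; rewrite separatedC in sB.
exact: escaping_not_split EB sB AT (B0 false).
Qed.

End SpidersWeb.

Theorem theorem1p4 (R : realType) (f : R[i] -> R[i]) (r0 : R)
    (f_entire : entire f) (f_transcendental : transcendental f)
    (r0_gt0 : 0 < r0) (r0_lt_maxmod : forall r, r0 <= r -> r < maxmod f r)
    (bounded_comp : has_bounded_component (~` A_ r0 f)) :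
  [/\ spiders_web (A_ r0 f),
      spiders_web (fast_escaping_set r0 f) &
      spiders_web (escaping_set f)].
Proof.
have df z : cdiff f z by exact: entire_cdiff.
rewrite level00 in bounded_comp *.
have [n bn] := core_bounded df r0_gt0 r0_lt_maxmod bounded_comp.
split.
- apply: (web_of_superset df r0_gt0 r0_lt_maxmod bn) => //.
  exact: (level_connected df r0_gt0 r0_lt_maxmod bn).
- apply: (web_of_superset df r0_gt0 r0_lt_maxmod bn).
    exact: (fast_escaping_connected df r0_gt0 r0_lt_maxmod bn).
  exact: (level_sub_fast r0_lt_maxmod).
- apply: (web_of_superset df r0_gt0 r0_lt_maxmod bn).
    exact: (escaping_connected df r0_gt0 r0_lt_maxmod bn).
  apply: subset_trans (level_sub_fast r0_lt_maxmod (L := 0)) _.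
  exact: (fast_sub_escaping df r0_gt0 r0_lt_maxmod).
Qed.
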